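(* Let $V_3\subset\mathbb{A}^2_{\mathbb{Q}}$ be the union of the affine curves $E_1:\ -y^2=t^3+2t^2+t+1$ and $E_2:\ y^2(t+1)=t^3+2t^2+t+1$, and let $\pi:V_3\to\mathbb{A}^1$, $(t,y)\mapsto t$. Then $S_0^{(3)}\subseteq \pi(V_3(\mathbb{Q}))$, and $\pi(V_3(\mathbb{Q}))\setminus S_0^{(3)}=\{0,-2\}$.
   Context: For $\gamma,c\in\mathbb{Q}$ let $f_{\gamma,c}(x)=(x-\gamma)^2+c$, and write $f_c=f_{0,c}=x^2+c$; $f^n$ denotes $n$-fold composition. $\operatorname{Gal}(f^n)$ denotes the Galois group over $\mathbb{Q}$ of a splitting field of $f^n$. Say $\operatorname{Gal}(f^n)$ is maximal if $|\operatorname{Gal}(f^n)|=2^{2^n-1}$ (the order of the automorphism group $\operatorname{Aut}(T_n)$ of the complete rooted binary tree of depth $n$, i.e. the $n$-fold iterated wreath product of $\mathbb{Z}/2\mathbb{Z}$). A polynomial $f_{\gamma,c}$ has a small $n$-th iterate ($n\ge 2$) if $\operatorname{Gal}(f_{\gamma,c}^{n-1})$ is maximal but $\operatorname{Gal}(f_{\gamma,c}^n)$ is not. $S_\gamma^{(n)}=\{c\in\mathbb{Q}: f_{\gamma,c}\text{ has a small $n$-th iterate}\}$; in particular $S_0^{(3)}=\{c\in\mathbb{Q}: \operatorname{Gal}((x^2+c)^{\circ 2})\text{ maximal},\ \operatorname{Gal}((x^2+c)^{\circ 3})\text{ not maximal}\}$. *)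

(* Defs.v *)
From HB Require Import structures.
From mathcomp Require Import all_boot all_order all_algebra all_fingroup all_solvable all_field.
Set Implicit Arguments. Unset Strict Implicit. Unset Printing Implicit Defensive.
Import Order.TTheory GRing.Theory Num.Theory.
Local Open Scope ring_scope.

Definition fc (c : rat) : {poly rat} := 'X^2 + c%:P.

Definition fc_iter (c : rat) (n : nat) : {poly rat} :=
  iter n (fun q => q \Po fc c) 'X.

Definition gal_order_is (p : {poly rat}) (m : nat) : Prop :=
  exists L : splittingFieldType rat,
    splittingFieldFor 1%VS (map_poly (in_alg L) p) fullv /\
    #|'Gal(fullv / 1%VS : {subfield L})|%g = m.

(* Gal(p) is maximal, for p = f^n : order 2^(2^n - 1) = |Aut(T_n)| *)
Definition gal_maximal (p : {poly rat}) (n : nat) : Prop :=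
  gal_order_is p (2 ^ (2 ^ n - 1))%N.

Definition S0_3 (c : rat) : Prop :=
  gal_maximal (fc_iter c 2) 2 /\ ~ gal_maximal (fc_iter c 3) 3.

Definition onE1 (t y : rat) : Prop := - y ^+ 2 = t ^+ 3 + 2 * t ^+ 2 + t + 1.
Definition onE2 (t y : rat) : Prop := y ^+ 2 * (t + 1) = t ^+ 3 + 2 * t ^+ 2 + t + 1.
Definition piV3 (t : rat) : Prop := exists y : rat, onE1 t y \/ onE2 t y.

(* Main.v *)
Require Import Defs.
From HB Require Import structures.
From Stdlib Require Import ZArith Lia Ring Setoid Morphisms List Znumtheory Reals Lra.
From mathcomp Require Import all_boot all_order all_algebra all_fingroup all_solvable all_field.
Import Order.TTheory GRing.Theory Num.Theory.

(* Put [g = t^3 + 2t^2 + t + 1], so that [f^3(0) = c g(c)]. Climbing the tower of quadratic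
   extensions generated by the roots of the iterates and taking norms shows that
   [Gal(f^2)] is maximal iff [-c], [c^2 + c], [-(c + 1)] are not squares, and that then
   [Gal(f^3)] is maximal iff none of [c g], [-c * c g], [(c^2 + c) * c g], [-(c + 1) * c g] is
   a square. The second and third conditions are the curves [E1] and [E2]. The fourth value is
   a square only if [-c] is, by coprimality, and [c g] is a square only for [c = 0].

   What remains are the points of [E1] and [E2] with [-t], [t (t + 1)] or [-(t + 1)] a
   square. They lead to [t g = y^2] again, to the genus 2 curve [y^2 = s^6 + s^4 - 1], and to
   [r^2 + s^2 = 1], [y^2 = 1 - s^2 r^4]. All are treated in [Z[th]], [th^3 + th^2 = 1], the
   ring of integers of the cubic field of discriminant -23, which is norm-Euclidean with
   units [+- th^k]. The sextic has a Jacobian of rank 2; its two coverings are Jacobi quartics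
   [y^2 = 1 + A s^2 + B s^4] over [Z[th]]. For a point with [s] divisible by [2], repeated
   descent along the 2-isogenies fixes the residue mod 2 of [s] divided by its power of 2 (a
   2-adic Chabauty argument), and a rational [s] other than the known one has the wrong residue. *)

(** * The cubic ring and the descents *)

(** The cubic field enters because [g = t (t + 1)^2 + 1] has the root [-1 - th]: in lowest terms the
    values of [g] are, up to sign, norms of forms [p - q th], and a square value puts the form into
    a square class of units. As [2] is inert, with residue field [F_8], and none of [-1], [th],
    [-th] is a square modulo [4], congruences modulo [4] kill most classes. The surviving classes
    contain known points, so no congruence can remove them. On the sextic, rank equals genus, which
    blocks Chabauty over the rationals; over [Z[th]] the extra information is that [s] is rational.
    Near the origin doubling multiplies the parameter by [2] up to higher order, so halving a point
    preserves the residue of [s] divided by its power of [2]. The bottom of the descent allows a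
    single residue [rho], while a quotient of odd integers has residue [1]. These descents run on
    the exponent of [2] in the parameter; only [t g = y^2] is treated by descent on size. *)

Module Zth.
Delimit Scope Z_scope with ZZ.
Delimit Scope R_scope with RR.
Local Open Scope Z_scope.

(* [Zt a b c] is [a + b th + c th^2] with [th^3 = 1 - th^2]; [thi] is [th^-1]. *)
Record zt := Zt { c0 : Z; c1 : Z; c2 : Z }.

Declare Scope zt_scope.
Delimit Scope zt_scope with zt.
Bind Scope zt_scope with zt.

Definition inj (n : Z) : zt := Zt n 0 0.
Definition add (x y : zt) := Zt (c0 x + c0 y) (c1 x + c1 y) (c2 x + c2 y).
Definition opp (x : zt) := Zt (- c0 x) (- c1 x) (- c2 x).
Definition sub (x y : zt) := add x (opp y).
Definition mul (x y : zt) :=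
  let d0 := c0 x * c0 y in
  let d1 := c0 x * c1 y + c1 x * c0 y in
  let d2 := c0 x * c2 y + c1 x * c1 y + c2 x * c0 y in
  let d3 := c1 x * c2 y + c2 x * c1 y in
  let d4 := c2 x * c2 y in
  Zt (d0 + d3 - d4) (d1 + d4) (d2 - d3 + d4).
Definition th := Zt 0 1 0.
Definition thi := Zt 0 1 1.

Infix "+" := add : zt_scope.
Infix "-" := sub : zt_scope.
Infix "*" := mul : zt_scope.
Notation "- x" := (opp x) : zt_scope.
Notation "0" := (inj 0) : zt_scope.
Notation "1" := (inj 1) : zt_scope.

Lemma zt_eq (x y : zt) : c0 x = c0 y -> c1 x = c1 y -> c2 x = c2 y -> x = y.
Proof. by destruct x, y; simpl; intros -> -> ->. Qed.

Lemma zt_rt : ring_theory (inj 0) (inj 1) add mul sub opp eq.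
Proof.
split; intros; apply: zt_eq; cbv [mul add sub opp inj c0 c1 c2]; ring.
Qed.

Lemma inj_morph : ring_morph (inj 0) (inj 1) add mul sub opp eq
  Z0 (Zpos xH) Z.add Z.mul Z.sub Z.opp Z.eqb inj.
Proof.
split; intros; try (apply: zt_eq; cbv [mul add sub opp inj c0 c1 c2]; ring).
by move/Z.eqb_eq: H => ->.
Qed.

Ltac inj_cst t :=
  match t with
  | inj ?z => match isZcst z with true => z | _ => constr:(InitialRing.NotConstant) end
  | _ => constr:(InitialRing.NotConstant)
  end.

Add Ring zt_ring : zt_rt (morphism inj_morph, constants [inj_cst]).

Local Open Scope zt_scope.

Lemma th3 : th * th * th = inj 1 - th * th.
Proof. by []. Qed.

Lemma injM m n : inj (m * n) = inj m * inj n.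
Proof. apply: zt_eq; cbv [mul inj c0 c1 c2]; ring. Qed.

Lemma injD m n : inj (m + n) = inj m + inj n.
Proof. by []. Qed.

(** * The norm form *)

Definition adj (x : zt) : zt :=
  let a := c0 x in let b := c1 x in let c := c2 x in
  Zt (a * (a - b + c) - c * (b - c))%ZZ (c * c - b * (a - b + c))%ZZ (b * (b - c) - a * c)%ZZ.
(** The constant coordinate of [x * adj x], where [adj x] is the product of the two other conjugates
    of [x]. *)
Definition norm (x : zt) : Z :=
  (c0 x * c0 (adj x) + c2 x * c1 (adj x) + (c1 x - c2 x) * c2 (adj x))%ZZ.

Lemma mul_adj x : x * adj x = inj (norm x).
Proof. apply: zt_eq; cbv [norm adj mul add sub opp inj c0 c1 c2]; ring. Qed.

Lemma normM x y : norm (x * y) = (norm x * norm y)%ZZ.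
Proof. cbv [norm adj mul add sub opp inj c0 c1 c2]; ring. Qed.

(** This says that [2] is inert: the norm form has no zero over [F_2] except the origin. *)
Lemma norm_even x : Z.even (norm x) = true ->
  [/\ Z.even (c0 x) = true, Z.even (c1 x) = true & Z.even (c2 x) = true].
Proof.
rewrite /norm /adj /= !(Z.even_add, Z.even_sub, Z.even_mul).
by case: (Z.even _); case: (Z.even _); case: (Z.even _).
Qed.

Lemma half x : [/\ Z.even (c0 x) = true, Z.even (c1 x) = true & Z.even (c2 x) = true] ->
  exists y, x = inj 2 * y.
Proof.
case: x => x0 x1 x2 /=; case=> /Z.even_spec [a ha] /Z.even_spec [b hb] /Z.even_spec [c hc].
exists (Zt a b c); apply: zt_eq; cbv [mul inj c0 c1 c2]; lia.
Qed.

(** Infinite descent by halving: a zero of the norm has even coordinates, and its half is again a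
    zero. *)
Lemma norm_eq0 x : norm x = 0%ZZ -> x = 0.
Proof.
have [n hn] : exists n : nat, (Z.abs (c0 x) + Z.abs (c1 x) + Z.abs (c2 x) <= Z.of_nat n)%ZZ.
  by exists (Z.to_nat (Z.abs (c0 x) + Z.abs (c1 x) + Z.abs (c2 x))); lia.
elim: n x hn => [|n IH] x hn h0.
  by apply: zt_eq => /=; lia.
have /half[y hy] : [/\ Z.even (c0 x) = true, Z.even (c1 x) = true & Z.even (c2 x) = true].
  by apply: norm_even; rewrite h0.
have hny : norm y = 0%ZZ.
  have : norm x = (8 * norm y)%ZZ by rewrite hy normM.
  lia.
case: (Z.eq_dec (Z.abs (c0 x) + Z.abs (c1 x) + Z.abs (c2 x)) 0) => [h|h].
  by apply: zt_eq => /=; lia.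
suff y0 : y = 0 by rewrite hy y0; ring.
apply: IH => //.
move: hn h; rewrite hy; case: (y) => y0 y1 y2; cbv [mul inj c0 c1 c2]; lia.
Qed.

Lemma mul_eq0 x y : x * y = 0 -> x = 0 \/ y = 0.
Proof.
move=> h; have : (norm x * norm y = 0)%ZZ by rewrite -normM h.
by move/Z.mul_eq_0 => [] /norm_eq0; [left|right].
Qed.

Lemma mulI x y z : x <> 0 -> x * y = x * z -> y = z.
Proof.
move=> x0 h; have : x * (y - z) = 0 by ring_simplify; rewrite h; ring.
case/mul_eq0 => // h2; have -> : y = (y - z) + z by ring.
by rewrite h2; ring.
Qed.


(** * Norm-Euclidean division *)

Ltac ztz := apply: zt_eq; cbv [mul add sub opp inj th thi c0 c1 c2].

(* Bounds [norm (v + e)] for [e] in the unit cube by the Taylor expansion at [v]. *)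
Definition taylor_bound (v : zt) : Z :=
  let a := c0 v in let b := c1 v in let c := c2 v in
  (Z.abs (norm v) + (Z.abs (3*a*a - 2*a*b + 2*a*c - 3*b*c + 2*c*c)
   + Z.abs (3*b*b - a*a - 3*a*c - 2*b*c) + Z.abs (3*c*c + a*a - 3*a*b + 4*a*c - b*b))
   + (Z.abs (3*a - b + c) + Z.abs (3*b - c) + Z.abs (3*c + 2*a)
   + Z.abs (2*a + 3*c) + Z.abs (2*a - 3*b + 4*c) + Z.abs (3*a + 2*b)) + 11)%ZZ.

Lemma abs_mul_le (a x y : Z) : (Z.abs x <= y)%ZZ -> (Z.abs (a * x) <= y * Z.abs a)%ZZ.
Proof. by rewrite Z.abs_mul; nia. Qed.

Lemma abs_mul_le2 (x y X Y : Z) : (Z.abs x <= X)%ZZ -> (Z.abs y <= Y)%ZZ ->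
  (Z.abs (x * y) <= X * Y)%ZZ.
Proof.
move=> hx hy; rewrite Z.abs_mul.
by apply: Z.mul_le_mono_nonneg => //; apply: Z.abs_nonneg.
Qed.

(** [n] is a denominator: [e / n] lies in the cube [[-1, 1]^3]. The cubic form is expanded exactly
    at [v]; the last term is [norm e], whose coefficients have absolute values with sum [11]. *)
Lemma norm_taylor n v e : (0 < n)%ZZ ->
  (Z.abs (c0 e) <= n)%ZZ -> (Z.abs (c1 e) <= n)%ZZ -> (Z.abs (c2 e) <= n)%ZZ ->
  (Z.abs (norm (inj n * v + e)) <= n * n * n * taylor_bound v)%ZZ.
Proof.
case: v e => a b c [x y z] n0; cbn [c0 c1 c2] => hx hy hz.
pose N3 := (n * n * n)%ZZ.
have h2 u v : (Z.abs u <= n)%ZZ -> (Z.abs v <= n)%ZZ -> (Z.abs (n * (u * v)) <= N3)%ZZ.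
  move=> hu hv; rewrite /N3 -Z.mul_assoc; apply: abs_mul_le2; first by lia.
  exact: abs_mul_le2.
have h1 u : (Z.abs u <= n)%ZZ -> (Z.abs (n * n * u) <= N3)%ZZ.
  by move=> hu; apply: abs_mul_le2 => //; apply: abs_mul_le2; lia.
have h3 u v w : (Z.abs u <= n)%ZZ -> (Z.abs v <= n)%ZZ -> (Z.abs w <= n)%ZZ ->
    (Z.abs (u * v * w) <= N3)%ZZ.
  by move=> hu hv hw; apply: abs_mul_le2 => //; apply: abs_mul_le2.
have t1 w u : (Z.abs u <= n)%ZZ -> (Z.abs (w * (n * n * u)) <= N3 * Z.abs w)%ZZ.
  by move=> hu; apply: abs_mul_le; apply: h1.
have t2 w u v : (Z.abs u <= n)%ZZ -> (Z.abs v <= n)%ZZ ->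
    (Z.abs (w * (n * (u * v))) <= N3 * Z.abs w)%ZZ.
  by move=> hu hv; apply: abs_mul_le; apply: h2.
have -> : norm (inj n * Zt a b c + Zt x y z) =
  (norm (Zt a b c) * N3
   + ((3*a*a - 2*a*b + 2*a*c - 3*b*c + 2*c*c) * (n * n * x)
      + (3*b*b - a*a - 3*a*c - 2*b*c) * (n * n * y)
      + (3*c*c + a*a - 3*a*b + 4*a*c - b*b) * (n * n * z))
   + ((3*a - b + c) * (n * (x * x)) + (3*b - c) * (n * (y * y)) + (3*c + 2*a) * (n * (z * z))
      - (2*a + 3*c) * (n * (x * y)) + (2*a - 3*b + 4*c) * (n * (x * z)) - (3*a + 2*b) * (n * (y * z)))
   + (x*x*x + y*y*y + z*z*z - x*x*y + x*x*z - 3*(x*y*z) + 2*(x*z*z) - y*y*z))%ZZ.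
  rewrite /N3; cbv [norm adj mul add inj c0 c1 c2]; ring.
have s0 : (Z.abs (norm (Zt a b c) * N3) = N3 * Z.abs (norm (Zt a b c)))%ZZ.
  by rewrite Z.abs_mul Z.mul_comm /N3; congr Z.mul; rewrite Z.abs_eq; nia.
rewrite /taylor_bound -/N3; cbn [c0 c1 c2].
rewrite !Z.mul_add_distr_l.
have l1 := t1 (3*a*a - 2*a*b + 2*a*c - 3*b*c + 2*c*c)%ZZ x hx.
have l2 := t1 (3*b*b - a*a - 3*a*c - 2*b*c)%ZZ y hy.
have l3 := t1 (3*c*c + a*a - 3*a*b + 4*a*c - b*b)%ZZ z hz.
have q1 := t2 (3*a - b + c)%ZZ x x hx hx.
have q2 := t2 (3*b - c)%ZZ y y hy hy.
have q3 := t2 (3*c + 2*a)%ZZ z z hz hz.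
have q4 := t2 (2*a + 3*c)%ZZ x y hx hy.
have q5 := t2 (2*a - 3*b + 4*c)%ZZ x z hx hz.
have q6 := t2 (3*a + 2*b)%ZZ y z hy hz.
have := (h3 x x x hx hx hx, h3 y y y hy hy hy, h3 z z z hz hz hz, h3 x x y hx hx hy,
  h3 x x z hx hx hz, h3 x y z hx hy hz, h3 x z z hx hz hz, h3 y y z hy hy hz).
move=> [[[[[[[w1 w2] w3] w4] w5] w6] w7] w8].
clear t1 t2 h1 h2 h3 hx hy hz.
have s0' : (Z.abs (norm (Zt a b c) * N3) <= N3 * Z.abs (norm (Zt a b c)))%ZZ by rewrite s0; lia.
clear s0; move: s0' l1 l2 l3 q1 q2 q3 q4 q5 q6 w1 w2 w3 w4 w5 w6 w7 w8.
rewrite !Z.abs_le.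
(* All products become atoms, so that the remaining triangle inequality is linear. *)
repeat (let X := fresh "X" in set X := (N3 * Z.abs _)%ZZ; move: X => X).
set A0 := (norm _ * N3)%ZZ.
set A1 := (_ * (n * n * x))%ZZ. set A2 := (_ * (n * n * y))%ZZ. set A3 := (_ * (n * n * z))%ZZ.
set D1 := (_ * (n * (x * x)))%ZZ. set D2 := (_ * (n * (y * y)))%ZZ. set D3 := (_ * (n * (z * z)))%ZZ.
set D4 := (_ * (n * (x * y)))%ZZ. set D5 := (_ * (n * (x * z)))%ZZ. set D6 := (_ * (n * (y * z)))%ZZ.
set W1 := (x * x * x)%ZZ. set W2 := (y * y * y)%ZZ. set W3 := (z * z * z)%ZZ. set W4 := (x * x * y)%ZZ.
set W5 := (x * x * z)%ZZ. set W6 := (x * y * z)%ZZ. set W7 := (x * (z * z))%ZZ. set W8 := (y * y * z)%ZZ.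
rewrite -[(x * z * z)%ZZ]Z.mul_assoc -/W7.
move: N3 A0 A1 A2 A3 D1 D2 D3 D4 D5 D6 W1 W2 W3 W4 W5 W6 W7 W8.
clear; intros.
lia.
Qed.

(* Every point of each third-size subcube of the unit cube is at distance of norm less than [1]
   from a vertex of the unit cube; coordinates are scaled by [6]. *)
Definition small_cubes : bool :=
  let r3 := [:: 0; 1; 2]%ZZ in let r2 := [:: 0; 1]%ZZ in
  List.forallb (fun i => List.forallb (fun j => List.forallb (fun l =>
    List.existsb (fun i' => List.existsb (fun j' => List.existsb (fun l' =>
      (taylor_bound (inj 2 * Zt i j l + Zt 1 1 1 - inj 6 * Zt i' j' l') <? 216)%ZZ) r2) r2) r2) r3) r3) r3.

Lemma euclid x y : y <> 0 -> exists q, (Z.abs (norm (x - q * y)) < Z.abs (norm y))%ZZ.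
Proof.
move=> y0; have ny : norm y <> 0%ZZ by move/norm_eq0.
pose n := Z.abs (norm y); have n0 : (0 < n)%ZZ by rewrite /n; lia.
(* [g / n] is the quotient [x / y] with a positive integer denominator. *)
pose g := x * adj y * inj (Z.sgn (norm y)).
have gy : g * y = inj n * x.
  have -> : g * y = (y * adj y) * inj (Z.sgn (norm y)) * x by rewrite /g; ring.
  by rewrite mul_adj -injM (_ : norm y * Z.sgn (norm y) = n)%ZZ // /n; lia.
(* [k] tells in which third of the unit interval the fractional part of [t / n] lies, and [e / n] is
   six times its offset from the middle of that third. *)
pose k t := ((3 * (t mod n)) / n)%ZZ.
pose e t := (6 * (t mod n) - (2 * k t + 1) * n)%ZZ.
have hk t : List.In (k t) [:: 0; 1; 2]%ZZ.
  have := Z.mod_pos_bound t n n0; move=> hm.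
  have : (0 <= k t < 3)%ZZ.
    split; first by apply: Z.div_pos; lia.
    by apply: Z.div_lt_upper_bound; lia.
  by move=> h; rewrite /=; lia.
have he t : (Z.abs (e t) <= n)%ZZ.
  have := Z.div_mod (3 * (t mod n)) n ltac:(lia).
  have := Z.mod_pos_bound (3 * (t mod n)) n n0.
  rewrite /e -/(k t); lia.
have : small_cubes = true by vm_compute.
rewrite /small_cubes => /List.forallb_forall /(_ _ (hk (c0 g))).
move=> /List.forallb_forall /(_ _ (hk (c1 g))) /List.forallb_forall /(_ _ (hk (c2 g))).
move=> /List.existsb_exists [i [_]] /List.existsb_exists [j [_]] /List.existsb_exists [l [_]].
move=> /Z.ltb_lt hb.
set v := (inj 2 * _ + _ - _) in hb.
pose q := Zt (c0 g / n)%ZZ (c1 g / n)%ZZ (c2 g / n)%ZZ + Zt i j l.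
pose w := Zt (e (c0 g)) (e (c1 g)) (e (c2 g)).
exists q.
have key : inj 6 * (g - inj n * q) = inj n * v + w.
  have d t := Z.div_mod t n ltac:(lia).
  rewrite /q /v /w /e; move: (d (c0 g)) (d (c1 g)) (d (c2 g)).
  case: (g) => g0 g1 g2; cbn [c0 c1 c2] => d0 d1 d2.
  ztz; [rewrite {1}d0 | rewrite {1}d1 | rewrite {1}d2]; ring.
have b1 : (Z.abs (norm (inj 6 * (g - inj n * q))) <= n * n * n * taylor_bound v)%ZZ.
  by rewrite key; apply: norm_taylor => //; apply: he.
have b2 : (Z.abs (norm (g - inj n * q)) < n * n * n)%ZZ.
  move: b1; rewrite normM Z.abs_mul (_ : Z.abs (norm (inj 6)) = 216)%ZZ //.
  have : (0 < n * n * n)%ZZ by nia.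
  nia.
have b3 : (norm (x - q * y) * (n * n * n) = norm (g - inj n * q) * norm y)%ZZ.
  have <- : norm (inj n) = (n * n * n)%ZZ by cbv [norm adj inj c0 c1 c2]; ring.
  rewrite -!normM; congr norm.
  have -> : (g - inj n * q) * y = g * y - inj n * q * y by ring.
  by rewrite gy; ring.
move: (f_equal Z.abs b3); rewrite !Z.abs_mul -/n (Z.abs_eq n); last by lia.
have : (0 < n * n * n)%ZZ by nia.
by nia.
Qed.



(** These three lemmas take explicit cofactors and reduce an equality under equational hypotheses to
    a [ring] identity. *)
Lemma lincomb1 k a b p q : a = b -> p - q = k * (a - b) -> p = q.
Proof.
move=> -> h; have -> : p = (p - q) + q by ring.
by rewrite h; ring.
Qed.

Lemma lincomb2 k l a b c d p q : a = b -> c = d ->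
  p - q = k * (a - b) + l * (c - d) -> p = q.
Proof.
move=> -> -> h; have -> : p = (p - q) + q by ring.
by rewrite h; ring.
Qed.

Lemma lincomb3 k l m a b c d e f p q : a = b -> c = d -> e = f ->
  p - q = k * (a - b) + l * (c - d) + m * (e - f) -> p = q.
Proof.
move=> -> -> -> h; have -> : p = (p - q) + q by ring.
by rewrite h; ring.
Qed.

Arguments lincomb1 k {a b p q}.
Arguments lincomb2 k l {a b c d p q}.
Arguments lincomb3 k l m {a b c d e f p q}.

(** * Divisibility, coprime factors of squares, primes *)

Definition dvd (x y : zt) := exists z, y = x * z.
Definition coprime (x y : zt) := exists u v, u * x + v * y = 1.
Definition unit (u : zt) := exists v, u * v = 1.

Lemma coprime_sym x y : coprime x y -> coprime y x.
Proof. by move=> [u [v h]]; exists v, u; rewrite -h; ring. Qed.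

Lemma coprimeM x y z : coprime x y -> coprime x z -> coprime x (y * z).
Proof.
move=> [u [v h]] [u' [v' h']]; exists (u * u' * x + u * v' * z + v * y * u'), (v * v').
have -> : 1 = (u * x + v * y) * (u' * x + v' * z) by rewrite h h'; ring.
ring.
Qed.

Lemma coprime_dvdr x y z : coprime x y -> dvd z y -> coprime x z.
Proof. by move=> [u [v h]] [w e]; exists u, (v * w); rewrite -h e; ring. Qed.

Lemma coprime_gauss x y z : coprime x y -> dvd x (y * z) -> dvd x z.
Proof.
move=> [u [v h]] [w e]; exists (u * z + v * w).
by apply: (lincomb2 (- z) v h e); ring.
Qed.

Lemma bezout x y : exists g u v, [/\ g = u * x + v * y, dvd g x & dvd g y].
Proof.
have [n] : exists n : nat, (Z.abs (norm y) < Z.of_nat n)%ZZ.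
  by exists (Z.to_nat (Z.abs (norm y) + 1)); lia.
elim: n x y => [|n IH] x y hn; first by lia.
have [y0|y0] : y = 0 \/ y <> 0.
  case: (Z.eq_dec (norm y) 0) => [/norm_eq0|h]; first by left.
  by right => e; apply: h; rewrite e.
  exists x, 1, 0; rewrite y0; split; [ring | by exists 1; ring | by exists 0; ring].
have [q hq] := euclid x _ y0.
have [g [u [v [e [s hs] [t ht]]]]] := IH y (x - q * y) ltac:(lia).
exists g, v, (u - v * q); split; first by rewrite e; ring.
- by exists (t + q * s); apply: (lincomb2 1 q ht hs); ring.
- by exists s.
Qed.

Lemma gcd_split x y : x <> 0 -> exists g a b, [/\ x = g * a, y = g * b, coprime a b & g <> 0].
Proof.
move=> x0; have [g [u [v [e [a ha] [b hb]]]]] := bezout x y.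
have g0 : g <> 0 by move=> g0; apply: x0; rewrite ha g0; ring.
exists g, a, b; split=> //; exists u, v.
by apply: (mulI g) => //; apply: (lincomb3 (inj (-1)) (-u) (-v) e ha hb); ring.
Qed.

(** With [g] a gcd of [x] and [z], [x = g x1] and [z = g z1], one has [x1 y = g z1^2]. Coprimality
    of [x1] and [z1] gives that [x1] divides [g], that of [x] and [y] gives that [g] divides [x1];
    so [x] is a unit times [g^2]. *)
Lemma sq_split x y z : coprime x y -> x * y = z * z -> z <> 0 ->
  exists u u' g c, [/\ u * u' = 1, x = u * (g * g), y = u' * (c * c) & z = g * c].
Proof.
move=> [s [t cop]] e z0.
have [g [x1 [z1 [hx hz [p [q cop1]] g0]]]] : exists g a b, [/\ x = g * a, z = g * b, coprime a b & g <> 0].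
  apply: gcd_split => x0; have /mul_eq0 : z * z = 0 by rewrite -e x0; ring.
  by case.
have e1 : x1 * y = g * z1 * z1.
  by apply: (mulI g) => //; apply: (lincomb3 1 (- y) (z + g * z1) e hx hz); ring.
pose w := g * p * p * x1 + inj 2 * g * p * q * z1 + q * q * y.
have hw : g = x1 * w.
  apply: (lincomb2 (- g * (p * x1 + q * z1 + 1)) (- q * q) cop1 e1).
  by rewrite /w; ring.
pose u := s * x1 * x1 + t * z1 * z1.
have hu : x1 = g * u.
  apply: (lincomb3 (- x1) t (s * x1) cop e1 hx).
  by rewrite /u; ring.
exists u, w, g, z1; split=> //.
- apply: (mulI g) => //; apply: (lincomb2 (- w) (inj (-1)) hu hw); ring.
- by rewrite hx hu; ring.
apply: (mulI x1) => [x10|]; first by apply: g0; rewrite hw x10; ring.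
rewrite e1; apply: (lincomb1 (z1 * z1) hw); ring.
Qed.

Lemma coprime_pow x y : coprime x y -> coprime x (y * y * (y * y)).
Proof. by move=> h; do !apply: coprimeM. Qed.

Lemma sq_dvd g z : g <> 0 -> dvd (g * g) (z * z) -> dvd g z.
Proof.
move=> g0 [k hk]; have [d [a [b [ha hb ab d0]]]] := gcd_split g z g0.
have e : b * b = a * a * k.
  apply: (mulI d) => //; apply: (mulI d) => //.
  by apply: (lincomb3 (k * (g + d * a)) (- (z + d * b)) 1 ha hb hk); ring.
have [u [v uv]] : coprime a b by [].
have [s [t st]] : coprime a (b * b) by apply: coprimeM.
exists (b * (s + t * a * k)).
apply: (lincomb3 1 (- b * d) (t * d * b) hb st e) => //.
rewrite ha; ring.
Qed.

Lemma norm1_unit x : Z.abs (norm x) = 1%ZZ -> unit x.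
Proof.
move=> h; exists (adj x * inj (norm x)).
have -> : x * (adj x * inj (norm x)) = (x * adj x) * inj (norm x) by ring.
by rewrite mul_adj -injM (_ : (norm x * norm x = 1)%ZZ) //; lia.
Qed.

Lemma unit_norm x : unit x -> Z.abs (norm x) = 1%ZZ.
Proof.
move=> [v h]; have : (norm x * norm v = 1)%ZZ by rewrite -normM h.
by move/Z.mul_eq_1; lia.
Qed.

(** A gcd of [p] and [x] has norm [1] or that of [p] in absolute value; in the latter case it is
    associated to [p]. *)
Lemma prime_coprime p x : Znumtheory.prime (Z.abs (norm p)) -> ~ dvd p x -> coprime p x.
Proof.
move=> pp ndv; have [g [u [v [e [a ha] [b hb]]]]] := bezout p x.
have nn : (Z.abs (norm p) = Z.abs (norm g) * Z.abs (norm a))%ZZ.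
  by rewrite -Z.abs_mul -normM -ha.
have : (Z.abs (norm g) | Z.abs (norm p))%ZZ by exists (Z.abs (norm a)); rewrite nn; ring.
move/(prime_divisors _ pp) => h.
have [h1|h1] : Z.abs (norm g) = 1%ZZ \/ Z.abs (norm g) = Z.abs (norm p) by lia.
  have [w hw] := norm1_unit g h1.
  by exists (w * u), (w * v); apply: (lincomb2 1 (- w) hw e); ring.
case: ndv; have [p2 _] := pp.
have [w hw] : unit a by apply: norm1_unit; rewrite h1 in nn; nia.
exists (w * b); rewrite hb ha; apply: (lincomb1 (- g * b) hw); ring.
Qed.

Lemma prime_dvdM p x y : Znumtheory.prime (Z.abs (norm p)) -> dvd p (x * y) -> dvd p x \/ dvd p y.
Proof.
move=> pp h; have [hx|hx] : dvd p x \/ ~ dvd p x.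
  by apply: Classical_Prop.classic.
- by left.
- by right; apply: coprime_gauss h; apply: prime_coprime.
Qed.

(** * Units modulo squares *)

Section RealEmbedding.
Local Open Scope R_scope.

Lemma real_root : exists r : R, r * r * r = 1 - r * r /\ 0.754 < r < 0.756.
Proof.
have [||||r [[h1 h2] h3]] := IVT (fun x => x * x * x + x * x - 1) 0.754 0.756; try lra.
  by reg.
exists r; split; first by lra.
split.
  by case: h1 => // e; rewrite -e in h3; lra.
by case: h2 => // e; rewrite e in h3; lra.
Qed.

Variable r : R.
Hypothesis r3 : r * r * r = 1 - r * r.
Hypothesis rb : 0.754 < r < 0.756.

Definition ev (x : zt) : R := IZR (c0 x) + IZR (c1 x) * r + IZR (c2 x) * (r * r).

Lemma evM x y : ev (mul x y) = ev x * ev y.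
Proof.
case: x y => a b c [x y z]; cbv [ev mul c0 c1 c2].
rewrite !(plus_IZR, minus_IZR, mult_IZR); ring [r3].
Qed.

Lemma ev_inj n : ev (inj n) = IZR n.
Proof. by cbv [ev inj c0 c1 c2]; ring. Qed.

(* [ev (adj x)] is the squared modulus of the complex embedding of [x]. *)
Lemma ev_adj x : let a := IZR (c0 x) in let b := IZR (c1 x) in let c := IZR (c2 x) in
  4 * ev (adj x) = (2 * a - b * (1 + r) + c * (1 - r * r)) * (2 * a - b * (1 + r) + c * (1 - r * r))
   + (3 * (r * r) + 2 * r - 1) * ((b - c * (1 + r)) * (b - c * (1 + r))).
Proof.
case: x => a b c; cbv [ev adj c0 c1 c2].
rewrite !(plus_IZR, minus_IZR, mult_IZR); ring [r3].
Qed.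

Lemma sq_bound (x m : R) : 0 <= m -> x * x <= m * m -> - m <= x <= m.
Proof. move=> *; split; nra. Qed.

(** Both embeddings are bounded: the real one by [r^-2 < 1.76], and the complex one by [1], since
    its squared modulus is the inverse of [Rabs (ev x)]. Bounded embeddings bound the
    coordinates. *)
Lemma small_unit_coef x : Z.abs (norm x) = 1%ZZ -> 1 <= Rabs (ev x) -> Rabs (ev x) * (r * r) < 1 ->
  (-1 <= c2 x <= 1 /\ -1 <= c1 x <= 1 /\ -3 <= c0 x <= 3)%ZZ.
Proof.
move=> hn h1 h2.
have e : Rabs (ev x) * Rabs (ev (adj x)) = 1.
  by rewrite -Rabs_mult -evM mul_adj ev_inj -abs_IZR hn.
have ub : Rabs (ev x) < 1.76 by nra.
have e0 : 0 <= 4 * ev (adj x).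
  have := ev_adj x; rewrite /=.
  set P := (_ - _ + _); set Q := (_ - _ * (1 + r)) => ->.
  have hr : 0 < 3 * (r * r) + 2 * r - 1 by nra.
  have := Rmult_le_pos _ _ (Rlt_le _ _ hr) (Rle_0_sqr Q).
  by have := Rle_0_sqr P; rewrite /Rsqr; lra.
rewrite (Rabs_pos_eq (ev (adj x))) in e; last by lra.
have e1 : ev (adj x) <= 1 by nra.
have := ev_adj x; rewrite /=; move: ub; rewrite {1}/ev.
move: (c0 x) (c1 x) (c2 x) => a b c.
set A := IZR a; set B := IZR b; set C := IZR c.
move=> ub hq.
have [u1 u2] : -1.76 <= A + B * r + C * (r * r) <= 1.76.
  by move/Rabs_def2: ub => [? ?]; lra.
have [x1 x2] : - (1.35) <= B - C * (1 + r) <= 1.35.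
  apply: sq_bound; first lra.
  have := Rle_0_sqr (2 * A - B * (1 + r) + C * (1 - r * r)).
  have hr : 2.2 < 3 * (r * r) + 2 * r - 1 by nra.
  have := Rmult_le_compat_r _ _ _ (Rle_0_sqr (B - C * (1 + r))) (Rlt_le _ _ hr).
  by rewrite /Rsqr; lra.
have [y1 y2] : - (2) <= 2 * A - B * (1 + r) + C * (1 - r * r) <= 2.
  apply: sq_bound; first lra.
  have hr : 0 < 3 * (r * r) + 2 * r - 1 by nra.
  have := Rmult_le_pos _ _ (Rlt_le _ _ hr) (Rle_0_sqr (B - C * (1 + r))).
  by rewrite /Rsqr; lra.
(* Twice the real embedding minus twice the real part of the complex one eliminates [A];
   [5.52 = 2 * 1.76 + 2]. The imaginary part, through [x1] and [x2], then eliminates [B]. *)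
have [v1 v2] : -5.52 <= B * (1 + 3 * r) + C * (3 * (r * r) - 1) <= 5.52 by lra.
have [w1 w2] : -10 <= C * (6 * (r * r) + 4 * r) <= 10.
  have -> : C * (6 * (r * r) + 4 * r) = (B * (1 + 3 * r) + C * (3 * (r * r) - 1)) - (1 + 3 * r) * (B - C * (1 + r)) by ring.
  split; nra.
have hc : (-1 <= c <= 1)%ZZ.
  have : -2 < C < 2 by split; nra.
  by move=> [/lt_IZR ? /lt_IZR ?]; lia.
have hb : (-1 <= b <= 1)%ZZ.
  have : -2 < B < 2.
    have [/(f_equal IZR) k|[/(f_equal IZR) k|/(f_equal IZR) k]] : (c = -1 \/ c = 0 \/ c = 1)%ZZ by lia.
    - by move: v1 v2; rewrite /C k => *; split; nra.
    - by move: v1 v2; rewrite /C k => *; split; nra.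
    - by move: v1 v2; rewrite /C k => *; split; nra.
  by move=> [/lt_IZR ? /lt_IZR ?]; lia.
split=> //; split=> //.
have : -4 < A < 4.
  have hB : -1 <= B <= 1 by split; apply: IZR_le; lia.
  have hC : -1 <= C <= 1 by split; apply: IZR_le; lia.
  by split; nra.
by move=> [/lt_IZR ? /lt_IZR ?]; lia.
Qed.
End RealEmbedding.

Definition eqb (x y : zt) : bool := ((c0 x =? c0 y) && (c1 x =? c1 y) && (c2 x =? c2 y))%ZZ.

Lemma eqbP x y : eqb x y = true -> x = y.
Proof.
by move=> /andP [/andP [/Z.eqb_eq h0 /Z.eqb_eq h1] /Z.eqb_eq h2]; apply: zt_eq.
Qed.

Definition unit_reps : seq zt := [:: 1; - (1); th; - th].

(** Each candidate square root comes with its inverse, so that the check also certifies that it is a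
    unit. *)
Definition small_unit_ok (u : zt) : bool :=
  implb (Z.abs (norm u) =? 1)%ZZ
    (List.existsb (fun d => List.existsb (fun p : zt * zt =>
       eqb (p.1 * p.2) 1 && eqb u (d * (p.1 * p.1)))
     [:: (1, 1); (th, thi); (thi, th); (th * th, thi * thi); (thi * thi, th * th);
      (th * th * th, thi * thi * thi); (thi * thi * thi, th * th * th); (th * th * th * th, thi * thi * thi * thi)]) unit_reps).

Definition small_units_ok : bool :=
  let r1 := [:: -1; 0; 1]%ZZ in
  List.forallb (fun c => List.forallb (fun b => List.forallb (fun a =>
    small_unit_ok (Zt a b c)) [:: -3; -2; -1; 0; 1; 2; 3]%ZZ) r1) r1.

Lemma unitM u v : unit u -> unit v -> unit (u * v).
Proof.
move=> [u' hu] [v' hv]; exists (u' * v').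
by apply: (lincomb2 (v * v') 1 hu hv); ring.
Qed.

Lemma th_thi : th * thi = 1. Proof. by []. Qed.
Lemma unit_th : unit th. Proof. by exists thi. Qed.
Lemma unit_thi : unit thi. Proof. by exists th. Qed.

(* Dirichlet's theorem for [Z[th]]: multiplying by powers of [th ^ 2] brings the real
   embedding into [[1, th ^ -2)], which leaves finitely many candidates. *)
Lemma unit_class u : unit u ->
  exists d e, [/\ List.In d unit_reps, unit e & u = d * (e * e)].
Proof.
have [r [r3 rb]] := real_root.
have main n : forall u, unit u -> (1 <= Rabs (ev r u))%RR ->
    (Rabs (ev r u) * (r * r) ^ n.+1 < 1)%RR ->
    exists d e, [/\ List.In d unit_reps, unit e & u = d * (e * e)].
  elim: n => [|n IH] {}u hu h1 h2.
    have {}h2 : (Rabs (ev r u) * (r * r) < 1)%RR by move: h2; rewrite /=; lra.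
    have hn := unit_norm _ hu.
    have [hc [hb ha]] := small_unit_coef _ r3 rb _ hn h1 h2.
    have : small_units_ok = true by vm_compute.
    move=> /List.forallb_forall /(_ (c2 u)) h; have {h} := h ltac:(rewrite /=; lia).
    move=> /List.forallb_forall /(_ (c1 u)) h; have {h} := h ltac:(rewrite /=; lia).
    move=> /List.forallb_forall /(_ (c0 u)) h; have {h} := h ltac:(rewrite /=; lia).
    rewrite (_ : Zt _ _ _ = u); last by case: (u).
    rewrite /small_unit_ok hn Z.eqb_refl /implb.
    move=> /List.existsb_exists [d [hd]] /List.existsb_exists [p [_]] /andP [/eqbP h3 /eqbP h4].
    by exists d, p.1; split=> //; exists p.2.
  have [h3|h3] := Rlt_le_dec (Rabs (ev r u) * (r * r)) 1.
    apply: IH => //; apply: Rle_lt_trans h3.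
    apply: Rmult_le_compat_l; first exact: Rabs_pos.
    rewrite -[X in (_ <= X)%RR]Rmult_1_r /=; apply: Rmult_le_compat_l; first by nra.
    by rewrite -(pow1 n); apply: pow_incr; nra.
  have e2 : Rabs (ev r (u * (th * th))) = (Rabs (ev r u) * (r * r))%RR.
    rewrite !evM // !Rabs_mult; congr Rmult.
    have -> : ev r th = r by cbv [ev th c0 c1 c2]; lra.
    by rewrite -Rabs_mult Rabs_pos_eq //; nra.
  have [|||d [e [hd he ue]]] := IH (u * (th * th)).
  - by do !apply: unitM => //; apply: unit_th.
  - by rewrite e2.
  - by rewrite e2; move: h2; rewrite /=; lra.
  exists d, (e * thi); split=> //; first by apply: unitM => //; apply: unit_thi.
  apply: (lincomb2 (thi * thi) (- u * (1 + th * thi)) ue th_thi); ring.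
have gen v : unit v -> (1 <= Rabs (ev r v))%RR ->
    exists d e, [/\ List.In d unit_reps, unit e & v = d * (e * e)].
  move=> hv h1.
  have [N hN] := pow_lt_1_zero (r * r) ltac:(rewrite Rabs_pos_eq; nra) (/ Rabs (ev r v))%RR
    ltac:(apply: Rinv_0_lt_compat; lra).
  apply: (main N) => //.
  have := hN N.+1 ltac:(lia); rewrite Rabs_pos_eq; last by apply: pow_le; nra.
  move=> h; have := Rmult_lt_compat_l (Rabs (ev r v)) _ _ ltac:(lra) h.
  by rewrite Rinv_r; lra.
(* [u] or its inverse [v] has real embedding at least [1] in absolute value. Passing to the inverse
   preserves the class, because each representative is its own inverse modulo squares. *)
move=> [v uv].
have euv : (Rabs (ev r u) * Rabs (ev r v) = 1)%RR.
  by rewrite -Rabs_mult -evM // uv ev_inj Rabs_R1.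
have hu : unit u by exists v.
have hv : unit v by exists u; rewrite -uv; ring.
have [h|h] := Rle_lt_dec 1 (Rabs (ev r u)); first exact: gen.
have h1 : (1 <= Rabs (ev r v))%RR.
  by have := Rabs_pos (ev r u); have := Rabs_pos (ev r v); nra.
have [d [e [hd he ve]]] := gen v hv h1.
have [d' [dd' hd']] : exists d', d * d' = 1 /\ exists f, unit f /\ d' = d * (f * f).
  case: hd => [<-|[<-|[<-|[<-|//]]]].
  - by exists 1; split=> //; exists 1; split=> //; exists 1.
  - by exists (- (1)); split=> //; exists 1; split=> //; exists 1.
  - by exists thi; split=> //; exists thi; split=> //; exact: unit_thi.
  - by exists (- thi); split=> //; exists thi; split=> //; exact: unit_thi.
have [f [hf d'e]] := hd'; have [e' ee'] := he.
exists d, (f * e'); split=> //.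
  by apply: unitM => //; exists e; rewrite -ee'; ring.
have h2 : u * (d * (e * e)) = 1 by rewrite -ve.
have h3 : u = d' * (e' * e').
  apply: (lincomb3 (d' * e' * e') (- u * e * e * e' * e') (- u * (1 + e * e')) h2 dd' ee'); ring.
by rewrite h3 d'e; ring.
Qed.

(** * Congruences modulo powers of 2 *)

Definition eqm (n : Z) (x y : zt) := exists k, x = y + inj n * k.

Global Instance eqm_equiv n : Equivalence (eqm n).
Proof.
split.
- by move=> x; exists 0; ring.
- by move=> x y [k ->]; exists (- k); ring.
- by move=> x y z [k ->] [l ->]; exists (k + l); ring.
Qed.

Global Instance add_eqm n : Proper (eqm n ==> eqm n ==> eqm n) add.
Proof. by move=> x x' [k ->] y y' [l ->]; exists (k + l); ring. Qed.

Global Instance mul_eqm n : Proper (eqm n ==> eqm n ==> eqm n) mul.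
Proof.
by move=> x x' [k ->] y y' [l ->]; exists (x' * l + k * y' + inj n * k * l); ring.
Qed.

Global Instance opp_eqm n : Proper (eqm n ==> eqm n) opp.
Proof. by move=> x x' [k ->]; exists (- k); ring. Qed.

Global Instance sub_eqm n : Proper (eqm n ==> eqm n ==> eqm n) sub.
Proof. by move=> x x' [k ->] y y' [l ->]; exists (k - l); ring. Qed.

Definition red (n : Z) (x : zt) : zt := Zt (c0 x mod n)%ZZ (c1 x mod n)%ZZ (c2 x mod n)%ZZ.

Lemma eqm_red n x : (0 < n)%ZZ -> eqm n x (red n x).
Proof.
move=> n0; exists (Zt (c0 x / n)%ZZ (c1 x / n)%ZZ (c2 x / n)%ZZ).
have d t := Z.div_mod t n ltac:(lia).
move: (d (c0 x)) (d (c1 x)) (d (c2 x)); case: (x) => a b c; rewrite /red; cbn [c0 c1 c2] => d0 d1 d2.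
ztz; [rewrite {1}d0 | rewrite {1}d1 | rewrite {1}d2]; ring.
Qed.

Definition eqmb (n : Z) (x y : zt) : bool :=
  (((c0 x - c0 y) mod n =? 0) && ((c1 x - c1 y) mod n =? 0) && ((c2 x - c2 y) mod n =? 0))%ZZ.

Lemma eqmbP n x y : (0 < n)%ZZ -> eqm n x y <-> eqmb n x y = true.
Proof.
move=> n0; split.
  move=> [[k l m] ->]; rewrite /eqmb; case: y => a b c.
  cbv [mul add inj c0 c1 c2].
  have e (s t : Z) : s = (t * n)%ZZ -> (s mod n =? 0)%ZZ = true.
    by move=> ->; rewrite Z.mod_mul //; lia.
  by rewrite (e _ k); [rewrite (e _ l); [rewrite (e _ m); [|ring]|ring]|ring].
rewrite /eqmb => /andP [/andP [/Z.eqb_eq h0 /Z.eqb_eq h1] /Z.eqb_eq h2].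
have f t : (t mod n = 0)%ZZ -> exists k, t = (n * k)%ZZ.
  by move=> h; exists (t / n)%ZZ; apply/Z.div_exact => //; lia.
have [k hk] := f _ h0; have [l hl] := f _ h1; have [m hm] := f _ h2.
exists (Zt k l m); move: hk hl hm; case: (x) => a b c; case: (y) => a' b' c'.
by cbn [c0 c1 c2] => hk hl hm; ztz; lia.
Qed.

Fixpoint upto (n : nat) : seq Z := if n is m.+1 then rcons (upto m) (Z.of_nat m) else [::].

Definition reps (n : nat) : seq zt :=
  let s := upto n in
  List.flat_map (fun i => List.flat_map (fun j => List.map (fun l => Zt i j l) s) s) s.

Lemma upto_in n i : (0 <= i < Z.of_nat n)%ZZ -> List.In i (upto n).
Proof.
elim: n => [|n IH] h; first by lia.
rewrite /= -cats1; apply/List.in_or_app.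
have [e|e] : (i = Z.of_nat n \/ i < Z.of_nat n)%ZZ by lia.
- by right; left.
- by left; apply: IH; lia.
Qed.

Lemma red_in n x : (0 < n)%N -> List.In (red (Z.of_nat n) x) (reps n).
Proof.
move=> n0; have h t : List.In (t mod Z.of_nat n)%ZZ (upto n).
  by apply: upto_in; apply: Z.mod_pos_bound; move/ssrnat.ltP: n0; lia.
apply/List.in_flat_map; exists (c0 x mod Z.of_nat n)%ZZ; split; first exact: h.
apply/List.in_flat_map; exists (c1 x mod Z.of_nat n)%ZZ; split; first exact: h.
by apply: List.in_map; apply: h.
Qed.

Lemma rep n m x : Z.of_nat n = m -> (0 < m)%ZZ -> exists2 x', eqm m x x' & List.In x' (reps n).
Proof.
move=> <- m0; exists (red (Z.of_nat n) x); first exact: eqm_red.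
by apply: red_in; apply/ssrnat.ltP; lia.
Qed.

Lemma eqm_dvd m n x y : eqm (n * m) x y -> eqm n x y.
Proof. by move=> [k ->]; exists (inj m * k); rewrite injM; ring. Qed.

Lemma forallb2 (s t : seq zt) (P : zt -> zt -> bool) :
  List.forallb (fun x => List.forallb (P x) t) s = true ->
  forall x y, List.In x s -> List.In y t -> P x y = true.
Proof.
by move=> /List.forallb_forall h x y /h /List.forallb_forall; apply.
Qed.

Definition even (x : zt) := eqm 2 x 0.

Lemma even_dec x : even x \/ ~ even x.
Proof.
rewrite /even (eqmbP 2 x 0) //; case: eqmb; [by left | by right].
Qed.

(** The residue ring modulo [2] is the field [F_8]. *)
Lemma evenM x y : even (x * y) -> even x \/ even y.
Proof.
rewrite /even; have [a -> ia] := rep 2 2 x erefl ltac:(lia).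
have [b -> ib] := rep 2 2 y erefl ltac:(lia).
rewrite !eqmbP //.
have := forallb2 (reps 2) (reps 2)
  (fun x y => implb (eqmb 2 (x * y) 0) (eqmb 2 x 0 || eqmb 2 y 0)) ltac:(by vm_compute) a b ia ib.
by move/implyP => h /h /orP.
Qed.

(** Squaring is the Frobenius map of [F_8], hence injective. *)
Lemma sq_inj2 x y : eqm 2 (x * x) (y * y) -> eqm 2 x y.
Proof.
have [a -> ia] := rep 2 2 x erefl ltac:(lia).
have [b -> ib] := rep 2 2 y erefl ltac:(lia).
rewrite !eqmbP //.
have := forallb2 (reps 2) (reps 2)
  (fun x y => implb (eqmb 2 (x * x) (y * y)) (eqmb 2 x y)) ltac:(by vm_compute) a b ia ib.
by move/implyP.
Qed.

(** The local obstruction at [2] behind all the descents: among the unit classes only the trivial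
    one contains squares modulo [4]. *)
Lemma unit_rep_sq4 d x z : List.In d unit_reps -> ~ even x ->
  eqm 4 (d * (x * x)) (z * z) -> d = 1.
Proof.
move=> hd; rewrite /even.
have [a ea ia] := rep 4 4 x erefl ltac:(lia).
have [b eb ib] := rep 4 4 z erefl ltac:(lia).
move=> ox h; have {}ox : ~ eqm 2 a 0.
  by move=> h'; apply: ox; rewrite (eqm_dvd 2 2 _ _ ea).
move: ox h; rewrite ea eb !eqmbP //.
have := forallb2 (reps 4) (reps 4) (fun x y => List.forallb (fun d =>
   [|| eqmb 2 x 0, ~~ eqmb 4 (d * (x * x)) (y * y) | eqb d 1]) unit_reps)
  ltac:(by vm_compute) a b ia ib.
move=> /List.forallb_forall /(_ d hd).
by move=> /or3P [-> // | /negP h _ /h // | /eqbP].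
Qed.

Definition unit_pairs : seq (zt * zt) := [:: (1, 1); (- (1), - (1)); (th, thi); (- th, - thi)].

Lemma unit_pairsM p : List.In p unit_pairs -> p.1 * p.2 = 1.
Proof. by case=> [<-|[<-|[<-|[<-|//]]]]. Qed.

Lemma unit_pairs_reps p : List.In p unit_pairs -> List.In p.1 unit_reps.
Proof. by case=> [<-|[<-|[<-|[<-|//]]]]; rewrite /=; tauto. Qed.

Lemma unit_pairs1 p : List.In p unit_pairs -> p.1 = 1 -> p.2 = 1.
Proof. by case=> [<-|[<-|[<-|[<-|//]]]]. Qed.

Lemma unit_class_pair u u' : u * u' = 1 ->
  exists p e e', [/\ List.In p unit_pairs, e * e' = 1, u = p.1 * (e * e) & u' = p.2 * (e' * e')].
Proof.
move=> h; have [d [e [hd [e' he] ue]]] : exists d e, [/\ List.In d unit_reps, unit e & u = d * (e * e)].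
  by apply: unit_class; exists u'.
have [p hp pd] : exists2 p, List.In p unit_pairs & p.1 = d.
  case: hd => [<-|[<-|[<-|[<-|//]]]].
  - by exists (1, 1) => //; left.
  - by exists (- (1), - (1)) => //; right; left.
  - by exists (th, thi) => //; right; right; left.
  - by exists (- th, - thi) => //; right; right; right; left.
exists p, e, e'; rewrite pd; split=> //.
have hd' := unit_pairsM _ hp; rewrite pd in hd'.
have h2 : d * (e * e) * u' = 1 by rewrite -ue.
apply: (lincomb3 (p.2 * e' * e') (- u' * (1 + e * e') * d * p.2) (- u') h2 he hd'); ring.
Qed.

(** [sq_split] is applied twice: the roots [g] and [c] that it extracts from [p] and [q] are coprime
    with product [t^2], and split again. *)
Lemma fourth_split p q t : coprime p q -> p * q = t * t * (t * t) -> t <> 0 ->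
  exists d k k' m e, [/\ List.In d unit_pairs, k * k' = 1,
    p = d.1 * (k * k) * (m * m * (m * m)), q = d.2 * (k' * k') * (e * e * (e * e))
    & t = m * e /\ coprime m e].
Proof.
move=> cpq h t0.
have t20 : t * t <> 0 by case/mul_eq0.
have [u [u' [g [c [uu hp hq tt]]]]] := sq_split _ _ _ cpq h t20.
have cgc : coprime g c.
  have c1 : coprime p c by apply: coprime_dvdr cpq _; exists (u' * c); rewrite hq; ring.
  by apply: coprime_sym; apply: coprime_dvdr (coprime_sym _ _ c1) _; exists (u * g); rewrite hp; ring.
have [w [w' [m [e [ww hg hc te]]]]] := sq_split _ _ _ cgc (esym tt) t0.
have [d [k [k' [hd kk hu hu']]]] := unit_class_pair _ _ uu.
exists d, (k * w), (k' * w'), m, e; split=> //.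
- by apply: (lincomb2 (w * w') 1 kk ww); ring.
- by rewrite hp hg hu; ring.
- by rewrite hq hc hu'; ring.
split=> //.
have c1 : coprime g e by apply: coprime_dvdr cgc _; exists (w' * e); rewrite hc; ring.
by apply: coprime_sym; apply: coprime_dvdr (coprime_sym _ _ c1) _; exists (w * m); rewrite hg; ring.
Qed.

(* If [(P, Q)] is one factorisation of [D t ^ 4] obtained by completing a square, coprimality of
   [t] with [P + Q] makes both factors fourth powers up to units. *)
Lemma sum_split D S P Q t : P + D * Q = S -> P * Q = t * t * (t * t) -> coprime S t -> t <> 0 ->
  exists d k k' m e, [/\ List.In d unit_pairs, k * k' = 1, coprime (k * m) e,
    k * k * S = d.1 * (k * m * (k * m) * (k * m * (k * m))) + d.2 * D * (e * e * (e * e))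
    & t = m * e /\ P = d.1 * (k * k) * (m * m * (m * m)) /\ Q = d.2 * (k' * k') * (e * e * (e * e))].
Proof.
move=> hS hPQ cS t0.
have [u [v uv]] := coprime_pow _ _ cS.
have cop : coprime P Q.
  exists (u + v * Q), (u * D); apply: (lincomb3 1 u v uv hS hPQ); ring.
have [d [k [k' [m [e [hd kk hp hq [te [s [r cme]]]]]]]]] := fourth_split _ _ _ cop hPQ t0.
exists d, k, k', m, e; split=> //.
- exists (s * k'), r; apply: (lincomb2 (s * m) 1 kk cme); ring.
- rewrite -hS hp hq.
  apply: (lincomb1 (d.2 * D * e * e * e * e * (k * k' + 1)) kk); ring.
Qed.

Lemma eq_eqm n x y : x = y -> eqm n x y.
Proof. by move=> ->; reflexivity. Qed.

Lemma not_even1 : ~ even 1.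
Proof. by rewrite /even eqmbP // => h; vm_compute in h. Qed.

Lemma unit_odd k k' : k * k' = 1 -> ~ even k.
Proof.
move=> h; move=> [l hl]; apply: not_even1; exists (l * k').
by apply: (lincomb2 (inj (-1)) k' h hl); ring.
Qed.

Lemma oddM x y : ~ even x -> ~ even y -> ~ even (x * y).
Proof. by move=> hx hy /evenM []. Qed.

Lemma eqm2_cancel x y z : ~ even x -> eqm 2 (x * y) (x * z) -> eqm 2 y z.
Proof.
move=> ox [k hk]; have /evenM [//|] : even (x * (y - z)).
  by exists k; apply: (lincomb1 1 hk); ring.
by move=> [l hl]; exists l; apply: (lincomb1 1 hl); ring.
Qed.

Fixpoint p2 (j : nat) : zt := if j is i.+1 then inj 2 * p2 i else 1.

Lemma p2_odd_dvd j x z w : ~ even x -> x * z = p2 j * w -> exists z', z = p2 j * z' /\ x * z' = w.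
Proof.
move=> ox; elim: j z w => [|j IH] z w /= h.
  by exists z; split; [ring | rewrite h; ring].
have /evenM [//|[k hk]] : even (x * z).
  by exists (p2 j * w); rewrite h; ring.
have hxk : x * k = p2 j * w.
  by apply: (mulI (inj 2)) => //; apply: (lincomb2 (- x) 1 hk h); ring.
have [z' [e1 e2]] := IH _ _ hxk; exists z'; split=> //.
by apply: (lincomb2 1 (inj 2) hk e1); ring.
Qed.

Lemma p2_neq0 j : p2 j <> 0.
Proof. by elim: j => [|j IH] //= /mul_eq0 []. Qed.

(* [y ^ 2 = quartic a b] is descended along the two dual 2-isogenies ([descent_first] and
   [descent_second]), which together divide [b] by [2] up to odd factors. [level1] handles the
   bottom of the descent, where [b] is divisible by [2] exactly; [level0] rules out the
   2-torsion that is only defined 2-adically. *)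
Section Descent.
Variables A B B' rho : zt.
Let D := A * A - inj 4 * B.
Hypothesis BB' : B * B' = 1.
Hypothesis primeD : Znumtheory.prime (Z.abs (norm D)).
Hypothesis sqD : exists2 s, ~ even s & eqm 4 D (s * s).
Hypothesis level1 : forall p a m e, List.In p unit_pairs -> ~ even m -> ~ even e -> ~ even a ->
  a * a = p.1 * (m * m * (m * m)) - inj 2 * A * (m * m) * (e * e) + p.2 * D * (e * e * (e * e)) ->
  eqm 2 (m * e) (rho * a).
Hypothesis level0 : forall p y m e, List.In p unit_pairs -> ~ even m -> ~ even e ->
  y * y = p.1 * (m * m * (m * m)) + A * (m * m) * (e * e) + p.2 * B * (e * e * (e * e)) -> ~ even y.

Let quartic a b := a * a * (a * a) + A * (a * a) * (b * b) + B * (b * b * (b * b)).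

Lemma coprime_lin a b c k : coprime a b -> coprime (a * a + k * b * c) b.
Proof.
move=> h; have [u [v uv]] := coprimeM _ _ _ (coprime_sym _ _ h) (coprime_sym _ _ h).
by exists v, (u - v * k * c); rewrite -uv; ring.
Qed.

(** From [(a^2 + 2 A b1^2)^2 - y^2 = 4 D b1^4] and [y = a^2 + 2 k] come the factors [P Q = D b1^4]
    with [P + Q = a^2 + 2 A b1^2]. The prime [D] divides one of them, and [sum_split] applies to
    what is left. *)
Lemma descent_first a b b1 y : coprime a b -> ~ even a -> b = inj 2 * b1 -> b1 <> 0 ->
  y * y = quartic a b ->
  exists p k k' m e, [/\ List.In p unit_pairs, k * k' = 1, coprime m e, k * b1 = m * e &
    k * a * (k * a) = p.1 * (m * m * (m * m)) - inj 2 * A * (m * m) * (e * e) + p.2 * D * (e * e * (e * e))].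
Proof.
rewrite /quartic => cab oa hb b10 hy.
have /sq_inj2 [k hk] : eqm 2 (y * y) (a * a * (a * a)).
  exists (inj 2 * A * a * a * b1 * b1 + inj 8 * B * b1 * b1 * b1 * b1).
  by rewrite hy hb; ring.
pose P := A * b1 * b1 - k; pose Q := a * a + A * b1 * b1 + k.
have PQ : P * Q = D * (b1 * b1 * (b1 * b1)).
  apply: (mulI (inj 4)) => //; rewrite hb in hy.
  apply: (lincomb2 (inj (-1)) (y + a * a + inj 2 * k) hy hk); rewrite /P /Q /D; ring.
have cS : coprime (a * a + inj 2 * A * b1 * b1) b1.
  apply: coprime_lin; apply: coprime_dvdr cab _; exists (inj 2); rewrite hb; ring.
have [P' [Q' [e1 e2]]] : exists P' Q', P' + D * Q' = a * a + inj 2 * A * b1 * b1 /\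
    P' * Q' = b1 * b1 * (b1 * b1).
  have D0 : D <> 0 by move=> D0; move: primeD; rewrite D0 => -[h _]; vm_compute in h.
  have [[R hR]|[R hR]] : dvd D P \/ dvd D Q.
  - by apply: prime_dvdM => //; exists (b1 * b1 * (b1 * b1)).
  - exists Q, R; split; first by rewrite -hR /P /Q; ring.
    by apply: (mulI D) => //; rewrite -PQ hR; ring.
  - exists P, R; split; first by rewrite -hR /P /Q; ring.
    by apply: (mulI D) => //; rewrite -PQ hR; ring.
have [p [u [u' [m [e [hp uu cme hS [te _]]]]]]] := sum_split _ _ _ _ _ e1 e2 cS b10.
exists p, u, u', (u * m), e; split=> //; first by rewrite te; ring.
apply: (lincomb2 1 (- inj 2 * A * u * u * (b1 + m * e)) hS te); ring.
Qed.

(** The dual step factors [(m^2 - A e^2)^2 - a^2 = 4 B e^4], with [B] a unit. For even [e] and odd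
    [m] exactly one factor is odd; the sign [s] allows it to be put in front, which makes [m']
    odd. *)
Lemma descent_second a m e : coprime m e -> e <> 0 ->
  a * a = m * m * (m * m) - inj 2 * A * (m * m) * (e * e) + D * (e * e * (e * e)) ->
  exists p k k' m' e' s Q, [/\ List.In p unit_pairs, k * k' = 1, coprime (k * m') e' /\ e = m' * e',
    k * m * (k * m) = p.1 * (k * m' * (k * m') * (k * m' * (k * m')))
      + A * (k * m' * (k * m')) * (e' * e') + p.2 * B * (e' * e' * (e' * e'))
    & [/\ a = s * (p.1 * (k * k) * (m' * m' * (m' * m')) - Q), s * s = 1,
       p.1 * (k * k) * (m' * m' * (m' * m')) * Q = B * (e * e * (e * e)) &
       (even e -> ~ even m -> ~ even m')]].
Proof.
move=> cme e0 ha.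
have [k hk] : eqm 2 a (m * m - A * e * e).
  apply: sq_inj2; exists (- inj 2 * B * (e * e * (e * e))); rewrite ha /D; ring.
have fac (s Pa Qa : zt) : s * s = 1 -> Pa + Qa = m * m - A * e * e -> a = s * (Pa - Qa) ->
    (even e -> ~ even m -> ~ even Pa) -> 
  exists p k k' m' e' s Q, [/\ List.In p unit_pairs, k * k' = 1, coprime (k * m') e' /\ e = m' * e',
    k * m * (k * m) = p.1 * (k * m' * (k * m') * (k * m' * (k * m')))
      + A * (k * m' * (k * m')) * (e' * e') + p.2 * B * (e' * e' * (e' * e'))
    & [/\ a = s * (p.1 * (k * k) * (m' * m' * (m' * m')) - Q), s * s = 1,
       p.1 * (k * k) * (m' * m' * (m' * m')) * Q = B * (e * e * (e * e)) &
       (even e -> ~ even m -> ~ even m')]].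
  move=> ss hsum hdiff hodd.
  have hPQ : Pa * Qa = B * (e * e * (e * e)).
    apply: (mulI (inj 4)) => //; have h2 : a * a = (Pa - Qa) * (Pa - Qa).
      by apply: (lincomb2 (a + s * (Pa - Qa)) ((Pa - Qa) * (Pa - Qa)) hdiff ss); ring.
    apply: (lincomb3 (Pa + Qa + m * m - A * e * e) (inj (-1)) 1 hsum ha h2); rewrite /D; ring.
  have e1 : Pa + B * (B' * Qa) = m * m + (- A) * e * e.
    by apply: (lincomb2 Qa 1 BB' hsum); ring.
  have e2 : Pa * (B' * Qa) = e * e * (e * e).
    by apply: (lincomb2 B' (e * e * e * e) hPQ BB'); ring.
  have cS : coprime (m * m + (- A) * e * e) e by apply: coprime_lin.
  have [p [u [u' [m' [e' [hp uu cme' hS [te [hP hQ]]]]]]]] := sum_split _ _ _ _ _ e1 e2 cS e0.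
  exists p, u, u', m', e', s, Qa; split=> //.
    apply: (lincomb2 1 (A * u * u * (e + m' * e')) hS te); ring.
  split; rewrite -?hP // => ee om em'; apply: (hodd ee om); rewrite hP /even.
  by have em2 : eqm 2 m' 0 := em'; rewrite em2; apply: eq_eqm; ring.
pose P := m * m - A * e * e + k.
have hsum : P + (- k) = m * m - A * e * e by rewrite /P; ring.
have [eP|oP] := even_dec P.
- apply: (fac (- (1)) (- k) P) => //; first by rewrite -hsum; ring.
    by rewrite hk /P; ring.
  move=> ee om ek; case: (oddM _ _ om om); rewrite /even.
  move: eP ek ee => [l1 h1] [l2 h2] [l3 h3]; exists (l1 + l2 + A * e * l3).
  by apply: (lincomb3 1 1 (A * e) h1 h2 h3); rewrite /P; ring.
apply: (fac 1 P (- k)) => //; first by rewrite hk /P; ring.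
Qed.

(** Induction on the exponent of [2] in [b]. Once the unit classes of both steps are seen to be
    trivial, the composite lands on the same quartic with the exponent lowered by one, and the
    residue relation is carried back along the congruences modulo [2]. *)
Lemma descent j a b y beta : coprime a b -> ~ even a -> ~ even beta ->
  b = inj 2 * (p2 j * beta) -> y * y = quartic a b -> eqm 2 beta (rho * a).
Proof.
elim: j a b y beta => [|j IH] a b y beta cab oa ob hb hy.
  have b0 : beta <> 0 by move=> b0; apply: ob; rewrite b0; exists 0; ring.
  have [|p [k [k' [m [e [hp kk cme kb ha]]]]]] := descent_first _ _ beta _ cab oa _ b0 hy.
    by rewrite hb /=; ring.
  have okb : ~ even (m * e) by rewrite -kb; apply: oddM => //; apply: (unit_odd _ k').
  have om : ~ even m by move=> [l hl]; apply: okb; exists (l * e); rewrite hl; ring.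
  have oe : ~ even e by move=> [l hl]; apply: okb; exists (l * m); rewrite hl; ring.
  have ok : ~ even k by apply: (unit_odd _ k').
  apply: (eqm2_cancel k) => //.
  rewrite kb (level1 _ _ _ _ hp om oe (oddM _ _ ok oa) ha); apply: eq_eqm; ring.
pose b1 := p2 j.+1 * beta.
have b10 : b1 <> 0.
  move/mul_eq0 => [/p2_neq0 //|b0]; apply: ob; rewrite b0; exists 0; ring.
have [p [k [k' [m [e [hp kk cme kb ha]]]]]] := descent_first _ _ b1 _ cab oa hb b10 hy.
have ok : ~ even k by apply: (unit_odd _ k').
have e0 : e <> 0.
  move=> e0; have /mul_eq0 [k0|//] : k * b1 = 0 by rewrite kb e0; ring.
  by apply: ok; rewrite k0; exists 0; ring.
have me_even : even (m * e) by exists (p2 j * beta * k); rewrite -kb /b1 /=; ring.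
have not_both : ~ (even m /\ even e).
  move=> [[l hl] [l' hl']]; have [u [v uv]] := cme; apply: not_even1.
  by exists (u * l + v * l'); rewrite -uv hl hl'; ring.
(* Modulo [4] the square [(k a)^2] is [p.2 D e^4] when [m] is even and [p.1 m^4] when [e] is even;
   [D] is itself an odd square modulo [4], so the class is trivial either way. *)
have p1 : p.1 = 1.
  have [me|ee] := evenM _ _ me_even.
    have oe : ~ even e by move=> ee; apply: not_both.
    have [s os [t ht]] := sqD; have [l hl] := me.
    apply: (unit_rep_sq4 _ (s * (e * e)) (p.1 * (k * a)) (unit_pairs_reps _ hp)).
      by do !apply: oddM.
    have pp := unit_pairsM _ hp.
    exists (- p.1 * p.1 * (p.1 * inj 4 * l * l * l * l - inj 2 * A * l * l * e * e) - p.1 * t * e * e * e * e).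
    have h0 : m = inj 2 * l by rewrite hl; ring.
    apply: (lincomb3 (- p.1 * p.1) (- p.1 * D * e * e * e * e) (- p.1 * e * e * e * e) ha pp ht).
    rewrite h0; ring.
  have om : ~ even m by move=> me; apply: not_both.
  have [l hl] := ee.
  apply: (unit_rep_sq4 _ (m * m) (k * a) (unit_pairs_reps _ hp)); first by apply: oddM.
  have h0 : e = inj 2 * l by rewrite hl; ring.
  exists (inj 2 * A * m * m * l * l - p.2 * D * inj 4 * l * l * l * l).
  by apply: (lincomb1 (inj (-1)) ha); rewrite h0; ring.
have p2' := unit_pairs1 _ hp p1.
have ha1 : k * a * (k * a) = m * m * (m * m) - inj 2 * A * (m * m) * (e * e) + D * (e * e * (e * e)).
  by rewrite ha p1 p2'; ring.
have [q [c [c' [m' [e' [s [Q [hq cc [cme' he] hm [ha2 ss hPQ hodd]]]]]]]]] := descent_second _ _ _ cme e0 ha1.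
have oc : ~ even c by apply: (unit_odd _ c').
(* For even [m] the second covering would have odd parameters and the even value [c m], against
   [level0]. *)
have [me|ee] := evenM _ _ me_even.
  have oe : ~ even e by move=> ee; apply: not_both.
  have om' : ~ even m' by move=> [l hl]; apply: oe; exists (l * e'); rewrite he hl; ring.
  have oe' : ~ even e' by move=> [l hl]; apply: oe; exists (l * m'); rewrite he hl; ring.
  case: (level0 _ _ _ _ hq (oddM _ _ oc om') oe' hm).
  by have [l hl] := me; exists (c * l); rewrite hl; ring.
have om : ~ even m by move=> me; apply: not_both.
have om' := hodd ee om.
have ee' : even e' by move: ee; rewrite he => /evenM [].
have q1 : q.1 = 1.
  have [l hl] := ee'; have h0 : e' = inj 2 * l by rewrite hl; ring.
  apply: (unit_rep_sq4 _ (c * m' * (c * m')) (c * m) (unit_pairs_reps _ hq)).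
    by do !apply: oddM.
  exists (- A * c * m' * c * m' * l * l - q.2 * B * inj 4 * l * l * l * l).
  by apply: (lincomb1 (inj (-1)) hm); rewrite h0; ring.
have q2 := unit_pairs1 _ hq q1.
have [beta' [hb' hbb]] : exists z, e' = p2 j.+1 * z /\ m * m' * z = k * beta.
  apply: p2_odd_dvd; first exact: oddM.
  by apply: (lincomb2 (inj (-1)) (- m) kb he); rewrite /b1; ring.
have ob' : ~ even beta'.
  move=> [l hl]; case: (oddM _ _ ok ob); exists (m * m' * l); rewrite -hbb hl; ring.
have hb2 : e' = inj 2 * (p2 j * beta') by rewrite hb' /=; ring.
have hmc : c * m * (c * m) = quartic (c * m') e' by rewrite hm q1 q2 /quartic; ring.
have dir := IH (c * m') e' (c * m) beta' cme' (oddM _ _ oc om') ob' hb2 hmc.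
have eQ : even Q.
  have : even (q.1 * (c * c) * (m' * m' * (m' * m')) * Q).
    by rewrite hPQ; have [l hl] := ee; exists (B * l * e * e * e); rewrite hl; ring.
  move/evenM => [h|//]; exfalso; move: h; rewrite q1.
  by do !apply: oddM => //; apply: not_even1.
have s1 : eqm 2 s 1 by apply: sq_inj2; rewrite ss; apply: eq_eqm; ring.
have em : eqm 2 m (c * (m' * m')).
  apply: (eqm2_cancel c) => //; apply: sq_inj2.
  have [l hl] := ee'; exists (A * (c * m' * (c * m')) * (l * e') + B * (l * e' * (e' * e'))).
  have h0 : e' = inj 2 * l by rewrite hl; ring.
  rewrite hmc /quartic {1 3}h0; ring.
have ea : eqm 2 (k * a) (c * c * (m' * m' * (m' * m'))).
  have eQ0 : eqm 2 Q 0 := eQ.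
  by rewrite ha2 s1 eQ0 q1; apply: eq_eqm; ring.
(* Modulo [2]: [k beta = m m' beta' = rho c^2 m'^4 = rho k a]. *)
apply: (eqm2_cancel k) => //.
have -> : k * (rho * a) = rho * (k * a) by ring.
rewrite -hbb dir em ea; apply: eq_eqm; ring.
Qed.

(** A common factor of [a] and [b] is odd because [a] is, and its square divides [y], so it can be
    cancelled. *)
Lemma descent_gen j a b y beta : ~ even a -> ~ even beta ->
  b = inj 2 * (p2 j * beta) -> y * y = quartic a b -> eqm 2 beta (rho * a).
Proof.
move=> oa ob hb hy.
have a0 : a <> 0 by move=> a0; apply: oa; rewrite a0; exists 0; ring.
have [g [a' [b' [ha hb' cab g0]]]] := gcd_split _ b a0.
have og : ~ even g by move=> [l hl]; apply: oa; exists (l * a'); rewrite ha hl; ring.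
have oa' : ~ even a' by move=> [l hl]; apply: oa; exists (l * g); rewrite ha hl; ring.
have [y' hy'] : dvd (g * g) y.
  apply: sq_dvd; first by case/mul_eq0.
  by exists (quartic a' b'); rewrite hy /quartic ha hb'; ring.
have [beta' [h1 h2]] : exists z, b' = p2 j.+1 * z /\ g * z = beta.
  by apply: p2_odd_dvd => //; rewrite -hb' hb /=; ring.
have ob' : ~ even beta' by move=> [l hl]; apply: ob; exists (l * g); rewrite -h2 hl; ring.
have h3 : b' = inj 2 * (p2 j * beta') by rewrite h1 /=; ring.
have h4 : y' * y' = quartic a' b'.
  apply: (mulI (g * g)); first by case/mul_eq0.
  apply: (mulI (g * g)); first by case/mul_eq0.
  have -> : g * g * (g * g * (y' * y')) = y * y by rewrite hy'; ring.
  by rewrite hy /quartic ha hb'; ring.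
have := descent _ _ _ _ _ cab oa' ob' h3 h4.
by rewrite -h2 ha => ->; apply: eq_eqm; ring.
Qed.
End Descent.

(** * Residue tables and the two concrete quartics *)

Lemma prime23 : Znumtheory.prime 23.
Proof.
apply: prime_intro; first by lia.
move=> n hn; apply/Zgcd_1_rel_prime.
have : List.forallb (fun k => (Z.gcd k 23 =? 1)%ZZ) (List.tl (upto 23)) = true by vm_compute.
move/List.forallb_forall => /(_ n) h; apply/Z.eqb_eq; apply: h.
have : List.In n (upto 23) by apply: upto_in; lia.
by move: hn; rewrite /=; lia.
Qed.

Lemma odd_inv2 x : ~ even x -> exists f, eqm 2 (x * f) 1.
Proof.
move=> ox; have [a ea ia] := rep 2 2 x erefl ltac:(lia).
have oa : ~ eqm 2 a 0 by move=> h; apply: ox; rewrite /even ea.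
(* The unit group of [F_8] has order [7], so the sixth power is the inverse. *)
exists (a * a * (a * a) * (a * a)); rewrite ea; move: oa; rewrite !eqmbP //.
have : List.forallb (fun a => eqmb 2 a 0 || eqmb 2 (a * (a * a * (a * a) * (a * a))) 1) (reps 2) = true.
  by vm_compute.
by move=> /List.forallb_forall /(_ a ia) /orP [-> | ].
Qed.

Lemma odd_coprime2 x : ~ even x -> coprime x (inj 2).
Proof.
by move=> /odd_inv2 [f [k hk]]; exists f, (- k); apply: (lincomb1 1 hk); ring.
Qed.

(** If [y = 1 + 2 k] then [y^2 = 1 + 4 m] and [y^8 = (1 + 4 m)^4] is [1] modulo [16], so [y^7]
    inverts [y]. *)
Lemma odd_inv16 x : ~ even x -> exists f, eqm 16 (x * f) 1.
Proof.
move=> /odd_inv2 [f [k hk]].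
pose y := x * f.
exists (f * (y * y * (y * y) * (y * y * y))).
pose m := k + k * k.
have h2 : y * y = 1 + inj 4 * m by rewrite /y hk /m; ring.
exists (m + inj 6 * m * m + inj 16 * m * m * m + inj 16 * m * m * m * m).
have -> : x * (f * (y * y * (y * y) * (y * y * y))) = (y * y) * (y * y) * (y * y) * (y * y) by rewrite /y; ring.
rewrite h2; ring.
Qed.

(** Encodes [level1] after scaling to [e = 1] modulo [16]: the value modulo [16] depends on [m]
    modulo [4] only, and a square modulo [16] on its root modulo [8]. *)
Definition level1_table A B rho : bool :=
  let D := A * A - inj 4 * B in
  let sq := List.map (fun a => (a, red 16 (a * a))) (reps 8) in
  List.forallb (fun p : zt * zt => List.forallb (fun m =>
    if eqmb 2 m 0 then true else
    let v := red 16 (p.1 * (m * m * (m * m)) - inj 2 * A * (m * m) + p.2 * D) in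
    List.forallb (fun s : zt * zt => eqmb 2 s.1 0 || implb (eqb s.2 v) (eqmb 2 m (rho * s.1))) sq)
    (reps 4)) unit_pairs.

Lemma eqm_redE n x y : eqm n x y -> red n x = red n y.
Proof.
move=> [[a b c] ->]; case: y => k l m; rewrite /red; cbv [mul add inj c0 c1 c2].
have h (s t : Z) : ((s + t * n) mod n = s mod n)%ZZ by apply: Z_mod_plus_full.
by congr Zt; [rewrite -(h k a) | rewrite -(h l b) | rewrite -(h m c)]; congr Z.modulo; ring.
Qed.

Lemma level1_of_table A B rho : level1_table A B rho = true ->
  forall p a m e, List.In p unit_pairs -> ~ even m -> ~ even e -> ~ even a ->
  a * a = p.1 * (m * m * (m * m)) - inj 2 * A * (m * m) * (e * e)
     + p.2 * (A * A - inj 4 * B) * (e * e * (e * e)) ->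
  eqm 2 (m * e) (rho * a).
Proof.
move=> tab p a m e hp om oe oa h.
have [f hf] := odd_inv16 _ oe.
have [m0 em im] := rep 4 4 (m * f) erefl ltac:(lia).
have [a0 ea ia] := rep 8 8 (a * (f * f)) erefl ltac:(lia).
have f2 : eqm 2 (e * f) 1 := eqm_dvd 8 2 _ _ hf.
have odf : ~ even f.
  move=> [l hl]; apply: not_even1; rewrite /even -f2 hl; exists (e * l); ring.
have om0 : ~ even m0.
  move=> h0; case: (oddM _ _ om odf); rewrite /even (eqm_dvd 2 2 _ _ em); exact: h0.
have oa0 : ~ even a0.
  move=> h0; case: (oddM _ _ oa (oddM _ _ odf odf)); rewrite /even (eqm_dvd 4 2 _ _ ea); exact: h0.
have val : eqm 16 (a0 * a0) (p.1 * (m0 * m0 * (m0 * m0)) - inj 2 * A * (m0 * m0) + p.2 * (A * A - inj 4 * B)).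
  have [t ht] := em; have [s hs] := ea.
  have e1 : eqm 16 (a0 * a0) (a * (f * f) * (a * (f * f))).
    by exists (- (a0 * s + inj 4 * s * s)); rewrite hs; ring.
  have e2 : eqm 16 (m0 * m0 * (m0 * m0)) (m * f * (m * f) * (m * f * (m * f))).
    exists (- (m0 * m0 * m0 * t + inj 6 * m0 * m0 * t * t + inj 16 * m0 * t * t * t + inj 16 * t * t * t * t)).
    by rewrite ht; ring.
  have e3 : eqm 16 (inj 2 * A * (m0 * m0)) (inj 2 * A * (m * f * (m * f))).
    by exists (- A * (m0 * t + inj 2 * t * t)); rewrite ht; ring.
  rewrite e1 e2 e3.
  have -> : a * (f * f) * (a * (f * f)) = (p.1 * (m * f * (m * f) * (m * f * (m * f)))
     - inj 2 * A * (m * f * (m * f)) * (e * f * (e * f))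
     + p.2 * (A * A - inj 4 * B) * (e * f * (e * f) * (e * f * (e * f)))).
    by apply: (lincomb1 (f * f * f * f) h); ring.
  by rewrite hf; apply: eq_eqm; ring.
have key : eqm 2 m0 (rho * a0).
  move: tab; rewrite /level1_table => /List.forallb_forall /(_ p hp) /List.forallb_forall /(_ m0 im).
  case E : (eqmb 2 m0 0); first by case: om0; rewrite /even eqmbP.
  move=> /List.forallb_forall /(_ (a0, red 16 (a0 * a0))) hh.
  have {hh} := hh (List.in_map _ _ _ ia).
  rewrite (eqm_redE _ _ _ val) /fst /snd.
  case E' : (eqmb 2 a0 0); first by case: oa0; rewrite /even eqmbP.
  set v := red 16 _; have -> : eqb v v = true by rewrite /eqb !Z.eqb_refl.
  by rewrite /= eqmbP.
have -> : m * e = m * e * 1 by ring.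
have -> : rho * a = rho * a * (1 * 1) by ring.
rewrite -{1}f2 -f2.
have -> : m * e * (e * f) = m * f * (e * e) by ring.
rewrite (eqm_dvd 2 2 _ _ em) key -(eqm_dvd 4 2 _ _ ea).
by apply: eq_eqm; ring.
Qed.

Definition level0_table A B : bool :=
  List.forallb (fun p : zt * zt => List.forallb (fun m => List.forallb (fun e =>
    [|| eqmb 2 m 0, eqmb 2 e 0 | ~~ eqmb 4 (p.1 * (m * m * (m * m)) + A * (m * m) * (e * e)
      + p.2 * B * (e * e * (e * e))) 0]) (reps 4)) (reps 4)) unit_pairs.

(** An even [y] would make the value vanish modulo [4]. *)
Lemma level0_of_table A B : level0_table A B = true ->
  forall p y m e, List.In p unit_pairs -> ~ even m -> ~ even e ->
  y * y = p.1 * (m * m * (m * m)) + A * (m * m) * (e * e) + p.2 * B * (e * e * (e * e)) -> ~ even y.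
Proof.
move=> tab p y m e hp om oe h [l hl].
have [m0 em im] := rep 4 4 m erefl ltac:(lia).
have [e0 ee ie] := rep 4 4 e erefl ltac:(lia).
have v : eqm 4 (p.1 * (m * m * (m * m)) + A * (m * m) * (e * e) + p.2 * B * (e * e * (e * e))) 0.
  by exists (l * l); rewrite -h hl; ring.
rewrite em ee eqmbP // in v.
have om0 : ~ eqm 2 m0 0 by move=> h0; apply: om; rewrite /even (eqm_dvd 2 2 _ _ em).
have oe0 : ~ eqm 2 e0 0 by move=> h0; apply: oe; rewrite /even (eqm_dvd 2 2 _ _ ee).
move: om0 oe0; rewrite !eqmbP //.
move: tab => /List.forallb_forall /(_ p hp) /List.forallb_forall /(_ m0 im) /List.forallb_forall /(_ e0 ie).
by rewrite v /= orbF => /orP [-> | ->].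
Qed.

(** The covering of the sextic for [d = 1]: the right side is the quadratic cofactor of [p - th q]
    at [p = a^2], [q = b^2]. *)
Lemma curve1 j a b y beta : ~ even a -> ~ even beta -> b = inj 2 * (p2 j * beta) ->
  y * y = a * a * (a * a) + (1 + th) * (a * a) * (b * b) + thi * (b * b * (b * b)) ->
  eqm 2 beta ((1 + th + th * th) * a).
Proof.
apply: (descent_gen (1 + th) thi th) => //.
- exact: prime23.
- by exists (1 + th); [rewrite /even eqmbP // => h; vm_compute in h | rewrite eqmbP].
- by apply: level1_of_table; vm_compute.
- by apply: level0_of_table; vm_compute.
Qed.

(** The covering for [d = th]: the right side is [th] times the same cofactor at [p = b^2],
    [q = a^2]. *)
Lemma curve2 j a b y beta : ~ even a -> ~ even beta -> b = inj 2 * (p2 j * beta) ->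
  y * y = a * a * (a * a) + thi * (a * a) * (b * b) + th * (b * b * (b * b)) ->
  eqm 2 beta a.
Proof.
move=> oa ob hb hy; have -> : a = 1 * a by ring.
apply: (descent_gen thi th thi _ _ _ _ _ _ j _ b y) => //.
- exact: prime23.
- by exists thi; [rewrite /even eqmbP // => h; vm_compute in h | rewrite eqmbP].
- by apply: level1_of_table; vm_compute.
- by apply: level0_of_table; vm_compute.
Qed.

(** * Square values of the binary norm form *)

Lemma rel_prime_ex p q : rel_prime p q -> exists u v, (u * p + v * q = 1)%ZZ.
Proof. by move/rel_prime_bezout => [u v h]; exists u, v. Qed.

Lemma rel_prime_coprime p q : rel_prime p q -> coprime (inj p) (inj q).
Proof.
by move/rel_prime_ex => [u [v h]]; exists (inj u), (inj v); rewrite -!injM -injD h.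
Qed.

Lemma even_inj n : even (inj n) -> Z.even n = true.
Proof.
move=> [[a b c] h]; have : n = (2 * a)%ZZ.
  by move: (f_equal c0 h); cbv [mul add inj c0 c1 c2]; lia.
by move=> ->; rewrite Z.even_mul.
Qed.

Lemma odd_inj n : Z.even n = false -> ~ even (inj n).
Proof. by move=> h /even_inj; rewrite h. Qed.

Lemma sq_eq23 x y : (x * x = 23 * (y * y))%ZZ -> x = 0%ZZ.
Proof.
have [n] : exists n : nat, (Z.abs x <= Z.of_nat n)%ZZ by exists (Z.abs_nat x); lia.
elim: n x y => [|n IH] x y hn h; first by lia.
have : (23 | x * x)%ZZ by exists (y * y)%ZZ; lia.
move/(prime_mult _ prime23) => hx.
have [k hk] : (23 | x)%ZZ by case: hx.
have : (23 | y * y)%ZZ by exists (k * k)%ZZ; nia.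
move/(prime_mult _ prime23) => hy.
have [l hl] : (23 | y)%ZZ by case: hy.
case: (Z.eq_dec k 0) => [k0|k0]; first by lia.
have := IH k l ltac:(lia) ltac:(nia); lia.
Qed.

(* [norm (p - q th)] is a square; the gcd of the linear factor and its cofactor divides the
   different [3 th ^ 2 + 2 th], of norm [23]. *)
Lemma norm_form_square p q Y : rel_prime p q -> (p * p * p + p * p * q - q * q * q = Y * Y)%ZZ ->
  exists d w v, [/\ d = 1 \/ d = th, inj p - th * inj q = d * (w * w)
    & inj p * inj p + (1 + th) * inj p * inj q + thi * inj q * inj q = d * (v * v)].
Proof.
move=> pq hY.
pose X1 := inj p - th * inj q.
pose X2 := inj p * inj p + (1 + th) * inj p * inj q + thi * inj q * inj q.
pose pi := inj 3 * th * th + inj 2 * th.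
have n1 : norm X1 = (Y * Y)%ZZ.
  by rewrite -hY /X1; cbv [norm adj mul add sub opp inj th c0 c1 c2]; ring.
have X12 : X1 * X2 = inj Y * inj Y.
  by rewrite -injM -hY /X1 /X2; ztz; ring.
have Y0 : Y <> 0%ZZ.
  move=> Y0; have /norm_eq0 : norm X1 = 0%ZZ by rewrite n1 Y0.
  move=> h; have h0 := f_equal c0 h; have h1 := f_equal c1 h.
  move: h0 h1; rewrite /X1; cbv [mul add sub opp inj th c0 c1 c2] => h0 h1.
  have [u [v]] := rel_prime_ex _ _ pq.
  have [-> ->] : p = 0%ZZ /\ q = 0%ZZ by lia.
  by lia.
have X1q : coprime X1 (inj q).
  have [u [v uv]] := rel_prime_coprime _ _ pq.
  exists u, (v + u * th); rewrite -uv /X1; ring.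
have rem : X2 = X1 * (inj p + (1 + inj 2 * th) * inj q) + pi * (inj q * inj q).
  by rewrite /X1 /X2 /pi; ring_simplify; rewrite (_ : thi = th + th * th) //; ring.
have ppi : Znumtheory.prime (Z.abs (norm pi)) by exact: prime23.
have [[x1 hx1]|npi] : dvd pi X1 \/ ~ dvd pi X1 by apply: Classical_Prop.classic.
  (* If [pi] divided [X1], dividing both factors by [pi] and splitting would give [Y^2] as [23]
     times a square, up to sign. *)
  exfalso.
  have [x2 hx2] : dvd pi X2.
    exists (x1 * (inj p + (1 + inj 2 * th) * inj q) + inj q * inj q).
    by rewrite rem hx1; ring.
  have [y hy] : dvd pi (inj Y).
    apply: sq_dvd; first by move=> h; have := f_equal c1 h.
    by exists (x1 * x2); rewrite -X12 hx1 hx2; ring.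
  have pi0 : pi <> 0 by move=> h; have := f_equal c1 h.
  have e : x1 * x2 = y * y.
    apply: (mulI pi) => //; apply: (mulI pi) => //.
    apply: (lincomb1 (inj (-1)) (_ : X1 * X2 = pi * pi * (x1 * x2))); last first.
      by rewrite X12 hy; ring.
    by rewrite hx1 hx2; ring.
  have x1q : coprime x1 (inj q).
    by have [u [v uv]] := X1q; exists (u * pi), v; rewrite -uv hx1; ring.
  have c12 : coprime x1 x2.
    have -> : x2 = x1 * (inj p + (1 + inj 2 * th) * inj q) + inj q * inj q.
      by apply: (mulI pi) => //; rewrite -hx2 rem hx1; ring.
    have [u [v uv]] := coprimeM _ _ _ x1q x1q.
    exists (u - v * (inj p + (1 + inj 2 * th) * inj q)), v.
    by rewrite -uv; ring.
  have y0 : y <> 0.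
    by move=> y0; apply: Y0; have := f_equal c0 hy; rewrite y0.
  have [u [u' [g [c [uu hg _ _]]]]] := sq_split _ _ _ c12 e y0.
  have nu : Z.abs (norm u) = 1%ZZ by apply: unit_norm; exists u'.
  have : (Y * Y = 23 * norm u * (norm g * norm g))%ZZ.
    by rewrite -n1 hx1 hg !normM (_ : norm pi = 23)%ZZ //; ring.
  move=> h; apply: Y0; apply: (sq_eq23 _ (norm g)).
  have [e1|e1] : norm u = 1%ZZ \/ norm u = (-1)%ZZ by lia.
  - by rewrite h e1; ring.
  - by nia.
have cop : coprime X1 X2.
  have c1 := coprime_sym _ _ (prime_coprime _ _ ppi npi).
  have [u [v uv]] := coprimeM _ _ _ c1 (coprimeM _ _ _ X1q X1q).
  exists (u - v * (inj p + (1 + inj 2 * th) * inj q)), v.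
  apply: (lincomb2 1 v uv rem); ring.
have iY0 : inj Y <> 0 by move=> h; apply: Y0; apply: (f_equal c0 h).
have [u [u' [g [c [uu hg hc _]]]]] := sq_split _ _ _ cop X12 iY0.
have [d [e [e' [hd ee hu hu']]]] := unit_class_pair _ _ uu.
have ng : (norm d.1 * (norm e * norm g * (norm e * norm g)) = Y * Y)%ZZ.
  by rewrite -n1 hg hu !normM; ring.
(* The norm of [X1] is the nonzero square [Y^2], which excludes the classes [-1] and [- th] of
   negative norm. *)
have nd : (norm d.1 <> -1)%ZZ.
  by move=> nd; rewrite nd in ng; nia.
rewrite -/X1 -/X2 hg hc hu hu'.
move: nd hd => nd [hd|[hd|[hd|[hd|//]]]]; move: nd; rewrite -hd /= => nd.
- by exists 1, (e * g), (e' * c); split; [left | ring | ring].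
- by case: nd.
- exists th, (e * g), (e' * c * thi); split; [by right | ring |].
  by apply: (lincomb1 (- e' * e' * c * c * thi) th_thi); ring.
- by case: nd.
Qed.

(** * The genus 2 sextic *)

Lemma p2_val n : n <> 0%ZZ -> exists j m, [/\ Z.even m = false, inj n = p2 j * inj m
  & (Z.even n = true -> exists i, j = i.+1)].
Proof.
have [k] : exists k : nat, (Z.abs n <= Z.of_nat k)%ZZ by exists (Z.abs_nat n); lia.
elim: k n => [|k IH] n hk n0; first by lia.
case E : (Z.even n); last by exists 0%N, n; split=> //=; ring.
have [l hl] : exists l, n = (2 * l)%ZZ by move/Z.even_spec: E.
have [j [m [om hm _]]] := IH l ltac:(lia) ltac:(lia).
exists j.+1, m; split=> //; last by exists j.
by rewrite hl injM hm /=; ring.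
Qed.

Lemma odd_inj2 n : Z.even n = false -> eqm 2 (inj n) 1.
Proof.
move=> h; have [k ->] : exists k, n = (2 * k + 1)%ZZ.
  by apply/Z.odd_spec; rewrite -Z.negb_even h.
by exists (inj k); rewrite injD injM; ring.
Qed.

Lemma odd_sq4 n : Z.even n = false -> exists k, inj n * inj n = 1 + inj 4 * inj k.
Proof.
move=> h; have [k ->] : exists k, n = (2 * k + 1)%ZZ.
  by apply/Z.odd_spec; rewrite -Z.negb_even h.
by exists (k * k + k)%ZZ; rewrite !(injD, injM); ring.
Qed.

Lemma even_sq4 n : Z.even n = true -> exists k, inj n * inj n = inj 4 * inj k.
Proof.
move=> /Z.even_spec [k ->]; exists (k * k)%ZZ; rewrite !injM; ring.
Qed.

Lemma not_unit_rep_sq4 d x z : List.In d unit_reps -> d <> 1 -> ~ even x ->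
  eqm 4 (d * (x * x)) (z * z) -> False.
Proof. by move=> hd d1 ox /(unit_rep_sq4 _ _ _ hd ox). Qed.

Lemma th_odd : ~ even th.
Proof. exact: (unit_odd _ thi). Qed.

(* The Jacobi quartic [y ^ 2 = 1 + thi s ^ 2 + th s ^ 4] at [s = S / B], translated by its
   point [(-1, 1 + th)], lands at [s = - 2 k / (B ^ 2 - th S ^ 2)]. *)
Lemma jacobi_translate S B y k :
  y * y = th * (S * S * (S * S)) + thi * (S * S) * (B * B) + B * B * (B * B) ->
  y = (1 + th) * S * B + inj 2 * k ->
  let a := B * B - th * S * S in let b := - (inj 2 * k) in
  exists z, z * z = a * a * (a * a) + thi * (a * a) * (b * b) + th * (b * b * (b * b)).
Proof.
move=> hy hk a b.
exists ((B * B + th * S * S) * (y * (1 + th) - thi * S * B) - inj 2 * th * S * B * (S * S + B * B)).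
have -> : b = (1 + th) * S * B - y by rewrite hk /b; ring.
rewrite /a (_ : thi = th + th * th) // in hy *.
clear hk b; ring_simplify in hy; ring [hy th3].
Qed.

Lemma not_coprime_even S B : rel_prime S B -> Z.even S = true -> Z.even B = true -> False.
Proof.
move=> /rel_prime_ex [u [v h]] /Z.even_spec [k hk] /Z.even_spec [l hl].
by rewrite hk hl in h; lia.
Qed.

Lemma rel_prime_sq S B : rel_prime S B -> rel_prime (S * S)%ZZ (B * B)%ZZ.
Proof.
by move=> h; apply: rel_prime_mult; apply: rel_prime_sym; apply: rel_prime_mult;
  apply: rel_prime_sym.
Qed.

Lemma odd_sq8 n : Z.even n = false -> exists k, inj n * inj n = 1 + inj 8 * inj k.
Proof.
move=> h; have [k hk] : exists k, n = (2 * k + 1)%ZZ.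
  by apply/Z.odd_spec; rewrite -Z.negb_even h.
have [l hl] : exists l, (k * (k + 1) = 2 * l)%ZZ.
  by apply/Z.even_spec; rewrite Z.even_mul Z.even_add; case: (Z.even k).
exists l; rewrite -!injM -injD; congr inj; rewrite hk; lia.
Qed.

(** The translated point has numerator [b] with [2 K b = a (S^2 - B^2)] and [K] odd, so [b] inherits
    its power of [2] from the integer [S^2 - B^2], whose odd part [mu] is [1] modulo [2]. Hence
    [K beta = a] modulo [2]. But [K = 1 + th] modulo [2], and [curve2] gives [beta = a]: then [th a]
    would be even. *)
Lemma sextic_core S B y k : Z.even S = false -> Z.even B = false ->
  y * y = th * (inj S * inj S * (inj S * inj S)) + thi * (inj S * inj S) * (inj B * inj B)
     + inj B * inj B * (inj B * inj B) ->
  y = (1 + th) * inj S * inj B + inj 2 * k -> even k -> (S * S = B * B)%ZZ.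
Proof.
move=> oS oB hy hk ek; case: (Z.eq_dec (S * S) (B * B)) => // neq; exfalso.
have [z hz] := jacobi_translate _ _ _ _ hy hk.
move: hz; set a := (inj B * inj B - _); set b := - (inj 2 * k) => hz.
pose K := k + (1 + th) * inj S * inj B.
have [j [mu [omu hmu _]]] : exists j m, [/\ Z.even m = false, inj (S * S - B * B) = p2 j * inj m
  & (Z.even (S * S - B * B) = true -> exists i, j = i.+1)] by apply: p2_val; lia.
have [s hs] := odd_sq4 _ oS; have [t ht] := odd_sq4 _ oB.
have hdiff0 : inj (S * S - B * B) = inj S * inj S - inj B * inj B.
  have -> : (S * S - B * B = S * S + (-1) * (B * B))%ZZ by ring.
  by rewrite injD !injM; ring.
have [j' hj'] : exists j', j = j'.+2.
  have hd4 : inj (S * S - B * B) = inj 4 * (inj s - inj t).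
    by rewrite hdiff0 hs ht; ring.
  case: j hmu => [|[|j]] /= hmu; last by exists j.
  - exfalso; apply: (odd_inj _ omu); exists (inj 2 * (inj s - inj t)).
    by apply: (lincomb2 1 (inj (-1)) hd4 hmu); ring.
  - exfalso; apply: (odd_inj _ omu); exists (inj s - inj t).
    by apply: (mulI (inj 2)) => //; apply: (lincomb2 1 (inj (-1)) hd4 hmu); ring.
have hdiff : inj S * inj S - inj B * inj B = p2 j * inj mu by rewrite -hmu hdiff0.
have prod : b * (inj 2 * K) = a * (inj S * inj S - inj B * inj B).
  apply: (lincomb2 (inj (-1)) (y + (1 + th) * inj S * inj B + inj 2 * k) hy hk).
  by rewrite /b /a /K (_ : thi = th + th * th) //; ring.
have oSz := odd_inj _ oS; have oBz := odd_inj _ oB.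
have o1th : ~ even (1 + th) by rewrite /even eqmbP // => h; vm_compute in h.
have oK : ~ even K.
  move=> [l hl]; have [l' hl'] := ek.
  case: (oddM _ _ (oddM _ _ o1th oSz) oBz); exists (l - l').
  by apply: (lincomb2 1 (inj (-1)) hl hl'); rewrite /K; ring.
have oa : ~ even a.
  move=> [l hl]; have /(_ _) : ~ even (1 - th) by rewrite /even eqmbP // => h; vm_compute in h.
  apply; exists (l + inj 2 * (th * inj s - inj t)).
  by apply: (lincomb3 1 (inj (-1)) th hl ht hs); rewrite /a; ring.
have hb : K * b = p2 j'.+1 * (a * inj mu).
  apply: (mulI (inj 2)) => //; rewrite -[inj 2 * (p2 _ * _)](_ : a * (p2 j'.+2 * inj mu) = _); last by rewrite /=; ring.
  by rewrite -hj' -hdiff -prod; ring.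
have [beta [hb1 hb2]] := p2_odd_dvd _ _ _ _ oK hb.
have obeta : ~ even beta.
  move=> [l hl]; case: (oddM _ _ oa (odd_inj _ omu)); exists (K * l).
  by rewrite -hb2 hl; ring.
have hb3 : b = inj 2 * (p2 j' * beta) by rewrite hb1 /=; ring.
have dir := curve2 _ _ _ _ _ oa obeta hb3 hz.
have ek0 : eqm 2 k 0 := ek.
have e1 : eqm 2 (K * beta) ((1 + th) * a).
  by rewrite dir /K ek0 (odd_inj2 _ oS) (odd_inj2 _ oB); apply: eq_eqm; ring.
have e2 : eqm 2 (K * beta) a by rewrite hb2 (odd_inj2 _ omu); apply: eq_eqm; ring.
case: (oddM _ _ th_odd oa); rewrite /even.
have -> : th * a = (1 + th) * a - a by ring.
by rewrite -e1 e2; apply: eq_eqm; ring.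
Qed.

(** Parity of [S] and [B] against the class [d]: congruences modulo [4] remove all but two
    combinations. Even [B] with [d = 1], the class of the points at infinity, is refuted by
    [curve1]; odd [S] and [B] with [d = th] is the class of the known points. *)
Lemma sextic_points S B Y : rel_prime S B -> B <> 0%ZZ ->
  (Y * Y = S * S * S * S * S * S + S * S * S * S * (B * B) - B * B * B * B * B * B)%ZZ ->
  (S * S = B * B)%ZZ.
Proof.
move=> SB B0 hY.
have [|d [w [v [hd h1 h2]]]] := norm_form_square _ _ Y (rel_prime_sq _ _ SB).
  by rewrite hY; ring.
rewrite !injM in h1 h2.
case ES : (Z.even S); case EB : (Z.even B).
- by case: (not_coprime_even _ _ SB ES EB).
- have [s hs] := even_sq4 _ ES; exfalso.
  case: hd => hd; rewrite hd in h1.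
  + apply: (not_unit_rep_sq4 (- th) (inj B) w); [by right; right; right; left | by [] | exact: odd_inj |].
    by exists (- inj s); apply: (lincomb2 1 (inj (-1)) h1 hs); ring.
  + apply: (not_unit_rep_sq4 (- (1)) (inj B) w); [by right; left | by [] | exact: odd_inj |].
    exists (- thi * inj s).
    apply: (lincomb3 thi (- thi) (inj B * inj B + w * w) h1 hs th_thi); ring.
- have [t ht] := even_sq4 _ EB; case: hd => hd.
    exfalso; have [j [m [om hm hj]]] := p2_val _ B0; have [i ji] := hj EB.
    have := curve1 i (inj S) (inj B) v (inj m) (odd_inj _ ES) (odd_inj _ om).
    rewrite {1}hm ji /= => /(_ ltac:(ring)).
    have -> : v * v = inj S * inj S * (inj S * inj S) + (1 + th) * (inj S * inj S) * (inj B * inj B)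
       + thi * (inj B * inj B * (inj B * inj B)).
      by rewrite hd in h2; apply: (lincomb1 (inj (-1)) h2); ring.
    (* Odd integers being [1] modulo [2], [curve1] would give [1 = 1 + th + th^2]. *)
    move=> /(_ erefl); rewrite (odd_inj2 _ ES) (odd_inj2 _ om) eqmbP //.
  exfalso; rewrite hd in h1.
  apply: (not_unit_rep_sq4 th (inj S) (th * w)); [by right; right; left | by [] | exact: odd_inj |].
  by exists (th * th * inj t); apply: (lincomb2 th (th * th) h1 ht); ring.
- have [s hs] := odd_sq4 _ ES; have [t ht] := odd_sq4 _ EB; case: hd => hd.
    exfalso; rewrite hd in h1.
    (* For odd [S] and [B] the linear form is [1 - th] modulo [4], and
       [1 - th = th^5 = th (th^2)^2]. *)
    apply: (not_unit_rep_sq4 th (th * th) w); [by right; right; left | by [] | |].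
      by apply: oddM; apply: th_odd.
    exists (th * inj t - inj s).
    by apply: (lincomb3 1 (inj (-1)) th h1 hs ht); ring [th3].
  have hy : th * v * (th * v) = th * (inj S * inj S * (inj S * inj S))
      + thi * (inj S * inj S) * (inj B * inj B) + inj B * inj B * (inj B * inj B).
    rewrite hd in h2; apply: (lincomb2 (- th) (inj B * inj B * inj B * inj B) h2 th_thi).
    by rewrite (_ : thi = th + th * th) //; ring [th3].
  have [k hk] : eqm 2 (th * v) ((1 + th) * inj S * inj B).
    apply: sq_inj2; exists (inj 2 * (inj s - inj t) * (th * inj S * inj S - inj B * inj B)).
    apply: (lincomb3 1 (th * inj S * inj S - inj B * inj B) (- (th * inj S * inj S - inj B * inj B)) hy hs ht).
    by rewrite (_ : thi = th + th * th) //; ring [th3].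
  (* Odd integer squares are [1] modulo [8], so [(th v)^2] and [((1 + th) S B)^2] agree modulo [8].
     One factor is therefore even, and changing the sign of [th v] exchanges the two up to sign. *)
  have ek : even (k * (k + (1 + th) * inj S * inj B)).
    have [s8 hs8] := odd_sq8 _ ES; have [t8 ht8] := odd_sq8 _ EB.
    exists ((inj s8 - inj t8) * (th * inj S * inj S - inj B * inj B)).
    apply: (mulI (inj 4)) => //.
    have hy2 : (th * v) * (th * v) - (1 + th) * inj S * inj B * ((1 + th) * inj S * inj B)
        = inj 8 * ((inj s8 - inj t8) * (th * inj S * inj S - inj B * inj B)).
      apply: (lincomb3 1 (th * inj S * inj S - inj B * inj B) (- (th * inj S * inj S - inj B * inj B)) hy hs8 ht8).
      by rewrite (_ : thi = th + th * th) //; ring [th3].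
    by apply: (lincomb2 1 (- (th * v + (1 + th) * inj S * inj B + inj 2 * k)) hy2 hk); ring.
  have [e|e] := evenM _ _ ek; first exact: (sextic_core _ _ _ _ ES EB hy hk e).
  apply: (sextic_core _ _ (- (th * v)) (- (k + (1 + th) * inj S * inj B)) ES EB).
  + by rewrite -hy; ring.
  + by rewrite hk; ring.
  + by have [l hl] := e; exists (- l); rewrite hl; ring.
Qed.

(** * Integer descent for [t g = y^2] *)

Lemma int_rep4 n : exists n0, [/\ eqm 4 (inj n) (inj n0), List.In n0 (upto 4) & Z.even n0 = Z.even n].
Proof.
exists (n mod 4)%ZZ; split.
- exists (inj (n / 4)%ZZ); rewrite -injM -injD; congr inj.
  by have := Z.div_mod n 4 ltac:(lia); lia.
- by apply: upto_in; apply: Z.mod_pos_bound.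
have e := Z.div_mod n 4 ltac:(lia).
by rewrite {2}e Z.even_add Z.even_mul /=; case: (Z.even (n mod 4)).
Qed.

(** The left side is the norm of [A^2 + b + th b], which is a square [w^2] because the class [th]
    fails modulo [4]. Multiplied by [th^2] this reads [(p + q th + r th^2)^2 = b + A^2 th^2], and
    coordinates are compared. *)
Lemma cubic_param A b Y : rel_prime A b ->
  (A * A * A * A * A * A + 2 * (A * A * A * A) * b + A * A * (b * b) + b * b * b = Y * Y)%ZZ ->
  exists p q r, [/\ (2 * p * q + r * r = 0)%ZZ, (A * A = q * q + 2 * p * r - 2 * q * r + r * r)%ZZ
    & (b = p * p + 2 * q * r - r * r)%ZZ].
Proof.
move=> Ab hY.
have rp : rel_prime (A * A + b) (- b).
  have [u [v uv]] := rel_prime_ex _ _ (rel_prime_sym _ _ (rel_prime_mult _ _ _ (rel_prime_sym _ _ Ab) (rel_prime_sym _ _ Ab))).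
  by apply: bezout_rel_prime; apply: (Bezout_intro _ _ _ u (u - v)%ZZ); lia.
have [|d [w [v [hd h1 _]]]] := norm_form_square _ _ Y rp; first by rewrite -hY; ring.
case: hd => hd; rewrite hd {d hd} in h1; last first.
  exfalso.
  have [A0 [eA iA pA]] := int_rep4 A; have [b0 [eb ib pb]] := int_rep4 b.
  have [w0 ew iw] := rep 4 4 w erefl ltac:(lia).
  have v0 : eqm 4 (inj A0 * inj A0 + (1 + th) * inj b0) (th * (w0 * w0)).
    rewrite -eA -eb -ew -h1 injD injM (_ : inj (- b) = - inj b) //.
    by apply: eq_eqm; ring.
  have np : ~~ (Z.even A0 && Z.even b0).
    by rewrite pA pb; apply/negP => /andP [h h']; apply: (not_coprime_even _ _ Ab).
  rewrite eqmbP // in v0.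
  have : List.forallb (fun A0 => List.forallb (fun b0 => List.forallb (fun w0 =>
     (Z.even A0 && Z.even b0) || ~~ eqmb 4 (inj A0 * inj A0 + (1 + th) * inj b0) (th * (w0 * w0)))
     (reps 4)) (upto 4)) (upto 4) = true by vm_compute.
  move=> /List.forallb_forall /(_ A0 iA) /List.forallb_forall /(_ b0 ib) /List.forallb_forall /(_ w0 iw).
  by rewrite v0 (negbTE np).
have h2 : th * w * (th * w) = th * th * inj (A * A) + inj b.
  rewrite injD (_ : inj (- b) = - inj b) // in h1.
  by apply: (lincomb1 (- th * th) h1); ring [th3].
case: (th * w) h2 => p q r h2; exists p, q, r.
have g0 := f_equal c0 h2; have g1 := f_equal c1 h2; have g2 := f_equal c2 h2.
move: g0 g1 g2; cbv [mul add inj th c0 c1 c2] => g0 g1 g2.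
split; lia.
Qed.

Lemma rel_prime_mult2 a b c : rel_prime a c -> rel_prime b c -> rel_prime (a * b)%ZZ c.
Proof. by move=> h h'; apply: rel_prime_sym; apply: rel_prime_mult; apply: rel_prime_sym. Qed.

Lemma Zsq_split x y z : rel_prime x y -> (x * y = z * z)%ZZ ->
  exists s g h, [/\ (s * s = 1)%ZZ, (x = s * (g * g))%ZZ, (y = s * (h * h))%ZZ & (z = g * h)%ZZ].
Proof.
move=> xy e.
case: (Z.eq_dec x 0) => [x0|x0].
  have [u [v uv]] := rel_prime_ex _ _ xy; rewrite x0 in uv e.
  have z0 : z = 0%ZZ by nia.
  have y1 : (y * y = 1)%ZZ.
    have vy : (v * y = 1)%ZZ by lia.
    have := Z.mul_eq_1 _ _ vy; nia.
  by exists y, 0%ZZ, 1%ZZ; split=> //; lia.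
pose g := Z.gcd x z; have [u [v uv]] := rel_prime_ex _ _ xy.
have gp : (0 < g)%ZZ.
  by have := Z.gcd_nonneg x z; have := Z.gcd_eq_0_l x z; rewrite -/g; lia.
have [x1 hx] : (g | x)%ZZ := Z.gcd_divide_l x z.
have [z1 hz] : (g | z)%ZZ := Z.gcd_divide_r x z.
have [s [t st]] : exists s t, (s * x1 + t * z1 = 1)%ZZ.
  have [s [t st]] := Z.gcd_bezout x z g erefl; exists s, t; nia.
have e1 : (x1 * y = g * z1 * z1)%ZZ by nia.
have [w hw] : exists w, (g = x1 * w)%ZZ.
  exists (g * s * s * x1 + 2 * g * s * t * z1 + t * t * y)%ZZ.
  have : (g * ((s * x1 + t * z1) * (s * x1 + t * z1)) = g)%ZZ by rewrite st; ring.
  have : (t * t * (x1 * y) = t * t * (g * z1 * z1))%ZZ by rewrite e1.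
  lia.
have [k hk] : exists k, (x1 = g * k)%ZZ.
  exists (u * x1 * x1 + v * z1 * z1)%ZZ.
  have h1 : (x1 * (u * x + v * y) = x1)%ZZ by rewrite uv; ring.
  have h2 : (v * (x1 * y) = v * (g * z1 * z1))%ZZ by rewrite e1.
  have h3 : (x1 * u * x = x1 * u * (x1 * g))%ZZ by rewrite -hx.
  lia.
have kw : (k * w = 1)%ZZ by nia.
have k1 : (k * k = 1)%ZZ by move/Z.mul_eq_1: (kw); lia.
exists k, g, z1; split=> //.
- by rewrite hx hk; ring.
- have : (g * (k * y - z1 * z1) = 0)%ZZ by rewrite -[RHS](Z.sub_diag (x1 * y)) {2}e1 hk; ring.
  move/Z.mul_eq_0 => [|h]; first by lia.
  have : (k * k * y = k * (z1 * z1))%ZZ by rewrite -Z.mul_assoc; congr Z.mul; lia.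
  by rewrite k1; lia.
- by rewrite {1}hz; ring.
Qed.

Lemma sign_neq0 s x : (s * s = 1)%ZZ -> x <> 0%ZZ -> (s * x)%ZZ <> 0%ZZ.
Proof. by move=> ss x0 /Z.mul_eq_0 [s0|//]; rewrite s0 in ss. Qed.

Lemma Zsq_eq0 x : (x * x = 0)%ZZ -> x = 0%ZZ.
Proof. by move/Z.mul_eq_0 => []. Qed.

(** The homogenised cubic [b^3 g(a / b)]. *)
Definition cubic_form a b : Z := (a * a * a + 2 * (a * a) * b + a * (b * b) + b * b * b)%ZZ.

(** In [cubic_param], [r = 2 r1] and [p q = -2 r1^2] with [p], [q] coprime. So [p] and [q] are
    squares up to sign and a factor [2], and [A^2] becomes [n * cubic_form n mu], or four times
    that; these coprime factors are squares up to a common sign. The formula for [4 b] is recorded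
    for the case where the step does not shrink [A]. *)
Lemma cubic_form_step A b Y : rel_prime A b -> A <> 0%ZZ -> b <> 0%ZZ ->
  (cubic_form (A * A) b = Y * Y)%ZZ ->
  exists A' b' Y', [/\ rel_prime A' b', A' <> 0%ZZ, b' <> 0%ZZ, (cubic_form (A' * A') b' = Y' * Y')%ZZ
   & ((A = A' * Y')%ZZ /\ (exists m, b' = 2 * m)%ZZ /\
       (4 * b = b' * b' * (b' * b') - 8 * b' * (A' * A' * (A' * A') * (A' * A')) - 4 * (b' * b') * (A' * A' * (A' * A')))%ZZ)
     \/ (A = 2 * (A' * Y'))%ZZ].
Proof.
move=> Ab A0 b0 hY.
have [|p [q [r [h1 h2 h3]]]] := cubic_param A b Y Ab; first by rewrite -hY /cubic_form; ring.
have [r1 hr1] : exists r1, (r = 2 * r1)%ZZ.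
  have : Z.even (r * r) = true.
    have -> : (r * r = 2 * (- (p * q)))%ZZ by lia.
    by rewrite Z.even_mul.
  by rewrite Z.even_mul orbb => /Z.even_spec.
have pq2 : (p * q = - (2 * (r1 * r1)))%ZZ by rewrite hr1 in h1; lia.
(* A common divisor of [p] and [q] divides [r], then [A] and [b]. *)
have rp : rel_prime p q.
  apply/Zgcd_1_rel_prime.
  pose g := Z.gcd p q.
  have [p1 hp] : (g | p)%ZZ := Z.gcd_divide_l p q.
  have [q1 hq] : (g | q)%ZZ := Z.gcd_divide_r p q.
  have gn : (0 <= g)%ZZ := Z.gcd_nonneg p q.
  rewrite -/g.
  have g0 : g <> 0%ZZ.
    move=> g0; rewrite g0 !Z.mul_0_r in hp hq; have : (r * r = 0)%ZZ by lia.
    by move/Zsq_eq0 => r0; apply: A0; apply: Zsq_eq0; rewrite h2 hp hq r0.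
  have sqd x : (g * g | x * x)%ZZ -> (g | x)%ZZ.
    move=> [t ht]; have [||z hz] := sq_dvd (inj g) (inj x).
    - by move=> h; apply: g0; apply: (f_equal c0 h).
    - by exists (inj t); rewrite -!injM ht; congr inj; ring.
    by case: z hz => z0 z1 z2 hz; exists z0; move: (f_equal c0 hz); cbv [mul inj c0 c1 c2]; lia.
  have [l hl] : (g | r)%ZZ.
    apply: sqd; exists (- (2 * (p1 * q1)))%ZZ.
    have -> : (r * r = - (2 * (p * q)))%ZZ by lia.
    by rewrite hp hq; ring.
  have [m hm] : (g | A)%ZZ.
    by apply: sqd; exists (q1 * q1 + 2 * p1 * l - 2 * q1 * l + l * l)%ZZ; rewrite h2 hp hq hl; ring.
  have [u [v uv]] := rel_prime_ex _ _ Ab.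
  have g1 : (g * (u * m + v * (g * (p1 * p1 + 2 * q1 * l - l * l))) = 1)%ZZ.
    by rewrite -uv h3 hm hp hq hl; ring.
  by have := Z.mul_eq_1 _ _ g1; lia.
have finish n mu A1 : rel_prime n mu -> mu <> 0%ZZ -> A1 <> 0%ZZ ->
  (A1 * A1 = n * cubic_form n mu)%ZZ ->
  exists s A' Y', [/\ (s * s = 1)%ZZ, rel_prime A' (s * mu)%ZZ, (n = s * (A' * A'))%ZZ,
     (cubic_form (A' * A') (s * mu) = Y' * Y')%ZZ & (A1 = A' * Y')%ZZ].
  move=> rnm mu0 A10 hA.
  have rnG : rel_prime n (cubic_form n mu).
    have [u [v uv]] := rel_prime_ex _ _ (rel_prime_mult _ _ _ rnm (rel_prime_mult _ _ _ rnm rnm)).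
    apply: bezout_rel_prime; apply: (Bezout_intro _ _ _ (u - v * (n * n + 2 * n * mu + mu * mu))%ZZ v).
    by rewrite -uv /cubic_form; ring.
  have [s [g [h [ss hn hG hz]]]] := Zsq_split _ _ _ rnG (esym hA).
  exists s, g, h; split=> //.
  - have [u [v uv]] := rel_prime_ex _ _ rnm.
    apply: bezout_rel_prime; apply: (Bezout_intro _ _ _ (u * s * g)%ZZ (v * s)%ZZ).
    have : (v * mu * (s * s) = v * mu * 1)%ZZ by rewrite ss.
    by move: uv; rewrite {1}hn; lia.
  - have -> : (g * g = s * n)%ZZ by rewrite hn Z.mul_assoc ss; ring.
    have -> : (cubic_form (s * n) (s * mu) = s * (s * s) * cubic_form n mu)%ZZ by rewrite /cubic_form; ring.
    have -> : (s * (s * s) * cubic_form n mu = (s * s) * (s * cubic_form n mu))%ZZ by ring.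
    rewrite hG; have -> : (s * s * (s * (s * (h * h))) = (s * s) * ((s * s) * (h * h)))%ZZ by ring.
    by rewrite ss; lia.
case Ep : (Z.even p).
  have /Z.even_spec [p' hp'] := Ep.
  have rp' : rel_prime p' (- q).
    have [u [v uv]] := rel_prime_ex _ _ rp.
    by apply: bezout_rel_prime; apply: (Bezout_intro _ _ _ (2 * u) (- v))%ZZ; rewrite -uv hp'; ring.
  have [e [m [n [ee hm hn hr]]]] := Zsq_split _ _ r1 rp' ltac:(lia).
  have hq : (q = - (e * (n * n)))%ZZ by lia.
  have hpp : (p = 2 * e * (m * m))%ZZ by rewrite hp' hm; ring.
  have m0 : m <> 0%ZZ by move=> m0; apply: b0; rewrite h3 hr1 hr hpp m0; ring.
  have [||||s [A' [Y' [ss c1 c2 c3 c4]]]] := finish n (2 * e * m)%ZZ A.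
  - have [u [v uv]] := rel_prime_ex _ _ rp.
    apply: bezout_rel_prime; apply: (Bezout_intro _ _ _ (- v * e * n) (u * m))%ZZ.
    by rewrite -uv hpp hq; ring.
  - by rewrite -Z.mul_assoc Z.mul_shuffle3; apply: sign_neq0 => //; lia.
  - by [].
  - rewrite h2 hr1 hr hpp hq /cubic_form.
    have e2 x : (e * e * x = x)%ZZ by rewrite ee; lia.
    have := e2 (n * n * n * n)%ZZ; have := e2 (m * m * n * n)%ZZ; have := e2 (e * m * m * m * n)%ZZ; lia.
  exists A', (s * (2 * e * m))%ZZ, Y'; split=> //.
  - by move=> z; apply: A0; rewrite c4 z.
  - apply: sign_neq0 => //; rewrite -Z.mul_assoc Z.mul_shuffle3; apply: sign_neq0 => //; lia.
  left.
  split=> //; split; first by exists (s * e * m)%ZZ; ring.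
  rewrite h3 hr1 hr hpp hq.
  have s2 x : (s * s * x = x)%ZZ by rewrite ss; lia.
  have e2 x : (e * e * x = x)%ZZ by rewrite ee; lia.
  have hA : (A' * A' = s * n)%ZZ by rewrite c2 Z.mul_assoc ss; ring.
  rewrite hA.
  have -> : (s * (2 * e * m) * (s * (2 * e * m)) = 4 * (m * m))%ZZ.
    by rewrite -[RHS](s2) -[RHS](e2); ring.
  have -> : (s * n * (s * n) * (s * n) = s * (n * n * n))%ZZ by rewrite -[RHS]s2; ring.
  have -> : (s * n * (s * n) = n * n)%ZZ by rewrite -[RHS]s2; ring.
  have -> : (8 * (s * (2 * e * m)) * (s * (n * n * n)) = 16 * e * m * (n * n * n))%ZZ.
    by rewrite -[RHS]s2; ring.
  have := e2 (m * m * (m * m))%ZZ; have := e2 (n * n * m * m)%ZZ; lia.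
have /Z.even_spec [q' hq'] : Z.even q = true.
  have : Z.even (p * q) = true by rewrite pq2 Z.even_opp Z.even_mul.
  by rewrite Z.even_mul Ep.
have rp' : rel_prime p (- q').
  have [u [v uv]] := rel_prime_ex _ _ rp.
  by apply: bezout_rel_prime; apply: (Bezout_intro _ _ _ u (- 2 * v))%ZZ; rewrite -uv hq'; ring.
have [e [m [n [ee hm hn hr]]]] := Zsq_split _ _ r1 rp' ltac:(lia).
have hq : (q = - (2 * e * (n * n)))%ZZ by lia.
have m0 : m <> 0%ZZ by move=> m0; apply: b0; rewrite h3 hr1 hr hm m0; ring.
have hAA : (A * A = 4 * (n * cubic_form n (e * m)))%ZZ.
  rewrite h2 hr1 hr hm hq /cubic_form.
  have e2 x : (e * e * x = x)%ZZ by rewrite ee; lia.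
  have := e2 (n * n * n * n)%ZZ; have := e2 (m * m * n * n)%ZZ; have := e2 (e * m * m * m * n)%ZZ; lia.
have [A1 hA1] : exists A1, (A = 2 * A1)%ZZ.
  have : Z.even (A * A) = true by rewrite hAA Z.even_mul.
  by rewrite Z.even_mul orbb => /Z.even_spec.
have [||||s [A' [Y' [ss c1 c2 c3 c4]]]] := finish n (e * m)%ZZ A1.
- have [u [v uv]] := rel_prime_ex _ _ rp.
  apply: bezout_rel_prime; apply: (Bezout_intro _ _ _ (- v * 2 * e * n) (u * m))%ZZ.
  by rewrite -uv hm hq; ring.
- exact: sign_neq0.
- by move=> z; apply: A0; rewrite hA1 z.
- by rewrite hA1 in hAA; lia.
exists A', (s * (e * m))%ZZ, Y'; split=> //.
- by move=> z; apply: A0; rewrite hA1 c4 z.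
- by apply: sign_neq0 => //; apply: sign_neq0.
right.
by rewrite hA1 c4.
Qed.

(** Twelve times the cofactor of [x - y] is [3 (2 x + y + a)^2 + (3 y + a)^2 + 20 a^2], which is
    positive. *)
Lemma cubic_form_inj a x y : (0 < a)%ZZ -> cubic_form a x = cubic_form a y -> x = y.
Proof.
rewrite /cubic_form => a0 h.
have : ((x - y) * (x * x + x * y + y * y + a * (x + y) + 2 * (a * a)) = 0)%ZZ by lia.
move/Z.mul_eq_0 => [|e]; first by lia.
have : (0 <= (2 * x + y + a) * (2 * x + y + a))%ZZ by apply: Z.square_nonneg.
have : (0 <= (3 * y + a) * (3 * y + a))%ZZ by apply: Z.square_nonneg.
have : (0 < a * a)%ZZ by nia.
lia.
Qed.

(* Each solution has one with [A' | A]; when [A'] is not smaller, [cubic_form] takes the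
   value [1] and its injectivity forces the descent to be stationary, against parity. *)
Lemma cubic_form_points A b Y : rel_prime A b -> (cubic_form (A * A) b = Y * Y)%ZZ ->
  A = 0%ZZ \/ b = 0%ZZ.
Proof.
move=> Ab hY.
have main : forall n A b Y, (Z.abs A <= Z.of_nat n)%ZZ -> rel_prime A b -> A <> 0%ZZ -> b <> 0%ZZ ->
    (cubic_form (A * A) b = Y * Y)%ZZ -> False.
  clear; elim=> [|n IH] A b Y hA Ab A0 b0 hY; first by lia.
  have small A' Y' : (A = A' * Y')%ZZ -> (Z.abs A' <= Z.of_nat n)%ZZ \/ (Y' * Y' = 1 /\ A' * A' = A * A)%ZZ.
    move=> e; have Y0 : Y' <> 0%ZZ by move=> z; apply: A0; rewrite e z; ring.
    have [h|h] : (Z.abs Y' = 1 \/ 2 <= Z.abs Y')%ZZ by lia.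
      by right; have [y|y] : (Y' = 1 \/ Y' = -1)%ZZ by [lia]; rewrite e y; split; ring.
    have ea : (Z.abs A = Z.abs A' * Z.abs Y')%ZZ by rewrite e Z.abs_mul.
    by left; have : (0 < Z.abs A)%ZZ by [lia]; nia.
  have [A' [b' [Y' [r1 A'0 b'0 h1 [[e1 [[m hm] q1]]|e1]]]]] := cubic_form_step _ _ _ Ab A0 b0 hY; last first.
    by apply: (IH A' b' Y') => //; have [] := small A' (2 * Y')%ZZ ltac:(lia); [|nia].
  have [h|[Y1 A1]] := small _ _ e1; first exact: (IH A' b' Y').
  have [A'' [b'' [Y'' [r2 A''0 b''0 h2 [[e2 [[m' hm'] q2]]|e2]]]]] := cubic_form_step _ _ _ r1 A'0 b'0 h1; last first.
    by apply: (IH A'' b'' Y'') => //; have [] := small A'' (2 * Y'' * Y')%ZZ ltac:(rewrite e1 e2; ring); [|nia].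
  have [h|[Y2 A2]] := small A'' (Y'' * Y')%ZZ ltac:(rewrite e1 e2; ring); first exact: (IH A'' b'' Y'').
  have Y3 : (Y'' * Y'' = 1)%ZZ.
    have e : (Y'' * Y'' * (Y' * Y') = 1)%ZZ by lia.
    by rewrite Y1 in e; lia.
  have eb : b' = b''.
    apply: (cubic_form_inj (A * A)); first by nia.
    by rewrite -{1}A1 -A2 h1 h2 Y1 Y3.
  rewrite -eb hm A2 in q2.
  have m0 : m <> 0%ZZ by move=> m0; apply: b'0; rewrite hm m0.
  have : (m * (2 * (m * m * m) - 2 * (A * A * (A * A) * (A * A)) - 2 * (m * (A * A * (A * A))) - 1) = 0)%ZZ by lia.
  by move/Z.mul_eq_0 => [//|]; lia.
have [|A0] := Z.eq_dec A 0; first by left.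
have [|b0] := Z.eq_dec b 0; first by right.
by case: (main (Z.abs_nat A) A b Y _ Ab A0 b0 hY); lia.
Qed.

(** * Simultaneous squares and the circle *)

Section Twist.
Variables T T' : zt.
Hypothesis TT' : T * T' = 1.

Lemma twist_factor U V1 w : coprime U (inj 2 * V1) -> ~ even U -> even V1 -> V1 <> 0 ->
  w * w = U * U + T * (inj 2 * V1 * (inj 2 * V1)) ->
  exists u u' X Y, [/\ u * u' = 1, U = u' * (X * X) - T * u * (Y * Y), V1 = X * Y,
    even Y /\ ~ even X & coprime X Y].
Proof.
move=> cUV oU eV V0 hw.
have [k hk] : eqm 2 w U.
  by apply: sq_inj2; exists (inj 2 * T * V1 * V1); rewrite hw; ring.
have cUV1 : coprime U V1 by apply: coprime_dvdr cUV _; exists (inj 2); ring.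
have core k0 : even k0 -> k0 * (k0 + U) = T * (V1 * V1) ->
  exists u u' X Y, [/\ u * u' = 1, U = u' * (X * X) - T * u * (Y * Y), V1 = X * Y,
    even Y /\ ~ even X & coprime X Y].
  move=> ek hkk.
  have e2 : T' * k0 * (k0 + U) = V1 * V1.
    by apply: (lincomb2 T' (V1 * V1) hkk TT'); ring.
  have cop : coprime (T' * k0) (k0 + U).
    have [u [v uv]] := coprimeM _ _ _ cUV1 cUV1.
    exists (- u * T + v * (k0 + U)), u.
    by apply: (lincomb3 1 v (- u * k0) uv e2 TT'); ring.
  have [u [u' [Y [X [uu hY hX hV]]]]] := sq_split _ _ _ cop e2 V0.
  have oUk : ~ even (k0 + U).
    by move=> [l hl]; have [l' hl'] := ek; apply: oU; exists (l - l'); apply: (lincomb2 1 (inj (-1)) hl hl'); ring.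
  exists u, u', X, Y; split=> //.
  - by apply: (lincomb3 1 (- T) k0 hX hY TT'); ring.
  - by rewrite hV; ring.
  - split.
      have : even (u * (Y * Y)) by rewrite -hY; have [l hl] := ek; exists (T' * l); rewrite hl; ring.
      by move=> /evenM [/(unit_odd _ _ uu)//|/evenM []].
    by move=> [l hl]; apply: oUk; rewrite hX hl; exists (u' * l * (inj 2 * l)); ring.
  - have c1 : coprime (T' * k0) X by apply: coprime_dvdr cop _; exists (u' * X); rewrite hX; ring.
    by apply: coprime_dvdr (coprime_sym _ _ c1) _; exists (u * Y); rewrite hY; ring.
have hkU : k * (k + U) = T * (V1 * V1).
  apply: (mulI (inj 4)) => //; apply: (lincomb2 1 (- (w + U + inj 2 * k)) hw hk); ring.
have : even (k * (k + U)) by rewrite hkU; have [l hl] := eV; exists (T * l * V1); rewrite hl; ring.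
move=> /evenM [ek|[l hl]]; first exact: (core k).
apply: (core (- (k + U))).
  by exists (- l); rewrite hl; ring.
by rewrite -hkU; ring.
Qed.
End Twist.

Lemma odd_square_unit u u' X Z : u * u' = 1 -> ~ even X -> eqm 4 (u * (X * X)) (Z * Z) ->
  exists e e', e * e' = 1 /\ u = e * e.
Proof.
move=> uu oX h; have [p [e [e' [hp ee hu _]]]] := unit_class_pair _ _ uu.
exists e, e'; split=> //.
have p1 : p.1 = 1.
  apply: (unit_rep_sq4 _ (e * X) Z (unit_pairs_reps _ hp)).
    by apply: oddM => //; apply: (unit_odd _ e').
  by rewrite -h hu; apply: eq_eqm; ring.
by rewrite hu p1; ring.
Qed.

Definition T7 := Zt (-1) 0 2.
Definition T7' := Zt 3 4 2.

Lemma odd_neq0 x : ~ even x -> x <> 0.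
Proof. by move=> ox x0; apply: ox; exists 0; rewrite x0; ring. Qed.

(* [T7 = th ^ 7] and [T7' = th ^ -7] differ by [4] times a unit, so no prime but [2] can
   enter the second descent step. *)
Lemma twist_descent j U V beta w w' : coprime U V -> ~ even U -> ~ even beta ->
  V = inj 2 * (p2 j * beta) -> eqm 2 beta U ->
  w * w = U * U + T7 * (V * V) -> w' * w' = U * U + T7' * (V * V) -> False.
Proof.
elim: j U V beta w w' => [|j IH] U V beta w w' cUV oU ob hV dir hw hw'.
  have [k hk] : eqm 2 w U.
    by apply: sq_inj2; exists (inj 2 * T7 * beta * beta); rewrite hw hV /=; ring.
  have hkU : k * (k + U) = T7 * (beta * beta).
    apply: (mulI (inj 4)) => //; rewrite hV /= in hw.
    by apply: (lincomb2 1 (- (w + U + inj 2 * k)) hw hk); ring.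
  (* At the bottom [k / U] would be a root of [x^2 + x + 1] in [F_8], whose unit group of order [7]
     has no element of order [3]. *)
  have h : eqm 2 (k * (k + U)) (U * U).
    rewrite hkU dir; have t : eqm 2 T7 1 by rewrite eqmbP.
    by rewrite t; apply: eq_eqm; ring.
  have [k0 ek ik] := rep 2 2 k erefl ltac:(lia).
  have [U0 eU iU] := rep 2 2 U erefl ltac:(lia).
  have oU0 : ~ eqm 2 U0 0 by move=> h0; apply: oU; rewrite /even eU.
  move: h oU0; rewrite ek eU !eqmbP //.
  have := forallb2 (reps 2) (reps 2) (fun k U => eqmb 2 U 0 || ~~ eqmb 2 (k * (k + U)) (U * U))
    ltac:(by vm_compute) k0 U0 ik iU.
  by move=> /orP [-> // | /negbTE ->].
pose V1 := p2 j.+1 * beta.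
have hV1 : V = inj 2 * V1 by [].
have V10 : V1 <> 0 by move/mul_eq0 => [/p2_neq0 // | /odd_neq0]; apply.
have eV1 : even V1 by exists (p2 j * beta); rewrite /V1 /=; ring.
rewrite hV1 in cUV hw hw'.
have [u [u' [X [Y [uu hU hXY [eY oX] cXY]]]]] := twist_factor T7 T7' erefl _ _ _ cUV oU eV1 V10 hw.
have [v [v' [X' [Y' [vv hU' hXY' [eY' oX'] _]]]]] := twist_factor T7' T7 erefl _ _ _ cUV oU eV1 V10 hw'.
have [l hl] := eY; have [l' hl'] := eY'.
have hl0 : Y = inj 2 * l by rewrite hl; ring.
have hl0' : Y' = inj 2 * l' by rewrite hl'; ring.
(* [Y] and [Y'] are even, so the two expressions for [U] agree modulo [4] in their leading terms;
   this forces the units [u] and [v] into one square class, and both expressions can be written with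
   [u]. *)
have [e [e' [ee hz]]] : exists e e', e * e' = 1 /\ u' * v = e * e.
  apply: (odd_square_unit _ (u * v') X X') => //.
    by apply: (lincomb2 (v * v') 1 uu vv); ring.
  exists (v * (T7 * u * l * l - T7' * v * l' * l')).
  by apply: (lincomb3 (- v) v (X' * X') hU hU' vv); rewrite hl0 hl0'; ring.
pose X2 := e' * X'; pose Y2 := e * Y'.
have hve : v = u * (e * e) by rewrite -hz; apply: (lincomb1 (- v) uu); ring.
have hve' : v' = u' * (e' * e').
  have h1 : u * u' * (e * e' * (e * e')) = 1 by rewrite uu ee; ring.
  by apply: (lincomb3 (u' * e' * e') (- u' * e' * e' * v') (- v') vv hve h1); ring.
have oe' : ~ even e' by apply: (unit_odd _ e); rewrite -ee; ring.
have oX2 : ~ even X2 by apply: oddM.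
have hA : u * U = X * X - T7 * (u * u) * (Y * Y).
  by apply: (lincomb2 u (X * X) hU uu); ring.
have hB : u * U = X2 * X2 - T7' * (u * u) * (Y2 * Y2).
  have hU2 : U = u' * (X2 * X2) - T7' * u * (Y2 * Y2) by rewrite hU' hve hve' /X2 /Y2; ring.
  by apply: (lincomb2 u (X2 * X2) hU2 uu); ring.
have hXY2 : X * Y = X2 * Y2.
  by rewrite -hXY hXY' /X2 /Y2; apply: (lincomb1 (- X' * Y') ee); ring.
(* The equation [X Y = X2 Y2] is parametrised by [X = g q], [Y = q' m], [X2 = g q'], [Y2 = q m]. *)
have [g [q [q' [hX hX2 cqq g0]]]] := gcd_split _ X2 (odd_neq0 _ oX).
have og : ~ even g by move=> [t ht]; apply: oX; exists (t * q); rewrite hX ht; ring.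
have oq : ~ even q by move=> [t ht]; apply: oX; exists (t * g); rewrite hX ht; ring.
have oq' : ~ even q' by move=> [t ht]; apply: oX2; exists (t * g); rewrite hX2 ht; ring.
have hqY : q * Y = q' * Y2.
  by apply: (mulI g) => //; apply: (lincomb3 1 (- Y) Y2 hXY2 hX hX2); ring.
have [m hm] : dvd q' Y.
  by apply: (coprime_gauss _ _ _ (coprime_sym _ _ cqq)); exists Y2.
have hm2 : Y2 = q * m.
  by apply: (mulI q'); [exact: odd_neq0 | rewrite -hqY hm; ring].
pose n := u * m.
have em : even m by move: eY; rewrite hm => /evenM [].
have en : even n by have [t ht] := em; exists (u * t); rewrite /n ht; ring.
have cgn : coprime g n.
  have c1 : coprime X m by apply: coprime_dvdr cXY _; exists q'; rewrite hm; ring.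
  have c2 : coprime m g.
    by apply: coprime_dvdr (coprime_sym _ _ c1) _; exists q.
  by apply: coprimeM (coprime_sym _ _ c2); exists 0, u'; rewrite -uu; ring.
have heq : q * q * (g * g + T7' * (n * n)) = q' * q' * (g * g + T7 * (n * n)).
  have e3 : X * X - T7 * (u * u) * (Y * Y) = X2 * X2 - T7' * (u * u) * (Y2 * Y2) by rewrite -hA -hB.
  by rewrite hm hm2 hX hX2 in e3; apply: (lincomb1 1 e3); rewrite /n; ring.
have [mu hmu'] : dvd (q' * q') (g * g + T7' * (n * n)).
  apply: (coprime_gauss _ (q * q)); last by exists (g * g + T7 * (n * n)).
  have c1 := coprimeM _ _ _ (coprime_sym _ _ cqq) (coprime_sym _ _ cqq).
  by apply: coprime_sym; apply: coprimeM; apply: coprime_sym.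
have hmu : g * g + T7 * (n * n) = q * q * mu.
  apply: (mulI (q' * q')); first by apply: odd_neq0; apply: oddM.
  by rewrite -heq hmu'; ring.
have [t ht] := en.
have omu : ~ even mu.
  move=> [r hr]; case: (oddM _ _ og og); exists (q' * q' * r - T7' * t * n).
  by apply: (lincomb3 1 (q' * q') (- T7' * n) hmu' hr ht); ring.
(* Eliminating between the two quadratic forms shows that [mu] divides [4 n^2] and [4 g^2]; it is
   odd and [g], [n] are coprime, so it is a unit. *)
have [mu' hmm] : dvd mu 1.
  have [s1 [s2 hs]] := coprimeM _ _ _ (coprime_sym _ _ (coprimeM _ _ _ cgn cgn))
    (coprime_sym _ _ (coprimeM _ _ _ cgn cgn)).
  have c4 := coprimeM _ _ _ (odd_coprime2 _ omu) (odd_coprime2 _ omu).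
  apply: (coprime_gauss _ _ _ c4).
  exists (th * th * (s1 * (q' * q' - q * q) + s2 * (T7' * (q * q) - T7 * (q' * q')))).
  have hT : T7' - T7 = inj 4 * (thi * thi) by [].
  have hth : th * th * (thi * thi) = 1 by [].
  have k1 : mu * (th * th * (q' * q' - q * q)) = inj 4 * (n * n).
    apply: (lincomb3 (th * th * n * n) (inj 4 * n * n) 1 hT hth (_ : th * th * (q' * q' * mu - q * q * mu) = th * th * (n * n * (T7' - T7)))).
      by rewrite -hmu -hmu'; ring.
    ring.
  have k2 : mu * (th * th * (T7' * (q * q) - T7 * (q' * q'))) = inj 4 * (g * g).
    apply: (lincomb3 (th * th * g * g) (inj 4 * g * g) 1 hT hth (_ : th * th * (T7' * (q * q * mu) - T7 * (q' * q' * mu)) = th * th * (g * g * (T7' - T7)))).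
      by rewrite -hmu -hmu'; ring.
    ring.
  apply: (lincomb3 (- s1) (- s2) (- inj 4) k1 k2 hs); ring.
have [f [f' [ff hf]]] : exists e e', e * e' = 1 /\ mu = e * e.
  apply: (odd_square_unit _ mu' q' g) => //.
  exists (T7' * t * t).
  have ht0 : n = inj 2 * t by rewrite ht; ring.
  by apply: (lincomb1 (inj (-1)) hmu'); rewrite ht0; ring.
have [beta' [hb1 hb2]] : exists z, n = p2 j.+1 * z /\ g * q * q' * z = u * beta.
  apply: p2_odd_dvd; first by do !apply: oddM.
  have e3 : V1 = g * q * (q' * m) by rewrite hXY hX hm.
  by apply: (lincomb1 (- u) e3); rewrite /n /V1; ring.
have ou : ~ even u by apply: (unit_odd _ u').
have ob' : ~ even beta'.
  by move=> [r hr]; case: (oddM _ _ ou ob); exists (g * q * q' * r); rewrite -hb2 hr; ring.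
(* [mu = f^2], so [(g, n)] solves the same two equations with one factor [2] fewer in the second
   entry. *)
apply: (IH g n beta' (f * q) (f * q') cgn og ob').
- by rewrite hb1 /=; ring.
- apply: (eqm2_cancel (g * q * q')); first by do !apply: oddM.
  rewrite hb2 dir hA.
  have eY0 : eqm 2 Y 0 := eY.
  have eqq : eqm 2 q q'.
    apply: sq_inj2; apply: (eqm2_cancel mu) => //; exists ((T7 - T7') * t * n).
    by apply: (lincomb3 (inj (-1)) 1 ((T7 - T7') * n) hmu hmu' ht); ring.
  by rewrite eY0 hX -eqq; apply: eq_eqm; ring.
- by rewrite hmu hf; ring.
- by rewrite hmu' hf; ring.
Qed.

(** On the circle, [N^3 + S R^2 = N^3 + N^2 S - S^3], the norm of [N - th S]. *)
Lemma norm_form_rep N S R P : rel_prime N S -> (S * S + R * R = N * N)%ZZ ->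
  (P * P = N * N * N + S * (R * R))%ZZ ->
  exists d w, (d = 1 \/ d = th) /\ inj N - th * inj S = d * (w * w).
Proof.
move=> NS hN hP.
have e : (S * (S * S + R * R) = S * (N * N))%ZZ by rewrite hN.
have [|d [w [v [hd h _]]]] := norm_form_square N S P NS; first by lia.
by exists d, w.
Qed.

(** Here [N - th S = (1 - th) U^2 + (1 + th) V^2], and [N + th S] has the coefficients exchanged,
    where [1 - th = th^5] and [1 + th = th^-2]. As [V] is even, congruences modulo [4] leave only
    the classes [th] and [1]; removing units makes [U^2 + th^-7 V^2] and [U^2 + th^7 V^2]
    squares. *)
Lemma circle_core N S R P Q U V : rel_prime N S -> (S * S + R * R = N * N)%ZZ ->
  (P * P = N * N * N + S * (R * R))%ZZ -> (Q * Q = N * N * N - S * (R * R))%ZZ ->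
  N = (U * U + V * V)%ZZ -> S = (U * U - V * V)%ZZ -> rel_prime U V ->
  Z.even U = false -> Z.even V = true -> V = 0%ZZ.
Proof.
move=> NS hN hP hQ eN eS UV oU eV; case: (Z.eq_dec V 0) => // V0; exfalso.
have [d [w [hd hw]]] := norm_form_rep _ _ _ _ NS hN hP.
have [||| d' [w' [hd' hw']]] := norm_form_rep N (- S) R Q.
- have [u [v uv]] := rel_prime_ex _ _ NS.
  by apply: bezout_rel_prime; apply: (Bezout_intro _ _ _ u (- v))%ZZ; lia.
- by lia.
- by lia.
have eV2 := even_sq4 _ eV; have [t ht] := eV2.
have iN : inj N = inj U * inj U + inj V * inj V by rewrite eN injD !injM.
have iS : inj S = inj U * inj U - inj V * inj V.
  rewrite eS (_ : U * U - V * V = U * U + (-1) * (V * V))%ZZ; last by ring.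
  by rewrite injD !injM; ring.
have iSn : inj (- S) = - inj S by [].
rewrite iN iS in hw; rewrite iSn iN iS in hw'.
have oUz := odd_inj _ oU.
case: hd => hd; rewrite hd in hw.
  apply: (not_unit_rep_sq4 th (th * th * inj U) w); [by right; right; left | by [] | |].
    by apply: oddM => //; apply: oddM; apply: th_odd.
  exists (- (1 + th) * inj t).
  by apply: (lincomb2 1 (- (1 + th)) hw ht); ring [th3].
case: hd' => hd'; rewrite hd' in hw'; last first.
  apply: (not_unit_rep_sq4 th (inj U) (th * th * w')); [by right; right; left | by [] | done |].
  exists (th * th * th * (1 - th) * (- inj t)).
  apply: (lincomb2 (th * th * th) (- th * th * th * (1 - th)) hw' ht); ring [th3].
have [j [m [om hm hj]]] := p2_val _ V0; have [i ji] := hj eV.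
have hV : inj V = inj 2 * (p2 i * inj m) by rewrite hm ji /=; ring.
apply: (twist_descent i (inj U) (inj V) (inj m) (th * w') (thi * thi * w)) => //.
- exact: rel_prime_coprime.
- exact: odd_inj.
- by rewrite (odd_inj2 _ oU) (odd_inj2 _ om); reflexivity.
- have -> : T7 = th * th * (1 - th) by [].
  by apply: (lincomb1 (- th * th) hw'); ring [th3].
- have -> : T7' = thi * thi * thi * thi * thi * (1 + th) by [].
  have k : thi * thi * thi * thi * thi * (1 - th) = 1 by [].
  have k2 : thi * thi * thi * thi * thi * th = thi * thi * thi * thi by [].
  have hw2 := hw.
  apply: (lincomb3 (- thi * thi * thi * thi * thi) (inj U * inj U) (- w * w) hw k k2); ring.
Qed.

(** For even [S], [N - S = V^2] and [N^3 - S R^2 = cubic_form (V^2) S], which is the curve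
    [t g = y^2] again. For even [R], the Pythagorean parametrisation leads to [circle_core], after
    changing the sign of [S] when [U] is the even parameter. *)
Lemma circle_points N S R P Q : rel_prime N S -> (0 < N)%ZZ -> (S * S + R * R = N * N)%ZZ ->
  (P * P = N * N * N + S * (R * R))%ZZ -> (Q * Q = N * N * N - S * (R * R))%ZZ ->
  S = 0%ZZ \/ R = 0%ZZ.
Proof.
move=> NS N0 hN hP hQ.
have [u [v uv]] := rel_prime_ex _ _ NS.
have SN : (- N <= S <= N)%ZZ by nia.
case ES : (Z.even S).
  have oN : Z.even N = false.
    by case E : (Z.even N) => //; case: (not_coprime_even _ _ NS E ES).
  have rp : rel_prime (N - S) (N + S).
    have /Z.even_spec [s1 hs1] := ES.
    have [n1 hn1] : exists n1, N = (2 * n1 + 1)%ZZ by apply/Z.odd_spec; rewrite -Z.negb_even oN.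
    have c2 : rel_prime (N - S) 2.
      by apply: bezout_rel_prime; apply: (Bezout_intro _ _ _ 1 (- (n1 - s1)))%ZZ; lia.
    have [x [y xy]] := rel_prime_ex _ _ c2.
    apply: bezout_rel_prime; apply: (Bezout_intro _ _ _ (x + y * (u - v)) (y * (u + v)))%ZZ.
    have : (y * (u * N + v * S) = y * 1)%ZZ by rewrite uv.
    lia.
  have [e [V [U [ee hV hU hR]]]] := Zsq_split _ _ R rp ltac:(lia).
  have e1 : (N - S = V * V)%ZZ.
    have [h|h] : (e = 1 \/ e = -1)%ZZ by nia.
      by rewrite hV h; lia.
    by rewrite h in hV hU; have := Z.square_nonneg V; have := Z.square_nonneg U; lia.
  have rV : rel_prime V S.
    by apply: bezout_rel_prime; apply: (Bezout_intro _ _ _ (u * V) (u + v))%ZZ; nia.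
  have [|V0|S0] := cubic_form_points V S Q rV; [ | | by left].
    have e2 : (S * (S * S + R * R) = S * (N * N))%ZZ by rewrite hN.
    by rewrite /cubic_form hQ -e1; lia.
  by right; rewrite hR V0.
case ER : (Z.even R); last first.
  exfalso; have [s hs] : exists s, S = (2 * s + 1)%ZZ by apply/Z.odd_spec; rewrite -Z.negb_even ES.
  have [r hr] : exists r, R = (2 * r + 1)%ZZ by apply/Z.odd_spec; rewrite -Z.negb_even ER.
  have : Z.even (N * N) = true by rewrite -hN Z.even_add !Z.even_mul ES ER.
  by rewrite Z.even_mul orbb => /Z.even_spec [n hn]; rewrite hn hs hr in hN; lia.
have oN : Z.even N = false.
  have : Z.even (N * N) = false by rewrite -hN Z.even_add !Z.even_mul ES ER.
  by rewrite Z.even_mul orbb.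
have [a [b [ha hb]]] : exists a b, (N = a + b /\ S = a - b)%ZZ.
  have [s hs] : exists s, S = (2 * s + 1)%ZZ by apply/Z.odd_spec; rewrite -Z.negb_even ES.
  have [n hn] : exists n, N = (2 * n + 1)%ZZ by apply/Z.odd_spec; rewrite -Z.negb_even oN.
  by exists (n + s + 1)%ZZ, (n - s)%ZZ; lia.
have /Z.even_spec [r hr] := ER.
have rab : rel_prime a b.
  by apply: bezout_rel_prime; apply: (Bezout_intro _ _ _ (u + v) (u - v))%ZZ; lia.
have hab : (a * b = r * r)%ZZ by rewrite ha hb hr in hN; lia.
have [e [U [V [ee hU hV hR]]]] := Zsq_split _ _ r rab hab.
have e1 : (e = 1)%ZZ.
  have [h|h] : (e = 1 \/ e = -1)%ZZ by nia.
    by [].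
  by rewrite h in hV hU; have := Z.square_nonneg V; have := Z.square_nonneg U; lia.
rewrite e1 !Z.mul_1_l in hU hV.
have rUV : rel_prime U V.
  have [x [y xy]] := rel_prime_ex _ _ rab.
  by apply: bezout_rel_prime; apply: (Bezout_intro _ _ _ (x * U) (y * V))%ZZ; rewrite hU hV in xy; lia.
right; rewrite hr hR.
rewrite hU hV in ha hb.
case EV : (Z.even V).
  have EU : Z.even U = false.
    by case E : (Z.even U) => //; case: (not_coprime_even _ _ rUV E EV).
  by rewrite (circle_core N S R P Q U V NS hN hP hQ ha hb rUV EU EV); lia.
have EU : Z.even U = true.
  by move: oN; rewrite ha Z.even_add !Z.even_mul EV; case: (Z.even U).
rewrite (circle_core N (- S) R Q P V U _ _ _ _ _ _ (rel_prime_sym _ _ rUV) EV EU) //; try lia.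
by apply: bezout_rel_prime; apply: (Bezout_intro _ _ _ u (- v))%ZZ; lia.
Qed.

End Zth.

From mathcomp Require Import ssrZ zify ring lra.
Delimit Scope Z_scope with ZZ.
Local Open Scope ring_scope.

(** * Rational points *)

Definition QZ (z : Z) : rat := (int_of_Z z)%:~R.

Lemma QZD x y : QZ (x + y)%ZZ = QZ x + QZ y.
Proof. by rewrite /QZ (rmorphD (int_of_Z : {rmorphism Z -> int}) x y) rmorphD. Qed.

Lemma QZM x y : QZ (x * y)%ZZ = QZ x * QZ y.
Proof. by rewrite /QZ (rmorphM (int_of_Z : {rmorphism Z -> int}) x y) rmorphM. Qed.

Lemma QZN x : QZ (- x)%ZZ = - QZ x.
Proof. by rewrite /QZ (rmorphN (int_of_Z : {rmorphism Z -> int}) x) rmorphN. Qed.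

Lemma QZB x y : QZ (x - y)%ZZ = QZ x - QZ y.
Proof. by rewrite (QZD x (- y)%ZZ) QZN. Qed.

Lemma QZ_inj : injective QZ.
Proof. by move=> x y /(intr_inj) h; apply: (can_inj int_of_ZK). Qed.

Lemma QZ1 : QZ 1 = 1. Proof. by []. Qed.
Lemma QZN1 : QZ (-1) = -1. Proof. by []. Qed.
Lemma QZ2 : QZ 2 = 2. Proof. by []. Qed.
Lemma QZ0 : QZ 0 = 0. Proof. by []. Qed.

Lemma QZ_gt0 x : (0 < x)%ZZ -> 0 < QZ x.
Proof. by move=> h; rewrite /QZ ltr0z; case: x h => [//|p|p //] _; rewrite /int_of_Z ltz_nat; apply/ssrnat.ltP; apply: Pos2Nat.is_pos. Qed.

Lemma rat_frac (t : rat) : exists a b, [/\ rel_prime a b, (0 < b)%ZZ & t * QZ b = QZ a].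
Proof.
exists (Z_of_int (numq t)), (Z_of_int (denq t)).
have d0 := denq_gt0 t.
split.
- have /coprimezP [[u v] /= uv] : coprimez (numq t) (denq t) by exact: coprime_num_den.
  apply: bezout_rel_prime; apply: (Bezout_intro _ _ _ (Z_of_int u) (Z_of_int v)).
  apply: (can_inj int_of_ZK).
  rewrite (rmorphD (int_of_Z : {rmorphism Z -> int}) (Z_of_int u * _)%ZZ).
  rewrite !(rmorphM (int_of_Z : {rmorphism Z -> int})) /= !Z_of_intK.
  exact: uv.
- by move: d0; case: (denq t) => // -[|n].
- by rewrite /QZ !Z_of_intK -numqE.
Qed.

Lemma sq_rat_int n (y : rat) : QZ n = y * y -> exists m, (n = m * m)%ZZ.
Proof.
have [p [q [pq q0 e]]] := rat_frac y => h.
have hn : (n * (q * q) = p * p)%ZZ.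
  by apply: QZ_inj; rewrite !QZM h -e; ring.
have [u [v uv]] := Zth.rel_prime_ex _ _ (Zth.rel_prime_mult2 _ _ _ pq pq).
have q1 : (q * (u * n * q + v) = 1)%ZZ by rewrite -uv -hn; lia.
have e1 : q = 1%ZZ by have := Z.mul_eq_1 _ _ q1; lia.
by exists p; rewrite e1 in hn; lia.
Qed.

Definition cg (t : rat) : rat := t ^+ 3 + 2 * t ^+ 2 + t + 1.

Ltac QZE := rewrite ?(QZM, QZD, QZB, QZN, QZN1, QZ2, QZ1).

(** The numerator [a] is coprime to [cubic_form a b], so both are squares up to a common sign;
    moving the sign into [b] gives an instance of [cubic_form_points]. *)
Lemma mul_cg_square (t y : rat) : t * cg t = y * y -> t = 0.
Proof.
have [a [b [ab b0 e]]] := rat_frac t => h.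
have hb := QZ_gt0 _ b0.
have [m hm] : exists m, (a * Zth.cubic_form a b = m * m)%ZZ.
  apply: (@sq_rat_int _ (y * (QZ b * QZ b))).
  have -> : y * (QZ b * QZ b) * (y * (QZ b * QZ b)) = y * y * (QZ b) ^+ 4 by ring.
  by rewrite -h /cg /Zth.cubic_form; QZE; rewrite -e; ring.
have rG : rel_prime a (Zth.cubic_form a b).
  have [u [v uv]] := Zth.rel_prime_ex _ _ (rel_prime_mult _ _ _ ab (rel_prime_mult _ _ _ ab ab)).
  apply: bezout_rel_prime; apply: (Bezout_intro _ _ _ (u - v * (a * a + 2 * a * b + b * b))%ZZ v).
  by rewrite -uv /Zth.cubic_form; lia.
have [s [g [k [ss ha hG _]]]] := Zth.Zsq_split _ _ _ rG hm.
have gg : (g * g = s * a)%ZZ by rewrite ha; nia.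
have rg : rel_prime g (s * b)%ZZ.
  have [u [v uv]] := Zth.rel_prime_ex _ _ ab.
  apply: bezout_rel_prime; apply: (Bezout_intro _ _ _ (u * s * g) (v * s))%ZZ.
  by have e1 : (v * b * (s * s) = v * b * 1)%ZZ; [rewrite ss | lia].
have hk : (Zth.cubic_form (g * g) (s * b) = k * k)%ZZ.
  rewrite gg; have -> : (Zth.cubic_form (s * a) (s * b) = s * s * (s * Zth.cubic_form a b))%ZZ.
    by rewrite /Zth.cubic_form; lia.
  by rewrite hG (_ : s * s * (s * (s * (k * k))) = (s * s) * ((s * s) * (k * k)))%ZZ; [rewrite ss; lia | lia].
have a0 : a = 0%ZZ.
  case: (Zth.cubic_form_points _ _ _ rg hk) => [g0|sb]; first by rewrite ha g0; lia.
  have s0 : s <> 0%ZZ by move=> s0; rewrite s0 in ss.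
  by move: sb => /Z.mul_eq_0 [//|]; lia.
move: e; rewrite a0 QZ0 => /eqP; rewrite mulf_eq0 (gt_eqF hb) orbF => /eqP.
by [].
Qed.

Lemma cg_pos (t : rat) : -1 <= t -> 0 < cg t.
Proof.
move=> h; rewrite /cg.
have [t0|t0] := lerP 0 t.
  have := exprn_ge0 3 t0; have := sqr_ge0 t; lra.
have e : t ^+ 3 + 2 * t ^+ 2 + t + 1 = t * (t + 1) ^+ 2 + 1 by ring.
rewrite e.
have h1 : 0 <= t + 1 by lra.
have h2 : (t + 1) ^+ 2 <= t + 1 by rewrite expr2; nra.
nra.
Qed.

(* In lowest terms the three factors are pairwise coprime, hence squares up to sign. *)
Lemma mul3_cg_square (t y : rat) : - (t * (t + 1) * cg t) = y * y -> exists s, - t = s * s.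
Proof.
have [a [b [ab b0 e]]] := rat_frac t => h.
have hb := QZ_gt0 _ b0.
have [m hm] : exists m, ((a * b) * (- ((a + b) * Zth.cubic_form a b)) = m * m)%ZZ.
  apply: (@sq_rat_int _ (y * (QZ b * QZ b * QZ b))).
  have -> : y * (QZ b * QZ b * QZ b) * (y * (QZ b * QZ b * QZ b)) = y * y * (QZ b) ^+ 6 by ring.
  by rewrite -h /cg /Zth.cubic_form; QZE; rewrite -e; ring.
have [u [v uv]] := Zth.rel_prime_ex _ _ ab.
have ra1 : rel_prime a (a + b).
  by apply: bezout_rel_prime; apply: (Bezout_intro _ _ _ (u - v) v)%ZZ; lia.
have rb1 : rel_prime b (a + b).
  by apply: bezout_rel_prime; apply: (Bezout_intro _ _ _ (v - u) u)%ZZ; lia.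
have raG : rel_prime a (Zth.cubic_form a b).
  have [u' [v' uv']] := Zth.rel_prime_ex _ _ (rel_prime_mult _ _ _ ab (rel_prime_mult _ _ _ ab ab)).
  apply: bezout_rel_prime; apply: (Bezout_intro _ _ _ (u' - v' * (a * a + 2 * a * b + b * b))%ZZ v').
  by rewrite -uv' /Zth.cubic_form; lia.
have rbG : rel_prime b (Zth.cubic_form a b).
  have ba := rel_prime_sym _ _ ab.
  have [u' [v' uv']] := Zth.rel_prime_ex _ _ (rel_prime_mult _ _ _ ba (rel_prime_mult _ _ _ ba ba)).
  apply: bezout_rel_prime; apply: (Bezout_intro _ _ _ (u' - v' * (2 * a * a + a * b + b * b))%ZZ v').
  by rewrite -uv' /Zth.cubic_form; lia.
have rr : rel_prime (a * b) (- ((a + b) * Zth.cubic_form a b)).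
  have r1 : rel_prime (a * b) ((a + b) * Zth.cubic_form a b).
    by apply: Zth.rel_prime_mult2; apply: rel_prime_mult.
  have [u' [v' uv']] := Zth.rel_prime_ex _ _ r1.
  by apply: bezout_rel_prime; apply: (Bezout_intro _ _ _ u' (- v'))%ZZ; lia.
have [s [g [k [ss hg hk _]]]] := Zth.Zsq_split _ _ _ rr hm.
(* The sign [1] would give [t >= 0] together with [(t + 1) g(t) <= 0]. *)
have [s1|s1] : (s = 1 \/ s = -1)%ZZ by nia.
  exfalso; rewrite s1 in hg hk.
  have t0 : 0 <= t.
    have : 0 <= t * (QZ b * QZ b).
      have -> : t * (QZ b * QZ b) = QZ g * QZ g by rewrite mulrA e -!QZM; congr QZ; lia.
      by rewrite -expr2 sqr_ge0.
    by rewrite pmulr_lge0 //; apply: mulr_gt0.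
  have : 0 < (t + 1) * cg t * (QZ b) ^+ 4.
    by rewrite !mulr_gt0 ?exprn_gt0 ?cg_pos //; lra.
  have -> : (t + 1) * cg t * (QZ b) ^+ 4 = - (QZ k * QZ k).
    have -> : (t + 1) * cg t * (QZ b) ^+ 4 = QZ ((a + b) * Zth.cubic_form a b)%ZZ.
      by rewrite /cg /Zth.cubic_form; QZE; rewrite -e; ring.
    by rewrite -QZM -QZN; congr QZ; lia.
  by have := sqr_ge0 (QZ k); rewrite expr2; lra.
exists (QZ g / QZ b).
have e2 : - (t * (QZ b * QZ b)) = QZ g * QZ g.
  by rewrite mulrA e -!QZM -QZN; congr QZ; rewrite hg s1; lia.
have b1 : QZ b != 0 by rewrite gt_eqF.
apply: (mulIf (mulf_neq0 b1 b1)); rewrite mulNr e2; field.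
by rewrite b1.
Qed.

Lemma sextic_rat (s y : rat) : s ^+ 6 + s ^+ 4 - 1 = y * y -> s ^+ 2 = 1.
Proof.
have [S [B [SB B0 e]]] := rat_frac s => h.
have hb := QZ_gt0 _ B0.
have [m hm] : exists m, (S * S * S * S * S * S + S * S * S * S * (B * B) - B * B * B * B * B * B = m * m)%ZZ.
  apply: (@sq_rat_int _ (y * (QZ B * QZ B * QZ B))).
  have -> : y * (QZ B * QZ B * QZ B) * (y * (QZ B * QZ B * QZ B)) = y * y * (QZ B) ^+ 6 by ring.
  by rewrite -h; QZE; rewrite -e; ring.
have hS : (S * S = B * B)%ZZ by apply: (Zth.sextic_points S B m) => //; lia.
have b1 : QZ B != 0 by rewrite gt_eqF.
apply: (mulIf (mulf_neq0 b1 b1)).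
have -> : s ^+ 2 * (QZ B * QZ B) = QZ S * QZ S by rewrite -e; ring.
by rewrite -QZM hS QZM mul1r.
Qed.

(** If [- t] is a square, so is [t g(t)], whence [t = 0], where [- g] is negative. If [t (t + 1)] is
    a square, then [t < -1], and the signs of coprime factors make [- t] a square again. If
    [t = - s^2 - 1], then [- g(t) = s^6 + s^4 - 1]. *)
Lemma neg_square_cases (t x : rat) : - cg t = x * x -> forall s : rat,
  (- t = s * s -> False) /\ (t * (t + 1) = s * s -> False) /\ (- (t + 1) = s * s -> t = -2).
Proof.
move=> hx.
have A s : - t = s * s -> False.
  move=> hs; have t0 : t = 0.
    apply: (@mul_cg_square t (s * x)).
    by have -> : s * x * (s * x) = s * s * (x * x) by [ring]; rewrite -hs -hx; ring.
  by have := sqr_ge0 x; rewrite expr2 -hx t0 /cg; lra.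
move=> s; split; [exact: A | split].
- move=> hs.
  have t1 : t < -1.
    rewrite ltNge; apply/negP => /cg_pos.
    by have := sqr_ge0 x; rewrite expr2 -hx; lra.
  have [a [b [ab b0 e]]] := rat_frac t.
  have hb := QZ_gt0 _ b0.
  have b1 : QZ b != 0 by rewrite gt_eqF.
  have [m hm] : exists m, (a * (a + b) = m * m)%ZZ.
    apply: (@sq_rat_int _ (s * QZ b)).
    by have -> : s * QZ b * (s * QZ b) = s * s * (QZ b * QZ b) by [ring]; rewrite -hs; QZE; rewrite -e; ring.
  have [n hn] : exists n, (b * (- Zth.cubic_form a b) = n * n)%ZZ.
    apply: (@sq_rat_int _ (x * (QZ b * QZ b))).
    have -> : x * (QZ b * QZ b) * (x * (QZ b * QZ b)) = x * x * (QZ b) ^+ 4 by ring.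
    by rewrite -hx /cg /Zth.cubic_form; QZE; rewrite -e; ring.
  have [u [v uv]] := Zth.rel_prime_ex _ _ ab.
  have ra1 : rel_prime a (a + b).
    by apply: bezout_rel_prime; apply: (Bezout_intro _ _ _ (u - v) v)%ZZ; lia.
  have rbG : rel_prime b (- Zth.cubic_form a b).
    have ba := rel_prime_sym _ _ ab.
    have [u' [v' uv']] := Zth.rel_prime_ex _ _ (rel_prime_mult _ _ _ ba (rel_prime_mult _ _ _ ba ba)).
    apply: bezout_rel_prime; apply: (Bezout_intro _ _ _ (u' + (- v') * (2 * a * a + a * b + b * b))%ZZ (- v')%ZZ).
    by rewrite -uv' /Zth.cubic_form; lia.
  have [r [g [k [rr hg _ _]]]] := Zth.Zsq_split _ _ _ ra1 hm.
  have [r' [g' [k' [rr' hg' _ _]]]] := Zth.Zsq_split _ _ _ rbG hn.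
  have r1 : (r = -1)%ZZ.
    have [r1|//] : (r = 1 \/ r = -1)%ZZ by nia.
    exfalso; have : QZ a < 0.
      by rewrite -e pmulr_llt0 //; lra.
    rewrite hg r1 !QZM QZ1 mul1r; have := sqr_ge0 (QZ g); rewrite expr2; lra.
  have r1' : (r' = 1)%ZZ.
    have [//|r1'] : (r' = 1 \/ r' = -1)%ZZ by nia.
    by exfalso; move: hg'; rewrite r1'; have := Z.square_nonneg g'; lia.
  apply: (A (QZ g / QZ g')).
  rewrite r1' Z.mul_1_l in hg'.
  have g0 : QZ g' != 0.
    by apply/eqP => g0; move: b1; rewrite hg' QZM g0 mulr0 eqxx.
  apply: (mulIf (mulf_neq0 g0 g0)).
  rewrite mulNr -QZM -hg' e hg r1 !QZM QZN1 hg' QZM; field.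
  by rewrite g0.
move=> hs.
have : s ^+ 6 + s ^+ 4 - 1 = x * x.
  rewrite -hx /cg; have -> : t = - (s * s) - 1 by rewrite -hs; ring.
  ring.
move/sextic_rat => s1.
have -> : t = - (s * s) - 1 by rewrite -hs; ring.
by rewrite -expr2 s1.
Qed.

(** For [t = - s^2], [t + 1 = 1 - s^2] and [g(t) = 1 - s^2 (1 - s^2)^2] are coprime after clearing
    denominators, hence squares up to a common sign. With sign [1] and [1 - s^2 = r^2], the factors
    [1 + s r^2] and [1 - s r^2] are squares in turn; sign [-1] falls under [neg_square_cases]. *)
Lemma circle_rat (t s y : rat) : t + 1 != 0 -> (t + 1) * cg t = y * y -> - t = s * s -> t = 0.
Proof.
move=> t1 hy hs.
have [S [B [SB B0 e]]] := rat_frac s.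
have hb := QZ_gt0 _ B0.
have b1 : QZ B != 0 by rewrite gt_eqF.
have tb : t * (QZ B * QZ B) = - (QZ S * QZ S).
  have -> : t = - (s * s) by rewrite -hs; ring.
  by rewrite -e; ring.
pose F := (B * B * B * B * B * B - S * S * ((B * B - S * S) * (B * B - S * S)))%ZZ.
have hcg : cg t * (QZ B) ^+ 6 = QZ F.
  have -> : cg t * (QZ B) ^+ 6 = (t * (QZ B * QZ B)) ^+ 3 + 2 * (t * (QZ B * QZ B)) ^+ 2 * (QZ B * QZ B)
      + t * (QZ B * QZ B) * (QZ B) ^+ 4 + (QZ B) ^+ 6 by rewrite /cg; ring.
  by rewrite tb /F; QZE; ring.
have ht1 : (t + 1) * (QZ B * QZ B) = QZ (B * B - S * S)%ZZ.
  by rewrite mulrDl tb; QZE; ring.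
have [m hm] : exists m, ((B * B - S * S) * F = m * m)%ZZ.
  apply: (@sq_rat_int _ (y * (QZ B) ^+ 4)).
  have -> : y * QZ B ^+ 4 * (y * QZ B ^+ 4) = y * y * (QZ B) ^+ 8 by ring.
  by rewrite QZM -ht1 -hcg -hy; ring.
have BS := rel_prime_sym _ _ SB.
have r1 : rel_prime (B * B - S * S) B.
  have [u [v uv]] := Zth.rel_prime_ex _ _ (Zth.rel_prime_mult2 _ _ _ SB SB).
  by apply: bezout_rel_prime; apply: (Bezout_intro _ _ _ (- u) (u * B + v))%ZZ; lia.
have r2 : rel_prime (B * B - S * S) F.
  have r6 : rel_prime (B * B - S * S) (B * B * B * B * B * B) by do 5![apply: rel_prime_mult => //].
  have [u [v uv]] := Zth.rel_prime_ex _ _ r6.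
  apply: bezout_rel_prime; apply: (Bezout_intro _ _ _ (u + v * (S * S * (B * B - S * S))) v)%ZZ.
  by rewrite -uv /F; lia.
have [r [R [w [rr hR hw _]]]] := Zth.Zsq_split _ _ _ r2 hm.
have [rE|rE] : (r = 1 \/ r = -1)%ZZ by nia.
  rewrite rE !Z.mul_1_l in hR hw.
  have hc : (S * S + R * R = B * B)%ZZ by lia.
  have oB : Z.even B = false.
    case EB : (Z.even B) => //; exfalso.
    have ES : Z.even S = false.
      by case ES : (Z.even S) => //; case: (Zth.not_coprime_even _ _ SB ES EB).
    have [k hk] : exists k, S = (2 * k + 1)%ZZ by apply/Z.odd_spec; rewrite -Z.negb_even ES.
    have /Z.even_spec [l hl] := EB.
    have ER : Z.even R = false.
      have : Z.even (R * R) = false.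
        by have -> : (R * R = B * B - S * S)%ZZ by [lia]; rewrite Z.even_sub !Z.even_mul EB ES.
      by rewrite Z.even_mul orbb.
    have [n hn] : exists n, R = (2 * n + 1)%ZZ by apply/Z.odd_spec; rewrite -Z.negb_even ER.
    by rewrite hk hl hn in hc; lia.
  have eSR : Z.even (S * (R * R)) = true.
    rewrite !Z.even_mul; have : Z.even (S * S + R * R) = false by rewrite hc Z.even_mul oB.
    by rewrite Z.even_add !Z.even_mul; case: (Z.even S); case: (Z.even R).
  have prod : ((B * B * B + S * (R * R)) * (B * B * B - S * (R * R)) = w * w)%ZZ.
    by rewrite -hw /F hR; lia.
  have rp : rel_prime (B * B * B + S * (R * R)) (B * B * B - S * (R * R)).
    have rB : rel_prime (B * B * B) (S * (R * R)).
      have rBR : rel_prime B (R * R) by rewrite -hR; apply: rel_prime_sym.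
      have r3 : rel_prime B (S * (R * R)) by apply: rel_prime_mult.
      by do 2![apply: Zth.rel_prime_mult2 => //].
    have /Z.even_spec [k hk] := eSR.
    have [n hn] : exists n, (B * B * B = 2 * n + 1)%ZZ.
      by apply/Z.odd_spec; rewrite -Z.negb_even !Z.even_mul oB.
    have [u [v uv]] := Zth.rel_prime_ex _ _ rB.
    rewrite hk hn in uv *.
    have c2 : rel_prime (2 * n + 1 + 2 * k) 2.
      by apply: bezout_rel_prime; apply: (Bezout_intro _ _ _ 1 (- (n + k)))%ZZ; lia.
    have [x [z xz]] := Zth.rel_prime_ex _ _ c2.
    apply: bezout_rel_prime; apply: (Bezout_intro _ _ _ (x + z * (u + v)) (z * (u - v)))%ZZ.
    have : (z * (u * (2 * n + 1) + v * (2 * k)) = z * 1)%ZZ by rewrite uv.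
    lia.
  have [r' [P [Q [rr' hP hQ _]]]] := Zth.Zsq_split _ _ _ rp prod.
  have r1' : (r' = 1)%ZZ.
    have [//|r1'] : (r' = 1 \/ r' = -1)%ZZ by nia.
    exfalso; rewrite r1' in hP hQ.
    have := Z.square_nonneg P; have := Z.square_nonneg Q.
    have : (0 < B * B * B)%ZZ by do 2!apply: Z.mul_pos_pos => //.
    lia.
  rewrite r1' !Z.mul_1_l in hP hQ.
  have [S0|R0] := Zth.circle_points B S R P Q BS B0 hc (esym hP) (esym hQ).
    move: tb; rewrite S0 QZ0 mulr0 oppr0 => /eqP; rewrite mulf_eq0.
    by rewrite (negbTE (mulf_neq0 b1 b1)) orbF => /eqP.
  move: ht1 => /eqP; rewrite hR R0 QZ0 mulf_eq0 (negbTE t1) (negbTE (mulf_neq0 b1 b1)).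
  by [].
exfalso; rewrite rE in hR hw.
have hn : - cg t = (QZ w / QZ B ^+ 3) * (QZ w / QZ B ^+ 3).
  apply: (mulIf (expf_neq0 6 b1)); rewrite mulNr hcg hw; QZE.
  by field; rewrite b1.
by have [h _] := neg_square_cases _ _ hn s; apply: h.
Qed.

(** On [E2], [t (t + 1) = s^2] gives [t g(t) = (y s)^2], and [- (t + 1) = s^2] gives
    [- g(t) = (y s)^2], the situation on [E1]. *)
Lemma piV3_degenerate (t s : rat) : piV3 t ->
  - t = s * s \/ t * (t + 1) = s * s \/ - (t + 1) = s * s -> t = 0 \/ t = -2.
Proof.
move=> [y [h|h]].
  have hx : - cg t = y * y.
    by move: h; rewrite /onE1 expr2 -/(cg t) => <-; ring.
  have [h1 [h2 h3]] := neg_square_cases _ _ hx s.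
  by case=> [/h1 // | [/h2 // | /h3]]; right.
have hc : cg t = y * y * (t + 1) by move: h; rewrite /onE2 expr2.
have t1 : t + 1 != 0.
  apply/eqP => t1; move: hc; rewrite t1 mulr0 /cg.
  by have -> : t = -1 by lra.
case=> [hs|[hs|hs]].
- left; apply: (@circle_rat t s ((t + 1) * y)) => //; rewrite hc; ring.
- left; apply: (@mul_cg_square t (y * s)); rewrite hc.
  by have -> : y * s * (y * s) = y * y * (s * s) by [ring]; rewrite -hs; ring.
- right; have hn : - cg t = (y * s) * (y * s).
    by have -> : y * s * (y * s) = y * y * (s * s) by [ring]; rewrite hc -hs; ring.
  by have [_ [_ h3]] := neg_square_cases _ _ hn s; apply: h3.
Qed.

(** * Quadratic towers and Galois groups *)

Section QuadraticTower.
Variable L : fieldExtType rat.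
Implicit Types E F : {subfield L}.

Definition sq_in E (x : L) := exists2 y, y \in E & y ^+ 2 = x.

(** Formulated by elements, so that one field can be presented as quadratic over two different
    subfields. *)
Definition quad_ext E F (r : L) :=
  [/\ r \notin E, r ^+ 2 \in E &
   forall x, x \in F <-> exists u v, [/\ u \in E, v \in E & x = u + v * r]].

Lemma adjoin_sqrt_deg E r : r ^+ 2 \in E -> (adjoin_degree E r <= 2)%N.
Proof.
move=> rE; have p0 : 'X^2 - (r ^+ 2)%:P != 0 :> {poly L}.
  by rewrite -size_poly_gt0 size_XnsubC.
have : minPoly E r %| 'X^2 - (r ^+ 2)%:P.
  apply: minPoly_dvdp.
    by rewrite rpredB ?rpredX ?polyOverX ?polyOverC.
  by rewrite rootE !hornerE subrr.
by move/(dvdp_leq p0); rewrite size_XnsubC // size_minPoly ltnS.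
Qed.

Lemma dim_adjoin_sqrt_le E r : r ^+ 2 \in E -> (\dim <<E; r>> <= 2 * \dim E)%N.
Proof. by move=> h; rewrite dim_Fadjoin leq_mul2r adjoin_sqrt_deg // orbT. Qed.

Lemma dim_adjoin_mem E r : r \in E -> \dim <<E; r>> = \dim E.
Proof. by move=> h; rewrite dim_Fadjoin (eqP (_ : adjoin_degree E r == 1%N)) ?mul1n ?adjoin_deg_eq1. Qed.

Lemma dim_adjoin_sqrt E r : r ^+ 2 \in E -> r \notin E -> \dim <<E; r>> = (2 * \dim E)%N.
Proof.
move=> h nr; rewrite dim_Fadjoin; congr muln; apply/eqP.
rewrite eqn_leq adjoin_sqrt_deg //= ltn_neqAle eq_sym adjoin_deg_eq1 nr.
by rewrite lt0n -(leqn0 _) -ltnNge.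
Qed.

Lemma quad_ext_adjoin E r : r ^+ 2 \in E -> r \notin E -> quad_ext E <<E; r>>%AS r.
Proof.
move=> h nr; split=> // x; split.
  move=> /Fadjoin_poly_eq <-; set p := Fadjoin_poly E r x.
  have sp : (size p <= 2)%N := leq_trans (size_Fadjoin_poly E r x) (adjoin_sqrt_deg _ _ h).
  have pE := Fadjoin_polyOver E r x.
  exists p`_0, p`_1; split; try exact: (polyOverP pE).
  by rewrite (horner_coef_wide _ sp) !big_ord_recl big_ord0 /= expr0 expr1 mulr1 addr0.
move=> [u [v [uE vE ->]]]; have sE := subvP (subv_adjoin E r).
by rewrite rpredD ?rpredM ?memv_adjoin ?sE.
Qed.

Lemma pchar_ext : [pchar L] =i pred0.
Proof. by move=> p; rewrite pchar_lalg; exact: Num.Theory.pchar_num. Qed.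

Lemma quad_ext_sub E F r x : quad_ext E F r -> x \in E -> x \in F.
Proof. by move=> [_ _ h] xE; apply/h; exists x, 0; rewrite rpred0 mul0r addr0. Qed.

Lemma two_neq0 : (2 : L) != 0.
Proof. by have := pchar_ext; move/pcharf0P => ->. Qed.

(** If [(u + v r)^2] lies in [E], then [2 u v = 0], since otherwise [r] would lie in [E]. *)
Lemma sq_descend E F r x : quad_ext E F r -> x \in E -> sq_in F x ->
  sq_in E x \/ sq_in E (x * r ^+ 2).
Proof.
move=> [nr rE h] xE [y /h [u [v [uE vE ->]]] e].
have uv : u * v = 0.
  apply/eqP; apply: contraNT nr => uv0.
  have -> : r = (x - u ^+ 2 - v ^+ 2 * r ^+ 2) / (2 * (u * v)).
    rewrite -e; field; move: uv0; rewrite mulf_eq0 negb_or => /andP [-> ->].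
    by rewrite two_neq0.
  apply: rpred_div; last by rewrite !rpredM ?rpred_nat.
  by apply: rpredB; [apply: rpredB => //; apply: rpredX | apply: rpredM => //; apply: rpredX].
move/eqP: uv; rewrite mulf_eq0 => /orP [/eqP u0|/eqP v0].
  right; exists (v * r ^+ 2); first by rewrite rpredM.
  by rewrite -e u0; ring.
by left; exists u => //; rewrite -e v0; ring.
Qed.

(** Conjugation turns a square root of [u + v r] into one of [u - v r]; their product is a root in
    [E] of the norm. *)
Lemma sq_norm E F r u v : quad_ext E F r -> u \in E -> v \in E -> sq_in F (u + v * r) ->
  sq_in E (u ^+ 2 - v ^+ 2 * r ^+ 2).
Proof.
move=> [nr rE h] uE vE [y /h [s [t [sE tE ->]]] e].
have e1 : (u - (s ^+ 2 + t ^+ 2 * r ^+ 2)) = (2 * s * t - v) * r.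
  by apply/eqP; rewrite -subr_eq0; apply/eqP; rewrite -[RHS](subrr ((s + t * r) ^+ 2)) {1}e; ring.
have e2 : 2 * s * t - v = 0.
  apply/eqP; apply: contraNT nr => n0.
  have -> : r = (u - (s ^+ 2 + t ^+ 2 * r ^+ 2)) / (2 * s * t - v) by rewrite e1 mulrAC divff ?mul1r.
  apply: rpred_div; last by apply: rpredB => //; rewrite !rpredM ?rpred_nat.
  by apply: rpredB => //; apply: rpredD; [apply: rpredX | apply: rpredM => //; apply: rpredX].
have hu : u = s ^+ 2 + t ^+ 2 * r ^+ 2 by apply/eqP; rewrite -subr_eq0 e1 e2 mul0r.
have hv : v = 2 * s * t by apply/esym/eqP; rewrite -subr_eq0 e2.
exists (s ^+ 2 - t ^+ 2 * r ^+ 2); first by apply: rpredB; [apply: rpredX | apply: rpredM => //; apply: rpredX].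
rewrite hu hv; ring.
Qed.

Lemma sq_cancel E w x : w \in E -> w != 0 -> sq_in E (w ^+ 2 * x) -> sq_in E x.
Proof.
move=> wE w0 [y yE e]; exists (y / w); first by rewrite rpred_div.
by rewrite expr_div_n e mulrAC divff ?mul1r // expf_neq0.
Qed.
End QuadraticTower.
Arguments sq_in {L}.
Arguments quad_ext {L}.

Definition nonsq (x : rat) := forall s : rat, x <> s * s.

Lemma nonsq_scale w x : nonsq x -> w != 0 -> nonsq (w ^+ 2 * x).
Proof.
move=> h w0 s e; apply: (h (s / w)).
by apply: (mulfI (expf_neq0 2 w0)); rewrite e; field.
Qed.

Lemma nonsq_neq0 x : nonsq x -> x != 0.
Proof. by move=> h; apply/eqP => x0; apply: (h 0); rewrite x0 mul0r. Qed.

(** * The tower of square roots under generic conditions on [c] *)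

Section Tower.
Variables (L : fieldExtType rat) (c : rat) (a b1 b2 : L).
Local Notation "x %:L" := (in_alg L x) (at level 2, format "x %:L").
Hypothesis ha : a ^+ 2 = - c%:L.
Hypothesis hb1 : b1 ^+ 2 = a - c%:L.
Hypothesis hb2 : b2 ^+ 2 = - a - c%:L.

(** The roots of [f^2] are [b1], [b2] and their negatives, so [F2] is generated by them. [G1] and
    [G2] are two intermediate fields, each the target of a norm map from [F2]. *)
Definition F1 : {subfield L} := <<1%AS; a>>%AS.
Definition G1 : {subfield L} := <<F1; b1>>%AS.
Definition G2 : {subfield L} := <<F1; b2>>%AS.
Definition F2 : {subfield L} := <<G1; b2>>%AS.

Lemma alg_in (E : {subfield L}) x : x%:L \in E.
Proof. by rewrite rpredZ ?rpred1. Qed.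

Lemma a2_in : a ^+ 2 \in (1%AS : {subfield L}).
Proof. by rewrite ha rpredN alg_in. Qed.

Lemma a_in1 : a \in F1. Proof. exact: memv_adjoin. Qed.

Lemma b1_2in (E : {subfield L}) : (F1 <= E)%VS -> b1 ^+ 2 \in E.
Proof. by move/subvP => h; apply: h; rewrite hb1 rpredB ?alg_in ?a_in1. Qed.

Lemma b2_2in (E : {subfield L}) : (F1 <= E)%VS -> b2 ^+ 2 \in E.
Proof. by move/subvP => h; apply: h; rewrite hb2 rpredB ?alg_in // rpredN a_in1. Qed.

Lemma sub_F1G1 : (F1 <= G1)%VS. Proof. exact: subv_adjoin. Qed.
Lemma sub_F1G2 : (F1 <= G2)%VS. Proof. exact: subv_adjoin. Qed.

Lemma base_sq x : sq_in (1%AS : {subfield L}) x%:L -> exists s, x = s * s.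
Proof.
move=> [y /vlineP [k ->] e]; exists k; apply: (fmorph_inj (in_alg L)).
by apply: etrans (esym e) _; rewrite rmorphM expr2.
Qed.

Hypothesis n1 : nonsq (- c).

Lemma a_notin : a \notin (1%AS : {subfield L}).
Proof.
apply/negP => h; have [|s e] := base_sq (- c); last exact: (n1 s).
by exists a => //; rewrite ha rmorphN.
Qed.

Lemma quad_F1 : quad_ext 1%AS F1 a.
Proof. exact: (quad_ext_adjoin _ _ _ a2_in a_notin). Qed.

Lemma norm_F1 k l x : x = k%:L + l%:L * a -> sq_in F1 x -> exists s, k ^+ 2 + c * l ^+ 2 = s * s.
Proof.
move=> -> /(sq_norm _ _ _ _ _ _ quad_F1 (alg_in _ _) (alg_in _ _)) h.
apply: base_sq; move: h; congr (sq_in _ _).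
by rewrite ha !(rmorphD, rmorphM, rmorphXn) /=; ring.
Qed.

Hypothesis n2 : nonsq (c ^+ 2 + c).
Hypothesis n3 : nonsq (- (c + 1)).

Let c0 : c != 0. Proof. by have := nonsq_neq0 _ n1; rewrite oppr_eq0. Qed.

Lemma b1_notin : b1 \notin F1.
Proof.
apply/negP => h; have [||s] := norm_F1 (- c) 1 (a - c%:L); first by rewrite rmorphN rmorph1; ring.
  by exists b1.
by rewrite [X in X = _](_ : _ = c ^+ 2 + c); [exact: n2 | ring].
Qed.

Lemma b2_notin : b2 \notin F1.
Proof.
apply/negP => h; have [||s] := norm_F1 (- c) (- 1) (- a - c%:L); first by rewrite !rmorphN rmorph1; ring.
  by exists b2.
by rewrite [X in X = _](_ : _ = c ^+ 2 + c); [exact: n2 | ring].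
Qed.

Lemma quad_G1 : quad_ext F1 G1 b1.
Proof. exact: (quad_ext_adjoin _ _ _ (b1_2in _ (subvv _)) b1_notin). Qed.

Lemma quad_G2 : quad_ext F1 G2 b2.
Proof. exact: (quad_ext_adjoin _ _ _ (b2_2in _ (subvv _)) b2_notin). Qed.

Lemma c2c_notin : ~ sq_in F1 (c ^+ 2 + c)%:L.
Proof.
case/(sq_descend _ _ _ _ _ quad_F1 (alg_in _ _)); first by case/base_sq => s; apply: n2.
rewrite ha -rmorphN -rmorphM => /base_sq [s].
rewrite (_ : _ * _ = c ^+ 2 * (- (c + 1))); last by ring.
exact: (nonsq_scale _ _ n3 c0).
Qed.

Lemma prodb : (a - c%:L) * (- a - c%:L) = (c ^+ 2 + c)%:L.
Proof.
have -> : (a - c%:L) * (- a - c%:L) = c%:L ^+ 2 - a ^+ 2 by ring.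
by rewrite ha rmorphD rmorphXn /=; ring.
Qed.

Lemma b2_notinG1 : b2 \notin G1.
Proof.
apply/negP => h; have : sq_in G1 (- a - c%:L) by exists b2.
case/(sq_descend _ _ _ _ _ quad_G1).
- by rewrite rpredB ?alg_in // rpredN a_in1.
- move/(norm_F1 (- c) (- 1)) => [|s]; first by rewrite !rmorphN rmorph1; ring.
  by rewrite [X in X = _](_ : _ = c ^+ 2 + c); [exact: n2 | ring].
by rewrite hb1 mulrC prodb => /c2c_notin.
Qed.

Lemma b1_notinG2 : b1 \notin G2.
Proof.
apply/negP => h; have : sq_in G2 (a - c%:L) by exists b1.
case/(sq_descend _ _ _ _ _ quad_G2).
- by rewrite rpredB ?alg_in // a_in1.
- move/(norm_F1 (- c) 1) => [|s]; first by rewrite rmorphN rmorph1; ring.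
  by rewrite [X in X = _](_ : _ = c ^+ 2 + c); [exact: n2 | ring].
by rewrite hb2 prodb => /c2c_notin.
Qed.

Lemma quad_F2 : quad_ext G1 F2 b2.
Proof. exact: (quad_ext_adjoin _ _ _ (b2_2in _ sub_F1G1) b2_notinG1). Qed.

Lemma quad_F2' : quad_ext G2 F2 b1.
Proof.
have [h1 h2 h3] := quad_ext_adjoin _ _ _ (b1_2in _ sub_F1G2) b1_notinG2.
by split=> // x; rewrite -h3 /= adjoinC.
Qed.

Lemma dim_F2 : \dim F2 = 8.
Proof.
rewrite /F2 (dim_adjoin_sqrt _ _ _ (b2_2in _ sub_F1G1) b2_notinG1).
rewrite (dim_adjoin_sqrt _ _ _ (b1_2in _ (subvv _)) b1_notin).
by rewrite (dim_adjoin_sqrt _ _ _ a2_in a_notin) dimv1.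
Qed.

(** Kummer theory for the biquadratic extension [F2] of [F1]: the classes that become squares are
    generated by [a - c] and [- a - c], with product [c^2 + c]. *)
Lemma descend_F2 x : x \in F1 -> sq_in F2 x ->
  [\/ sq_in F1 x, sq_in F1 (x * (a - c%:L)), sq_in F1 (x * (- a - c%:L))
    | sq_in F1 (x * (c ^+ 2 + c)%:L)].
Proof.
move=> xF; have xG := quad_ext_sub _ _ _ _ _ quad_G1 xF.
have h2F : - a - c%:L \in F1 by rewrite rpredB ?alg_in // rpredN a_in1.
case/(sq_descend _ _ _ _ _ quad_F2 xG).
  case/(sq_descend _ _ _ _ _ quad_G1 xF); first by constructor 1.
  by rewrite hb1; constructor 2.
rewrite hb2; case/(sq_descend _ _ _ _ _ quad_G1); first by rewrite rpredM.
  by constructor 3.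
by rewrite hb1 -mulrA [X in _ * X]mulrC prodb; constructor 4.
Qed.

Let c3 := (c ^+ 2 + c) ^+ 2 + c.
Hypothesis m1 : nonsq c3.
Hypothesis m3 : nonsq (c3 * (c ^+ 2 + c)).

Let c2c0 : c ^+ 2 + c != 0. Proof. exact: nonsq_neq0. Qed.

(* The norm of [c^2 + c + e a] to the rationals is [c3]. *)
Lemma D_nonsq (e : rat) : e ^+ 2 = 1 -> ~ sq_in F2 ((c ^+ 2 + c)%:L + e%:L * a).
Proof.
move=> e1; have eL : e%:L ^+ 2 = 1 by rewrite -rmorphXn e1 rmorph1.
case/descend_F2; first by rewrite rpredD ?rpredM ?alg_in ?a_in1.
- move/(norm_F1 (c ^+ 2 + c) e) => [//|s].
  by rewrite e1 mulr1; apply: m1.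
- move/(norm_F1 (- c * (c ^+ 2 + c) - e * c) (c ^+ 2 + c - e * c)) => [|s].
    have -> : ((c ^+ 2 + c)%:L + e%:L * a) * (a - c%:L)
      = (c ^+ 2 + c)%:L * a - (c ^+ 2 + c)%:L * c%:L + e%:L * a ^+ 2 - e%:L * c%:L * a by ring.
    by rewrite ha !(rmorphB, rmorphM, rmorphN) /=; ring.
  rewrite [X in X = _](_ : _ = c3 * (c ^+ 2 + c)); first exact: m3.
  have -> : (- c * (c ^+ 2 + c) - e * c) ^+ 2 + c * (c ^+ 2 + c - e * c) ^+ 2
    = c ^+ 2 * (c ^+ 2 + c) ^+ 2 + e ^+ 2 * c ^+ 2 + c * (c ^+ 2 + c) ^+ 2 + c * e ^+ 2 * c ^+ 2 by ring.
  by rewrite e1 /c3; ring.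
- move/(norm_F1 (- c * (c ^+ 2 + c) + e * c) (- (c ^+ 2 + c) - e * c)) => [|s].
    have -> : ((c ^+ 2 + c)%:L + e%:L * a) * (- a - c%:L)
      = - (c ^+ 2 + c)%:L * a - (c ^+ 2 + c)%:L * c%:L - e%:L * a ^+ 2 - e%:L * c%:L * a by ring.
    by rewrite ha !(rmorphB, rmorphD, rmorphM, rmorphN) /=; ring.
  rewrite [X in X = _](_ : _ = c3 * (c ^+ 2 + c)); first exact: m3.
  have -> : (- c * (c ^+ 2 + c) + e * c) ^+ 2 + c * (- (c ^+ 2 + c) - e * c) ^+ 2
    = c ^+ 2 * (c ^+ 2 + c) ^+ 2 + e ^+ 2 * c ^+ 2 + c * (c ^+ 2 + c) ^+ 2 + c * e ^+ 2 * c ^+ 2 by ring.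
  by rewrite e1 /c3; ring.
move/(norm_F1 ((c ^+ 2 + c) ^+ 2) (e * (c ^+ 2 + c))) => [|s].
  by rewrite !(rmorphM, rmorphXn) /=; ring.
rewrite [X in X = _](_ : _ = (c ^+ 2 + c) ^+ 2 * c3); first exact: nonsq_scale.
have -> : (e * (c ^+ 2 + c)) ^+ 2 = e ^+ 2 * (c ^+ 2 + c) ^+ 2 by ring.
by rewrite e1 /c3; ring.
Qed.

Hypothesis m2 : nonsq (- c * c3).
Hypothesis m4 : nonsq (- (c + 1) * c3).

Lemma c3_nonsq : ~ sq_in F2 c3%:L.
Proof.
have c30 : c3 != 0 by exact: nonsq_neq0.
have base x : sq_in F1 x%:L -> (exists s, x = s * s) \/ (exists s, - c * x = s * s).
  case/(sq_descend _ _ _ _ _ quad_F1 (alg_in _ _)); first by move/base_sq; left.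
  by rewrite ha -rmorphN -rmorphM mulrC => /base_sq; right.
case/descend_F2; first exact: alg_in.
- by case/base => [] [s]; [apply: m1 | apply: m2].
- move/(norm_F1 (- c * c3) c3) => [|s]; first by rewrite rmorphM rmorphN /=; ring.
  rewrite [X in X = _](_ : _ = c3 ^+ 2 * (c ^+ 2 + c)); first exact: nonsq_scale.
  by ring.
- move/(norm_F1 (- c * c3) (- c3)) => [|s]; first by rewrite rmorphM !rmorphN /=; ring.
  rewrite [X in X = _](_ : _ = c3 ^+ 2 * (c ^+ 2 + c)); first exact: nonsq_scale.
  by ring.
rewrite -rmorphM => /base [] [s]; first exact: m3.
rewrite (_ : _ * _ = c ^+ 2 * (- (c + 1) * c3)); first exact: nonsq_scale.
by ring.
Qed.

Variables g1 g2 g3 g4 : L.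
Hypothesis hg1 : g1 ^+ 2 = b1 - c%:L.
Hypothesis hg2 : g2 ^+ 2 = - b1 - c%:L.
Hypothesis hg3 : g3 ^+ 2 = b2 - c%:L.
Hypothesis hg4 : g4 ^+ 2 = - b2 - c%:L.

Definition K1 : {subfield L} := <<F2; g1>>%AS.
Definition K2 : {subfield L} := <<K1; g2>>%AS.
Definition K3 : {subfield L} := <<K2; g3>>%AS.
Definition K4 : {subfield L} := <<K3; g4>>%AS.

Let D := (c ^+ 2 + c)%:L - a.
Let D' := (c ^+ 2 + c)%:L + a.

Lemma D_nsq : ~ sq_in F2 D.
Proof.
have e1 : (-1 : rat) ^+ 2 = 1 by rewrite sqrrN expr1n.
by have := D_nonsq (- 1) e1; rewrite rmorphN rmorph1 mulN1r.
Qed.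

Lemma D'_nsq : ~ sq_in F2 D'.
Proof. by have := D_nonsq 1 (expr1n _ _); rewrite rmorph1 mul1r. Qed.

Lemma nsq_neq0 (E : {subfield L}) x : ~ sq_in E x -> x != 0.
Proof. by move=> h; apply/eqP => x0; apply: h; exists 0; rewrite ?rpred0 // x0 expr0n. Qed.

Lemma mem_G1 x : x \in F1 -> x \in G1. Proof. exact: (subvP sub_F1G1). Qed.
Lemma mem_G2 x : x \in F1 -> x \in G2. Proof. exact: (subvP sub_F1G2). Qed.
Lemma mem_F2 x : x \in G1 -> x \in F2. Proof. exact: (quad_ext_sub _ _ _ _ _ quad_F2). Qed.
Lemma mem_F2' x : x \in G2 -> x \in F2. Proof. exact: (quad_ext_sub _ _ _ _ _ quad_F2'). Qed.

Lemma D_F1 : D \in F1. Proof. by rewrite rpredB ?alg_in ?a_in1. Qed.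
Lemma D'_F1 : D' \in F1. Proof. by rewrite rpredD ?alg_in ?a_in1. Qed.
Lemma b1_G1 : b1 \in G1. Proof. exact: memv_adjoin. Qed.
Lemma b2_G2 : b2 \in G2. Proof. exact: memv_adjoin. Qed.

Lemma norm_b1 w (e : L) : w \in G2 -> w != 0 -> e \in G2 -> e ^+ 2 = 1 ->
  ~ sq_in F2 (w * (e * b1 - c%:L)).
Proof.
move=> wG w0 eG e1.
have -> : w * (e * b1 - c%:L) = - (w * c%:L) + w * e * b1 by ring.
move/(sq_norm _ _ _ _ _ _ quad_F2'); case.
- by rewrite rpredN rpredM ?alg_in.
- by rewrite rpredM.
move=> y yG hy; apply: D_nsq.
have [|z zG hz] := sq_cancel _ _ w D wG w0.
  exists y => //; rewrite hy.
  have -> : (- (w * c%:L)) ^+ 2 - (w * e) ^+ 2 * b1 ^+ 2 = w ^+ 2 * c%:L ^+ 2 - e ^+ 2 * w ^+ 2 * b1 ^+ 2 by ring.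
  by rewrite e1 hb1 /D rmorphD rmorphXn /=; ring.
by exists z => //; apply: mem_F2'.
Qed.

Lemma norm_b2 w (e : L) : w \in G1 -> w != 0 -> e \in G1 -> e ^+ 2 = 1 ->
  ~ sq_in F2 (w * (e * b2 - c%:L)).
Proof.
move=> wG w0 eG e1.
have -> : w * (e * b2 - c%:L) = - (w * c%:L) + w * e * b2 by ring.
move/(sq_norm _ _ _ _ _ _ quad_F2); case.
- by rewrite rpredN rpredM ?alg_in.
- by rewrite rpredM.
move=> y yG hy; apply: D'_nsq.
have [|z zG hz] := sq_cancel _ _ w D' wG w0.
  exists y => //; rewrite hy.
  have -> : (- (w * c%:L)) ^+ 2 - (w * e) ^+ 2 * b2 ^+ 2 = w ^+ 2 * c%:L ^+ 2 - e ^+ 2 * w ^+ 2 * b2 ^+ 2 by ring.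
  by rewrite e1 hb2 /D' rmorphD rmorphXn /=; ring.
by exists z => //; apply: mem_F2.
Qed.

Let x1 := b1 - c%:L.
Let x2 := - b1 - c%:L.
Let x3 := b2 - c%:L.
Let x4 := - b2 - c%:L.

Let one2 : (1 : L) ^+ 2 = 1. Proof. exact: expr1n. Qed.
Let mone2 : (- 1 : L) ^+ 2 = 1. Proof. by rewrite sqrrN expr1n. Qed.

Lemma x1_G1 : x1 \in G1. Proof. by rewrite rpredB ?alg_in ?b1_G1. Qed.
Lemma x2_G1 : x2 \in G1. Proof. by rewrite rpredB ?alg_in ?rpredN ?b1_G1. Qed.
Lemma x3_F2 : x3 \in F2. Proof. by rewrite rpredB ?alg_in // mem_F2' ?b2_G2. Qed.
Lemma x4_F2 : x4 \in F2. Proof. by rewrite rpredB ?alg_in // rpredN mem_F2' ?b2_G2. Qed.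

Lemma x1_nsq w : w \in G2 -> w != 0 -> ~ sq_in F2 (w * x1).
Proof. by move=> wG w0; have := norm_b1 w 1 wG w0 (rpred1 _) one2; rewrite mul1r. Qed.
Lemma x2_nsq w : w \in G2 -> w != 0 -> ~ sq_in F2 (w * x2).
Proof.
by move=> wG w0; have := norm_b1 w (- 1) wG w0 (rpredN1 _) mone2; rewrite mulN1r.
Qed.
Lemma x3_nsq w : w \in G1 -> w != 0 -> ~ sq_in F2 (w * x3).
Proof. by move=> wG w0; have := norm_b2 w 1 wG w0 (rpred1 _) one2; rewrite mul1r. Qed.
Lemma x4_nsq w : w \in G1 -> w != 0 -> ~ sq_in F2 (w * x4).
Proof.
by move=> wG w0; have := norm_b2 w (- 1) wG w0 (rpredN1 _) mone2; rewrite mulN1r.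
Qed.

Lemma x12 : x1 * x2 = D.
Proof.
have -> : x1 * x2 = c%:L ^+ 2 - b1 ^+ 2 by rewrite /x1 /x2; ring.
by rewrite hb1 /D rmorphD rmorphXn /=; ring.
Qed.
Lemma x34 : x3 * x4 = D'.
Proof.
have -> : x3 * x4 = c%:L ^+ 2 - b2 ^+ 2 by rewrite /x3 /x4; ring.
by rewrite hb2 /D' rmorphD rmorphXn /=; ring.
Qed.
Lemma DD' : D * D' = c3%:L.
Proof.
have -> : D * D' = (c ^+ 2 + c)%:L ^+ 2 - a ^+ 2 by rewrite /D /D'; ring.
by rewrite ha /c3 (rmorphD _ ((c ^+ 2 + c) ^+ 2)) rmorphXn /=; ring.
Qed.

Lemma x1_neq0 : x1 != 0.
Proof. by have /nsq_neq0 := x1_nsq 1 (rpred1 _) (oner_neq0 _); rewrite mul1r. Qed.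
Lemma x2_neq0 : x2 != 0.
Proof. by have /nsq_neq0 := x2_nsq 1 (rpred1 _) (oner_neq0 _); rewrite mul1r. Qed.

Lemma g1_notin : g1 \notin F2.
Proof.
apply/negP => h; case: (x1_nsq 1 (rpred1 _) (oner_neq0 _)).
by rewrite mul1r; exists g1.
Qed.

Lemma quad_K1 : quad_ext F2 K1 g1.
Proof.
by apply: quad_ext_adjoin g1_notin; rewrite hg1 mem_F2 ?x1_G1.
Qed.

Lemma g2_notin : g2 \notin K1.
Proof.
apply/negP => h; have : sq_in K1 x2 by exists g2.
case/(sq_descend _ _ _ _ _ quad_K1); first by rewrite mem_F2 ?x2_G1.
  by rewrite -[x2]mul1r; apply: x2_nsq; rewrite ?rpred1 ?oner_neq0.
by rewrite hg1 mulrC x12; apply: D_nsq.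
Qed.

Lemma quad_K2 : quad_ext K1 K2 g2.
Proof.
apply: quad_ext_adjoin g2_notin.
by apply: (quad_ext_sub _ _ _ _ _ quad_K1); rewrite hg2 mem_F2 ?x2_G1.
Qed.

Lemma descend_K2 x : x \in F2 -> sq_in K2 x ->
  [\/ sq_in F2 x, sq_in F2 (x * x1), sq_in F2 (x * x2) | sq_in F2 (D * x)].
Proof.
move=> xF; have xK := quad_ext_sub _ _ _ _ _ quad_K1 xF.
case/(sq_descend _ _ _ _ _ quad_K2 xK).
  case/(sq_descend _ _ _ _ _ quad_K1 xF); first by constructor 1.
  by rewrite hg1; constructor 2.
rewrite hg2; case/(sq_descend _ _ _ _ _ quad_K1).
- by rewrite rpredM // mem_F2 ?x2_G1.
- by constructor 3.
by rewrite hg1 -mulrA [X in _ * X]mulrC x12 mulrC; constructor 4.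
Qed.

Let D0 : D != 0. Proof. exact: (nsq_neq0 _ _ D_nsq). Qed.
Let D'0 : D' != 0. Proof. exact: (nsq_neq0 _ _ D'_nsq). Qed.

(** The multipliers [1], [x1], [x2], [D] produced by [descend_K2] all lie in [G1], so the norm down
    to [G1] reduces each case to [D']. *)
Lemma g3_notin : g3 \notin K2.
Proof.
apply/negP => h; have : sq_in K2 x3 by exists g3.
case/(descend_K2 _ x3_F2).
- by rewrite -[x3]mul1r; apply: x3_nsq; rewrite ?rpred1 ?oner_neq0.
- by rewrite mulrC; apply: x3_nsq; [exact: x1_G1 | exact: x1_neq0].
- by rewrite mulrC; apply: x3_nsq; [exact: x2_G1 | exact: x2_neq0].
- by apply: x3_nsq => //; apply: mem_G1; exact: D_F1.
Qed.

Lemma mem_K2 x : x \in F2 -> x \in K2.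
Proof. by move/(quad_ext_sub _ _ _ _ _ quad_K1)/(quad_ext_sub _ _ _ _ _ quad_K2). Qed.

Lemma quad_K3 : quad_ext K2 K3 g3.
Proof. by apply: quad_ext_adjoin g3_notin; rewrite hg3 mem_K2 ?x3_F2. Qed.

(** Beyond the multiples of [x4], handled as for [g3], the product [x3 x4 = D'] occurs with the
    multipliers [1], [x1], [x2], [D]; the last gives the rational number [D D' = c3]. *)
Lemma g4_notin : g4 \notin K3.
Proof.
apply/negP => h; have : sq_in K3 x4 by exists g4.
case/(sq_descend _ _ _ _ _ quad_K3 (mem_K2 _ x4_F2)).
  case/(descend_K2 _ x4_F2).
  - by rewrite -[x4]mul1r; apply: x4_nsq; rewrite ?rpred1 ?oner_neq0.
  - by rewrite mulrC; apply: x4_nsq; [exact: x1_G1 | exact: x1_neq0].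
  - by rewrite mulrC; apply: x4_nsq; [exact: x2_G1 | exact: x2_neq0].
  - by apply: x4_nsq => //; apply: mem_G1; exact: D_F1.
rewrite hg3 mulrC x34 => /descend_K2 [].
- by rewrite mem_F2 // mem_G1 // D'_F1.
- exact: D'_nsq.
- by apply: x1_nsq => //; apply: mem_G2; exact: D'_F1.
- by apply: x2_nsq => //; apply: mem_G2; exact: D'_F1.
by rewrite DD'; exact: c3_nonsq.
Qed.

Lemma dim_K4 : \dim K4 = 128.
Proof.
have s1 : g1 ^+ 2 \in F2 by rewrite hg1 mem_F2 ?x1_G1.
have s2 : g2 ^+ 2 \in K1 by apply: (quad_ext_sub _ _ _ _ _ quad_K1); rewrite hg2 mem_F2 ?x2_G1.
have s3 : g3 ^+ 2 \in K2 by rewrite hg3 mem_K2 ?x3_F2.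
have s4 : g4 ^+ 2 \in K3.
  by apply: (quad_ext_sub _ _ _ _ _ quad_K3); rewrite hg4 mem_K2 ?x4_F2.
rewrite /K4 (dim_adjoin_sqrt _ _ _ s4 g4_notin) (dim_adjoin_sqrt _ _ _ s3 g3_notin).
by rewrite (dim_adjoin_sqrt _ _ _ s2 g2_notin) (dim_adjoin_sqrt _ _ _ s1 g1_notin) dim_F2.
Qed.
End Tower.

(** * Splitting fields of the iterates *)

Lemma fc_iterS c n : fc_iter c n.+1 = fc_iter c n ^+ 2 + c%:P.
Proof.
elim: n => [|n IH]; first by rewrite /fc_iter /= comp_polyX.
rewrite -[LHS]/(fc_iter c n.+1 \Po fc c) [in LHS]IH comp_polyD comp_polyC.
by rewrite expr2 comp_polyM -expr2.
Qed.

Lemma fc_iter_neq0 c n : fc_iter c n != 0.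
Proof.
have : size (fc_iter c n) = (2 ^ n).+1.
  elim: n => [|n IH]; first by rewrite size_polyX.
  have s2 : size (fc_iter c n ^+ 2) = (2 ^ n.+1).+1.
    by have := size_exp (fc_iter c n) 2; rewrite IH /= expnSr; have := expn_gt0 2 n; case: size => [|k] /=; lia.
  rewrite fc_iterS size_polyDl ?s2 //.
  by apply: leq_ltn_trans (size_polyC_leq1 _) _; rewrite ltnS expn_gt0.
by move=> h; rewrite -size_poly_gt0 h.
Qed.

(** The roots of [p] in [algC] generate a number field, which is then equipped with the splitting
    field structure. *)
Lemma splitting_field_exists (p : {poly rat}) : p != 0 ->
  exists L : splittingFieldType rat, splittingFieldFor 1%VS (map_poly (in_alg L) p) fullv.
Proof.
move=> p0; have [r hr] := closed_field_poly_normal (map_poly (ratr : rat -> algC) p).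
have [Q [QC [s hs gen]]] := num_field_exists r.
have hp : map_poly (in_alg Q) p %= \prod_(z <- s) ('X - z%:P).
  rewrite -(eqp_map QC) -map_poly_comp rmorph_prod /=.
  rewrite (eq_map_poly (g := ratr)); last by move=> x /=; rewrite -(fmorph_rat QC) alg_num_field.
  rewrite hr -hs big_map.
  have -> : \prod_(z <- s) map_poly QC ('X - z%:P) = \prod_(z <- s) ('X - (QC z)%:P).
    by apply: eq_bigr => z _; rewrite rmorphB /= map_polyX map_polyC.
  by apply: eqp_scale; rewrite lead_coef_eq0 map_poly_eq0.
have ax : SplittingField.axiom Q.
  exists (map_poly (in_alg Q) p); last by exists s.
  by apply/polyOverP => i; rewrite coef_map rpredZ ?rpred1.
pose mix := FieldExt_isSplittingField.Build _ Q ax.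
pose L : splittingFieldType rat := HB.pack Q mix.
by exists L; exists s.
Qed.

Lemma card_gal (L : splittingFieldType rat) : #|'Gal(fullv / 1%VS : {subfield L})|%g = \dim {:L}.
Proof.
rewrite -galois_dim ?dimv1 ?divn1 //.
apply/and3P; split; [exact: subvf | | exact: normalFieldf].
by apply/separableP => x _; apply: pcharf0_separable; apply: pchar_ext.
Qed.

Section SplittingData.
Variables (L : fieldExtType rat) (c : rat).
Local Notation "x %:L" := (in_alg L x) (at level 2, format "x %:L").

Lemma split_root (p q : {poly L}) (rs : seq L) : p %= \prod_(z <- rs) ('X - z%:P) ->
  q %| p -> (1 < size q)%N -> exists x, root q x.
Proof.
move=> hp qp sq; rewrite (eqp_dvdr _ hp) in qp.
have [m' hm'] := dvdp_prod_XsubC qp.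
case E : (mask m' rs) => [|x s].
  by move: (eqp_size hm') sq; rewrite E big_nil size_poly1 => ->.
exists x; rewrite (eqp_root hm') E root_prod_XsubC; exact: mem_head.
Qed.

Let P n : {poly L} := map_poly (in_alg L) (fc_iter c n).

Lemma P0 : P 0 = 'X. Proof. by rewrite /P map_polyX. Qed.
Lemma PS n : P n.+1 = P n ^+ 2 + c%:L%:P.
Proof. by rewrite /P fc_iterS rmorphD rmorphXn /= map_polyC. Qed.

Lemma P_factor n (r d : L) : r ^+ 2 = d - c%:L -> P n.+1 - d%:P = (P n - r%:P) * (P n + r%:P).
Proof.
move=> h; rewrite PS; have -> : d%:P = (r ^+ 2)%:P + c%:L%:P :> {poly L} by rewrite -polyCD h subrK.
by rewrite rmorphXn /=; ring.
Qed.

Lemma size_P n : size (P n) = (2 ^ n).+1.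
Proof.
elim: n => [|n IH]; first by rewrite P0 size_polyX.
have s2 : size (P n ^+ 2) = (2 ^ n.+1).+1.
  by have := size_exp (P n) 2; rewrite IH /= expnSr; have := expn_gt0 2 n; case: size => [|k] /=; lia.
rewrite PS size_polyDl ?s2 //.
by apply: leq_ltn_trans (size_polyC_leq1 _) _; rewrite ltnS expn_gt0.
Qed.

Lemma size_PD n (d : L) : (1 < size (P n + d%:P)%R)%N.
Proof.
have h : (1 < size (P n))%N by rewrite size_P ltnS expn_gt0.
by rewrite size_polyDl //; apply: leq_ltn_trans (size_polyC_leq1 _) h.
Qed.

Lemma root_P n d x : root (P n + d%:P) x -> (P n).[x] = - d.
Proof. by rewrite rootE hornerD hornerC addr_eq0 => /eqP. Qed.

Lemma horner_PS n x : (P n.+1).[x] = (P n).[x] ^+ 2 + c%:L.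
Proof. by rewrite PS hornerD hornerC horner_exp. Qed.

Definition base_roots (a b1 b2 : L) :=
  [/\ a ^+ 2 = - c%:L, b1 ^+ 2 = a - c%:L & b2 ^+ 2 = - a - c%:L].

Lemma split_base n rs : P n.+2 %= \prod_(z <- rs) ('X - z%:P) ->
  exists a b1 b2, base_roots a b1 b2 /\
   P n.+2 = (P n - b1%:P) * (P n + b1%:P) * ((P n - b2%:P) * (P n + b2%:P)).
Proof.
move=> hp.
have [x hx] : exists x, root (P n.+2) x.
  by apply: (split_root _ _ _ hp) => //; rewrite size_P ltnS expn_gt0.
(* [a] and [b1] are values of lower iterates at a root [x]; [b2] is such a value at a root of the
   other factor [P n.+1 + a]. *)
pose a := (P n.+1).[x]; pose b1 := (P n).[x].
have ha : a ^+ 2 = - c%:L.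
  by move: hx; rewrite rootE horner_PS addr_eq0 => /eqP.
have ha0 : a ^+ 2 = 0 - c%:L by rewrite sub0r.
have hb1 : b1 ^+ 2 = a - c%:L by rewrite /a horner_PS addrK.
have fa : P n.+2 = (P n.+1 - a%:P) * (P n.+1 + a%:P).
  by rewrite -(P_factor _ _ _ ha0) polyC0 subr0.
have [x2 /root_P hx2] : exists x, root (P n.+1 + a%:P) x.
  by apply: (split_root _ _ _ hp); [rewrite fa dvdp_mull | exact: size_PD].
pose b2 := (P n).[x2].
have hb2 : b2 ^+ 2 = - a - c%:L by rewrite -hx2 horner_PS addrK.
exists a, b1, b2; split=> //.
have -> : P n.+2 = (P n.+1 - a%:P) * (P n.+1 - (- a)%:P) by rewrite fa polyCN opprK.
by rewrite (P_factor _ _ _ hb1) (P_factor _ _ _ hb2).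
Qed.

Lemma sqr_eq_or (x y : L) : x ^+ 2 = y ^+ 2 -> x = y \/ x = - y.
Proof. by move/eqP; rewrite eqf_sqr => /orP [] /eqP; [left | right]. Qed.

Lemma full_sub (rs : seq L) (E : {subfield L}) : <<1 & rs>>%VS = fullv ->
  (forall r, r \in rs -> r \in E) -> \dim E = \dim {:L}.
Proof.
move=> h hr; congr (\dim _); apply/eqP; rewrite eqEsubv subvf -h.
by apply/Fadjoin_seqP; split; [exact: sub1v | move=> r; exact: hr].
Qed.

Lemma data2 : splittingFieldFor 1%VS (P 2) fullv ->
  exists a b1 b2, base_roots a b1 b2 /\ \dim (F2 L a b1 b2) = \dim {:L}.
Proof.
move=> [rs hp hrs]; have [a [b1 [b2 [hab fac]]]] := split_base 0 rs hp.
exists a, b1, b2; split=> //; apply: (full_sub rs) => // r rrs.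
have b2F : b2 \in F2 L a b1 b2 by exact: memv_adjoin.
have b1F : b1 \in F2 L a b1 b2.
  by apply: (subvP (subv_adjoin _ _)); exact: memv_adjoin.
have : root (P 2) r by rewrite (eqp_root hp) root_prod_XsubC.
rewrite rootE fac P0 !hornerE !mulf_eq0 !subr_eq0 !addr_eq0.
by rewrite -!orbA => /or4P [] /eqP ->; rewrite ?rpredN.
Qed.

Definition top_roots (b1 b2 g1 g2 g3 g4 : L) :=
  [/\ g1 ^+ 2 = b1 - c%:L, g2 ^+ 2 = - b1 - c%:L, g3 ^+ 2 = b2 - c%:L & g4 ^+ 2 = - b2 - c%:L].

Lemma data3 : splittingFieldFor 1%VS (P 3) fullv ->
  exists a b1 b2 g1 g2 g3 g4, [/\ base_roots a b1 b2, top_roots b1 b2 g1 g2 g3 g4 &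
    \dim (K4 L a b1 b2 g1 g2 g3 g4) = \dim {:L}].
Proof.
move=> [rs hp hrs]; have [a [b1 [b2 [hab fac]]]] := split_base 1 rs hp.
have get d : P 1 + d%:P %| P 3 -> exists g, g ^+ 2 = - d - c%:L.
  move=> hd; have [x /root_P] := split_root _ _ _ hp hd (size_PD _ _).
  by rewrite horner_PS P0 hornerX => h; exists x; rewrite -h addrK.
have [g1 hg1] : exists g, g ^+ 2 = b1 - c%:L.
  have [|g hg] := get (- b1); last by exists g; rewrite hg opprK.
  by rewrite fac polyCN; apply: dvdp_mulr; apply: dvdp_mulr; exact: dvdpp.
have [g2 hg2] : exists g, g ^+ 2 = - b1 - c%:L.
  by apply: get; rewrite fac; apply: dvdp_mulr; apply: dvdp_mull; exact: dvdpp.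
have [g3 hg3] : exists g, g ^+ 2 = b2 - c%:L.
  have [|g hg] := get (- b2); last by exists g; rewrite hg opprK.
  by rewrite fac polyCN; apply: dvdp_mull; apply: dvdp_mulr; exact: dvdpp.
have [g4 hg4] : exists g, g ^+ 2 = - b2 - c%:L.
  by apply: get; rewrite fac; apply: dvdp_mull; apply: dvdp_mull; exact: dvdpp.
exists a, b1, b2, g1, g2, g3, g4; split=> //; apply: (full_sub rs) => // r rrs.
have g4K : g4 \in K4 L a b1 b2 g1 g2 g3 g4 by exact: memv_adjoin.
have up3 := subvP (subv_adjoin (K3 L a b1 b2 g1 g2 g3) g4).
have up2 := subvP (subv_adjoin (K2 L a b1 b2 g1 g2) g3).
have up1 := subvP (subv_adjoin (K1 L a b1 b2 g1) g2).
have g3K : g3 \in K4 L a b1 b2 g1 g2 g3 g4 by apply: up3; exact: memv_adjoin.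
have g2K : g2 \in K4 L a b1 b2 g1 g2 g3 g4 by apply: up3; apply: up2; exact: memv_adjoin.
have g1K : g1 \in K4 L a b1 b2 g1 g2 g3 g4.
  by apply: up3; apply: up2; apply: up1; exact: memv_adjoin.
have : root (P 3) r by rewrite (eqp_root hp) root_prod_XsubC.
rewrite rootE fac !hornerE !horner_PS P0 hornerX !mulf_eq0.
have fin g e : r ^+ 2 + c%:L + e == 0 -> g ^+ 2 = - e - c%:L ->
    g \in K4 L a b1 b2 g1 g2 g3 g4 -> r \in K4 L a b1 b2 g1 g2 g3 g4.
  move=> h hg gK; have /sqr_eq_or [->|->] : r ^+ 2 = g ^+ 2; rewrite ?rpredN //.
  by rewrite hg; apply/eqP; rewrite -subr_eq0; move: h; congr (_ == 0); ring.
rewrite -!orbA => /or4P [] h.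
- by apply: (fin g1 (- b1)) => //; rewrite opprK.
- exact: (fin g2 b1).
- by apply: (fin g3 (- b2)) => //; rewrite opprK.
- exact: (fin g4 b2).
Qed.

(** * Upper bounds for the degrees *)

Section UpperBounds.
Variables a b1 b2 : L.
Hypothesis hab : base_roots a b1 b2.

Let F1a := F1 L a.
Let G1a := G1 L a b1.
Let F2a := F2 L a b1 b2.

Lemma dim_F1_le : (\dim F1a <= 2)%N.
Proof.
have [ha _ _] := hab; have := dim_adjoin_sqrt_le _ _ _ (a2_in L c a ha).
by rewrite dimv1.
Qed.

Lemma dim_G1_le : (\dim G1a <= 2 * \dim F1a)%N.
Proof. by have [_ h _] := hab; apply: dim_adjoin_sqrt_le; apply: (b1_2in L c a b1 h). Qed.

Lemma dim_F2_le : (\dim F2a <= 2 * \dim G1a)%N.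
Proof.
have [_ _ h] := hab; apply: dim_adjoin_sqrt_le; apply: (b2_2in L c a b2 h).
exact: subv_adjoin.
Qed.

Lemma dim_F2_le8 : (\dim F2a <= 8)%N.
Proof.
apply: leq_trans dim_F2_le _; rewrite -[8%N]/(2 * 4)%N leq_mul2l /=.
by apply: leq_trans dim_G1_le _; rewrite -[4%N]/(2 * 2)%N leq_mul2l /= dim_F1_le.
Qed.

Lemma dim_F2_a : a \in (1%AS : {subfield L}) -> (\dim F2a <= 4)%N.
Proof.
move=> h; apply: leq_trans dim_F2_le _; rewrite -[4%N]/(2 * 2)%N leq_mul2l /=.
apply: leq_trans dim_G1_le _; rewrite -[2%N]/(2 * 1)%N leq_mul2l /=.
by rewrite /F1a /F1 dim_adjoin_mem // dimv1.
Qed.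

Lemma dim_F2_prod : b1 * b2 \in F1a -> (\dim F2a <= 4)%N.
Proof.
move=> h; have [b10|b10] := eqVneq b1 0.
  apply: leq_trans dim_F2_le _; rewrite -[4%N]/(2 * 2)%N leq_mul2l /=.
  by rewrite /G1a /G1 dim_adjoin_mem ?dim_F1_le // b10 rpred0.
have b2G : b2 \in G1a.
  have -> : b2 = (b1 * b2) / b1 by rewrite mulrAC divff // mul1r.
  apply: rpred_div; last exact: memv_adjoin.
  by apply: (subvP (subv_adjoin _ _)).
rewrite /F2a /F2 dim_adjoin_mem //.
by apply: leq_trans dim_G1_le _; rewrite -[4%N]/(2 * 2)%N leq_mul2l /= dim_F1_le.
Qed.

Lemma prod_b : (b1 * b2) ^+ 2 = (c ^+ 2 + c)%:L.
Proof.
have [ha h1 h2] := hab.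
by rewrite exprMn h1 h2 (prodb L c a).
Qed.

Variables g1 g2 g3 g4 : L.
Hypothesis hg : top_roots b1 b2 g1 g2 g3 g4.

(** The eight roots of [f^3] are the [g_i] and their negatives, and their product is the constant
    term [f^3(0)]. *)
Lemma prod_g : (g1 * g2 * g3 * g4) ^+ 2 = ((c ^+ 2 + c) ^+ 2 + c)%:L.
Proof.
have [ha h1 h2] := hab; have [k1 k2 k3 k4] := hg.
rewrite !exprMn k1 k2 k3 k4.
have -> : (b1 - c%:L) * (- b1 - c%:L) * (b2 - c%:L) * (- b2 - c%:L)
  = (c%:L ^+ 2 - b1 ^+ 2) * (c%:L ^+ 2 - b2 ^+ 2) by ring.
rewrite h1 h2.
have -> : (c%:L ^+ 2 - (a - c%:L)) * (c%:L ^+ 2 - (- a - c%:L)) = (c%:L ^+ 2 + c%:L) ^+ 2 - a ^+ 2 by ring.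
by rewrite ha !(rmorphD, rmorphXn) /=; ring.
Qed.

(** One of the seven doublings is lost: the step of a vanishing [g1], [g2] or [g3], or else the last
    one, as [g4] is then a quotient of elements of [K3]. *)
Lemma dim_K4_prod : g1 * g2 * g3 * g4 \in F2a -> (\dim (K4 L a b1 b2 g1 g2 g3 g4) <= 64)%N.
Proof.
move=> h; have [ha h1 h2] := hab; have [k1 k2 k3 k4] := hg.
pose k1a := K1 L a b1 b2 g1; pose k2a := K2 L a b1 b2 g1 g2; pose k3a := K3 L a b1 b2 g1 g2 g3.
have upF : {subset F2a <= k1a} := subvP (subv_adjoin _ _).
have up1 : {subset k1a <= k2a} := subvP (subv_adjoin _ _).
have up2 : {subset k2a <= k3a} := subvP (subv_adjoin _ _).
have b2F : b2 \in F2a by exact: memv_adjoin.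
have b1F : b1 \in F2a.
  by apply: (subvP (subv_adjoin _ _)); exact: memv_adjoin.
have cF x : x%:L \in F2a by apply: alg_in.
have s1 : g1 ^+ 2 \in F2a by rewrite k1; apply: rpredB; [exact: b1F | exact: cF].
have t2 : g2 ^+ 2 \in F2a by rewrite k2; apply: rpredB; [rewrite rpredN; exact: b1F | exact: cF].
have t3 : g3 ^+ 2 \in F2a by rewrite k3; apply: rpredB; [exact: b2F | exact: cF].
have t4 : g4 ^+ 2 \in F2a by rewrite k4; apply: rpredB; [rewrite rpredN; exact: b2F | exact: cF].
have s2 : g2 ^+ 2 \in k1a := upF _ t2.
have s3 : g3 ^+ 2 \in k2a := up1 _ (upF _ t3).
have s4 : g4 ^+ 2 \in k3a := up2 _ (up1 _ (upF _ t4)).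
have d1 : (\dim k1a <= 2 * \dim F2a)%N := dim_adjoin_sqrt_le _ _ _ s1.
have d2 : (\dim k2a <= 2 * \dim k1a)%N := dim_adjoin_sqrt_le _ _ _ s2.
have d3 : (\dim k3a <= 2 * \dim k2a)%N := dim_adjoin_sqrt_le _ _ _ s3.
have d4 : (\dim (K4 L a b1 b2 g1 g2 g3 g4) <= 2 * \dim k3a)%N := dim_adjoin_sqrt_le _ _ _ s4.
have d0 := dim_F2_le8; rewrite -/F2a in d0.
have e1 : g1 \in F2a -> \dim k1a = \dim F2a := dim_adjoin_mem _ _ _.
have e2 : g2 \in k1a -> \dim k2a = \dim k1a := dim_adjoin_mem _ _ _.
have e3 : g3 \in k2a -> \dim k3a = \dim k2a := dim_adjoin_mem _ _ _.
have e4 : g4 \in k3a -> \dim (K4 L a b1 b2 g1 g2 g3 g4) = \dim k3a := dim_adjoin_mem _ _ _.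
have [z1|z1] := eqVneq g1 0.
  have := e1; rewrite z1 rpred0 => /(_ isT) E; rewrite -z1 in E *.
  by move: d0 d2 d3 d4 E; clear; lia.
have [z2|z2] := eqVneq g2 0.
  have := e2; rewrite z2 rpred0 => /(_ isT) E; rewrite -z2 in E *.
  by move: d0 d1 d3 d4 E; clear; lia.
have [z3|z3] := eqVneq g3 0.
  have := e3; rewrite z3 rpred0 => /(_ isT) E; rewrite -z3 in E *.
  by move: d0 d1 d2 d4 E; clear; lia.
have g4k : g4 \in k3a.
  have -> : g4 = (g1 * g2 * g3 * g4) / (g1 * g2 * g3) by field; rewrite z1 z2 z3.
  apply: rpred_div; first by apply: up2; apply: up1; apply: upF.
  rewrite !rpredM //; last exact: memv_adjoin.
    by apply: up2; apply: up1; exact: memv_adjoin.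
  by apply: up2; exact: memv_adjoin.
by move: (e4 g4k) d0 d1 d2 d3; clear; lia.
Qed.
End UpperBounds.
End SplittingData.

(** * Criteria for maximality and the theorem *)

(** A square value collapses one step of the tower: [- c = s^2] makes [a] rational, and
    [c^2 + c = (b1 b2)^2] puts [b1 b2] into [F1] when it is [s^2], or [(a s)^2] in the case
    [- (c + 1) = s^2]. *)
Lemma maximal2_nonsq c : gal_maximal (fc_iter c 2) 2 ->
  [/\ nonsq (- c), nonsq (c ^+ 2 + c) & nonsq (- (c + 1))].
Proof.
move=> [L [sp card]]; rewrite card_gal in card.
have [a [b1 [b2 [hab hd]]]] := data2 L c sp.
have [ha _ _] := hab.
have not4 : ~ (\dim (F2 L a b1 b2) <= 4)%N by rewrite hd card.
have notprod : ~ (b1 * b2 \in F1 L a) by move/(dim_F2_prod L c a b1 b2 hab).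
have pb := prod_b L c a b1 b2 hab.
split=> s hs.
- apply: not4; apply: (dim_F2_a L c a b1 b2 hab).
  have /sqr_eq_or [->|->] : a ^+ 2 = (in_alg L s) ^+ 2.
  + by rewrite ha -rmorphN hs rmorphM expr2.
  + exact: alg_in.
  + by rewrite rpredN; exact: alg_in.
- apply: notprod.
  have /sqr_eq_or [->|->] : (b1 * b2) ^+ 2 = (in_alg L s) ^+ 2.
  + by rewrite pb hs rmorphM expr2.
  + exact: alg_in.
  + by rewrite rpredN; exact: alg_in.
apply: notprod.
have aF : a * in_alg L s \in F1 L a by apply: rpredM; [exact: a_in1 | exact: alg_in].
have /sqr_eq_or [->|->] : (b1 * b2) ^+ 2 = (a * in_alg L s) ^+ 2; rewrite ?rpredN //.
rewrite pb exprMn ha -rmorphXn -rmorphN -rmorphM; congr (in_alg L _).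
by rewrite [s ^+ 2]expr2 -hs; ring.
Qed.

Lemma nonsq_maximal2 c : nonsq (- c) -> nonsq (c ^+ 2 + c) -> nonsq (- (c + 1)) ->
  gal_maximal (fc_iter c 2) 2.
Proof.
move=> n1 n2 n3; have [L sp] := splitting_field_exists _ (fc_iter_neq0 c 2).
exists L; split=> //; rewrite card_gal.
have [a [b1 [b2 [[ha h1 h2] <-]]]] := data2 L c sp.
exact: (dim_F2 L c a b1 b2).
Qed.

Lemma nonsq_maximal3 c : nonsq (- c) -> nonsq (c ^+ 2 + c) -> nonsq (- (c + 1)) ->
  let c3 := (c ^+ 2 + c) ^+ 2 + c in
  nonsq c3 -> nonsq (- c * c3) -> nonsq (c3 * (c ^+ 2 + c)) -> nonsq (- (c + 1) * c3) ->
  gal_maximal (fc_iter c 3) 3.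
Proof.
move=> n1 n2 n3 c3 m1 m2 m3 m4; have [L sp] := splitting_field_exists _ (fc_iter_neq0 c 3).
exists L; split=> //; rewrite card_gal.
have [a [b1 [b2 [g1 [g2 [g3 [g4 [[ha h1 h2] [k1 k2 k3 k4] <-]]]]]]]] := data3 L c sp.
exact: (dim_K4 L c a b1 b2).
Qed.

Lemma iter3E c : (c ^+ 2 + c) ^+ 2 + c = c * cg c.
Proof. by rewrite /cg; ring. Qed.

(** The square [(g1 g2 g3 g4)^2 = c g(c)] equals [(a y)^2] on [E1] and [(b1 b2 y)^2] on [E2], so the
    product already lies in [F2]. *)
Lemma piV3_not_maximal3 c : piV3 c -> ~ gal_maximal (fc_iter c 3) 3.
Proof.
move=> hV [L [sp card]]; rewrite card_gal in card.
have [a [b1 [b2 [g1 [g2 [g3 [g4 [hab hg hd]]]]]]]] := data3 L c sp.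
have [ha _ _] := hab.
suff : (\dim (K4 L a b1 b2 g1 g2 g3 g4) <= 64)%N by rewrite hd card.
apply: (dim_K4_prod L c a b1 b2 hab g1 g2 g3 g4 hg).
have pg := prod_g L c a b1 b2 hab g1 g2 g3 g4 hg.
have aF : a \in F2 L a b1 b2.
  by apply: (subvP (subv_adjoin _ _)); apply: (subvP (subv_adjoin _ _)); exact: a_in1.
have b2F : b2 \in F2 L a b1 b2 by exact: memv_adjoin.
have b1F : b1 \in F2 L a b1 b2 by apply: (subvP (subv_adjoin _ _)); exact: memv_adjoin.
have [w wF hw] : exists2 w, w \in F2 L a b1 b2 & (g1 * g2 * g3 * g4) ^+ 2 = w ^+ 2.
  rewrite pg iter3E; case: hV => y [h|h].
    exists (a * in_alg L y); first by apply: rpredM => //; exact: alg_in.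
    rewrite exprMn ha -rmorphXn -rmorphN -rmorphM; congr (in_alg L _).
    by move: h; rewrite /onE1 /cg => <-; ring.
  exists (b1 * b2 * in_alg L y).
    by apply: rpredM; [apply: rpredM | exact: alg_in].
  rewrite exprMn (prod_b L c a b1 b2 hab) -rmorphXn -rmorphM; congr (in_alg L _).
  by move: h; rewrite /onE2 /cg => <-; ring.
by have /sqr_eq_or [->|->] := hw; rewrite ?rpredN.
Qed.

Theorem theorem3 :
  (forall c : rat, S0_3 c -> piV3 c) /\
  (forall t : rat, (piV3 t /\ ~ S0_3 t) <-> (t = 0 \/ t = -2)).
Proof.
split.
  move=> c [mx2 nmx3]; have [n1 n2 n3] := maximal2_nonsq _ mx2.
  have c0 : c != 0 by have := nonsq_neq0 _ n1; rewrite oppr_eq0.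
  have c10 : c + 1 != 0 by have := nonsq_neq0 _ n3; rewrite oppr_eq0.
  apply: Classical_Prop.NNPP => nV; apply: nmx3.
  (* Four values to exclude: a square [c g] forces [c = 0]; the next two give points of [E1] and
     [E2] with [y = s / c] and [y = s / (c (c + 1))]; the last makes [- c] a square. *)
  apply: nonsq_maximal3 => // s; rewrite iter3E => e.
  - by move: c0; rewrite (mul_cg_square _ _ e) eqxx.
  - apply: nV; exists (s / c); left; rewrite /onE1 expr_div_n (expr2 s) -e /cg.
    by field.
  - apply: nV; exists (s / (c * (c + 1))); right; rewrite /onE2 expr_div_n (expr2 s) -e /cg.
    by field; rewrite c0 c10.
  have [r hr] : exists r, - c = r * r.
    apply: (mul3_cg_square c s); rewrite -e /cg; ring.
  exact: (n1 r).
move=> t; split.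
  move=> [hV nS].
  (* If none of the three values is a square, [Gal(f^2)] is maximal and [t] lies in [S0_3]. *)
  have [[s hs]|h1] := Classical_Prop.classic (exists s, - t = s * s).
    by apply: (piV3_degenerate t s hV); left.
  have [[s hs]|h2] := Classical_Prop.classic (exists s, t * (t + 1) = s * s).
    by apply: (piV3_degenerate t s hV); right; left.
  have [[s hs]|h3] := Classical_Prop.classic (exists s, - (t + 1) = s * s).
    by apply: (piV3_degenerate t s hV); right; right.
  case: nS; split; last exact: piV3_not_maximal3.
  apply: nonsq_maximal2 => s e; [apply: h1 | apply: h2 | apply: h3]; exists s => //.
  by rewrite -e; ring.
case=> ->; split.
(* At [0] the point is on [E2] and [- t = 0] is a square; at [-2] it is on [E1] and [- (t + 1) = 1]
   is a square. *)
- by exists 1; right; rewrite /onE2; ring.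
- by case=> /maximal2_nonsq [n1 _ _] _; apply: (n1 0); rewrite oppr0 mul0r.
- by exists 1; left; rewrite /onE1; ring.
- by case=> /maximal2_nonsq [_ _ n3] _; apply: (n3 1); ring.
Qed.
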